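(* Let $0.046\le p<1/2$ be the transition probability of the binary symmetric channel. Then the channel reliability satisfies $E(R,p)=E_0(R,p)$ for all $R_1\le R\le R_{\mathrm{crit}}$.
   Context: Logarithms base 2, $h$ binary entropy, $D(x\|y)=x\log\frac xy+(1-x)\log\frac{1-x}{1-y}$. For a binary code $C\subseteq\{0,1\}^n$ of size $M$, its rate is $\frac1n\log M$ and $P_e(C,p)$ is its average probability of error under maximum-likelihood decoding on the BSC with crossover probability $p$. The reliability function is $E(R,p)=\limsup_{n\to\infty}\frac1n\log\max_{C\subseteq\{0,1\}^n,\,R(C)=R}\frac1{P_e(C,p)}$. Let $\rho=\frac{\sqrt p}{\sqrt p+\sqrt{1-p}}$, $R_{\mathrm{crit}}=1-h(\rho)$, $E_0(R,p)=D(\rho\|p)+R_{\mathrm{crit}}-R$, $\delta_1=2\rho(1-\rho)$. Let $\tau_\nu(\xi)=\frac12\Big(1-\sqrt{1-4\big(\sqrt{\nu(1-\nu)-\xi(1-\xi)}-\xi\big)^2}\Big)$, $\bar R(\delta)=1+\min_{\frac12(1-\sqrt{1-2\delta})\le\alpha\le\frac12}\big(h(\tau_\alpha(\delta/2))-h(\alpha)\big)$, and $R_1=\bar R(\delta_1)$.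
   Formalization: In the definition of E(R,p), the maximum is taken over codes of rate at least R instead of exactly R, since for most R no code has rate exactly R; this is the same as using codes with ⌈2^{nR}⌉ codewords. *)

(* Defs.v *)
From HB Require Import structures.
From mathcomp Require Import all_boot all_order all_algebra.
From mathcomp Require Import all_classical all_reals all_analysis.
Set Implicit Arguments. Unset Strict Implicit. Unset Printing Implicit Defensive.
Import Order.TTheory GRing.Theory Num.Theory.
Local Open Scope ring_scope.

Section BSC.
Variable R : realType.

(* logarithm base 2; note ln x = 0 for x <= 0, so x * log2 x = 0 at x = 0 *)
Definition log2 (x : R) : R := ln x / ln 2.

Definition h (x : R) : R := - (x * log2 x) - (1 - x) * log2 (1 - x).

Definition Dkl (x y : R) : R :=
  x * log2 (x / y) + (1 - x) * log2 ((1 - x) / (1 - y)).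

Definition rho (p : R) : R := Num.sqrt p / (Num.sqrt p + Num.sqrt (1 - p)).
Definition Rcrit (p : R) : R := 1 - h (rho p).
Definition E0 (Rt p : R) : R := Dkl (rho p) p + Rcrit p - Rt.
Definition delta1 (p : R) : R := 2 * rho p * (1 - rho p).

Definition tau (nu xi : R) : R :=
  (1 - Num.sqrt (1 - 4 * (Num.sqrt (nu * (1 - nu) - xi * (1 - xi)) - xi) ^+ 2)) / 2.

(* Rbar(delta) = 1 + min over alpha in [(1 - sqrt(1-2 delta))/2, 1/2]
   of h(tau_alpha(delta/2)) - h(alpha)  (min taken as inf; it is attained) *)
Definition Rbar (delta : R) : R :=
  1 + inf [set h (tau alpha (delta / 2)) - h alpha | alpha in
             [set a : R | (1 - Num.sqrt (1 - 2 * delta)) / 2 <= a <= 1 / 2]]%classic.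

Definition R1 (p : R) : R := Rbar (delta1 p).

Definition hdist (n : nat) (x y : n.-tuple bool) : nat :=
  (\sum_(i < n) (tnth x i != tnth y i))%N.

Definition W (p : R) (n : nat) (y x : n.-tuple bool) : R :=
  p ^+ hdist x y * (1 - p) ^+ (n - hdist x y).

(* Average error probability of ML decoding of the code C on BSC(p):
   1 - (1/M) sum_y max_{c in C} W(y|c); this is the same for every ML
   tie-breaking rule. *)
Definition Pe (n : nat) (C : {set n.-tuple bool}) (p : R) : R :=
  1 - (#|C|%:R)^-1 * \sum_(y : n.-tuple bool) \big[Num.max/0]_(c in C) W p y c.

Definition rate (n : nat) (C : {set n.-tuple bool}) : R := log2 (#|C|%:R) / n%:R.

Definition exponent (n : nat) (C : {set n.-tuple bool}) (p : R) : \bar R :=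
  if 0 < Pe C p then ((- log2 (Pe C p)) / n%:R)%:E else +oo%E.

Definition best_exponent (Rt p : R) (n : nat) : \bar R :=
  \big[Order.max/-oo%E]_(C : {set n.-tuple bool} | Rt <= rate C) exponent C p.

Definition reliability (Rt p : R) : \bar R := limn_esup (best_exponent Rt p).

End BSC.

(* Main.v *)
Require Import Defs.
From HB Require Import structures.
From mathcomp Require Import all_boot all_order all_algebra.
From mathcomp Require Import all_classical all_reals all_analysis.
From mathcomp Require Import zify ring lra.
Set Implicit Arguments. Unset Strict Implicit. Unset Printing Implicit Defensive.
Import Order.TTheory GRing.Theory Num.Theory.
Local Open Scope ring_scope.

(** Put [x = 1 - 2 rho], so that [E0 (R) = ln (1 + x^2) - R] in nats, and let
    [s] solve [x^2 = 2 s / (1 + s^2)].  A calculus inequality shows that [R1] is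
    at least the entropy [htau s] of [s^2 / (1 + s^2)], which is the first linear
    programming rate at relative distance [delta1].

    Achievability: a greedy code of size [M] has Bhattacharyya sum at most
    [2 M^2 (1 + x^2)^-n], which bounds its error probability.

    Converse at rate [htau s]: a Krawtchouk test function supported on a short
    window of weights shows that some distance [w <= (delta1 + o(1)) n] has, for many
    codewords, about [|C| 2^-n (1 + gamma)^n gamma^-w] neighbours, where
    [gamma = 2 sqrt (p (1 - p))].  Taking the least such [w] for a decreasing chain of
    subcodes bounds the number of neighbours at every smaller distance.  The error
    events towards the [w]-neighbours are approximated by the points equidistant, at
    the typical radius, from both codewords; a Chernoff bound for triples shows that
    these sets overlap little for [p >= 0.046], so a second moment bound makes their
    union as large as the sum of the parts.

    Rates between [htau s] and [Rcrit]: split the coordinates in two blocks.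
    Around each prefix, collect the codewords on the typical sphere; their suffixes
    form a family to which the converse at rate [htau s] applies (straight line
    argument). *)

(** * The Hamming cube *)

(** The converse has to match a union bound, so the obstacle is the overlap of the error events
    towards the neighbours of one codeword. The number of [w]-neighbours times gamma^w, the
    probability of each event, is about |C| (1 + x^2)^-n for every [w], because (1 + gamma)(1 + x^2)
    = 2. The greedy code achieves the same, so the final bound does not depend on [w]. Overlaps grow
    as two neighbours approach each other, hence the need to count neighbours at all distances below
    [w]. The worst triangle is the equilateral one with sides [delta1] n; there the exponent depends
    on [s] alone, and it has the right sign for s <= 3/14. At s = 3/14 one has gamma = 121/289, just
    below 2 sqrt(0.046 (1 - 0.046)): this is where the bound on [p] enters. It enters again through
    [delta1] >= 59/200, which makes alpha = 1/2 a minimiser in the definition of [R1], with the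
    first linear programming rate as value. Exponents are computed in nats; [ln 2] appears only when
    the definitions in bits are reached. *)

Lemma sum_tuple_prod (S : comNzRingType) (n : nat) (F : 'I_n -> bool -> S) :
  \sum_(z : n.-tuple bool) \prod_(i < n) F i (tnth z i) =
  \prod_(i < n) (F i false + F i true).
Proof.
transitivity (\prod_(i < n) \sum_(b : bool) F i b); last first.
  by apply: eq_bigr => i _; rewrite big_bool addrC.
rewrite bigA_distr_bigA (reindex (fun f : {ffun 'I_n -> bool} => [tuple f i | i < n])).
  apply: eq_bigr => f _; apply: eq_bigr => i _; by rewrite tnth_mktuple.
exists (fun z : n.-tuple bool => [ffun i => tnth z i]) => z _.
  by apply/ffunP => i; rewrite ffunE tnth_mktuple.
by apply: eq_from_tnth => i; rewrite tnth_mktuple ffunE.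
Qed.

Section Cube.
Variable n : nat.
Implicit Types x y z u v : n.-tuple bool.

Definition wt u : nat := (\sum_(i < n) tnth u i)%N.

Lemma wt_le u : (wt u <= n)%N.
Proof.
apply: (@leq_trans (\sum_(i < n) 1)%N); first by apply: leq_sum => i _; case: (tnth u i).
by rewrite sum_nat_const card_ord muln1.
Qed.

Definition flip x (B : {set 'I_n}) : n.-tuple bool :=
  [tuple tnth x i (+) (i \in B) | i < n].

Definition dset x y : {set 'I_n} := [set i | tnth x i != tnth y i].

Lemma hdistE x y : hdist x y = #|dset x y|.
Proof.
rewrite /hdist -sum1_card [RHS]big_mkcond /=; apply: eq_bigr => i _.
by rewrite inE; case: (_ != _).
Qed.

Lemma hdistC x y : hdist x y = hdist y x.
Proof. by apply: eq_bigr => i _; rewrite eq_sym. Qed.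

Lemma hdist_le x y : (hdist x y <= n)%N.
Proof. by rewrite hdistE -[X in (_ <= X)%N]card_ord max_card. Qed.

Lemma hdistxx x : hdist x x = 0%N.
Proof. by rewrite /hdist big1 // => i _; rewrite eqxx. Qed.

Lemma hdist_eq0 x y : (hdist x y == 0%N) = (x == y).
Proof.
apply/idP/eqP => [|->]; last by rewrite hdistxx.
rewrite sum_nat_eq0 => /forallP h; apply: eq_from_tnth => i.
by move: (h i); rewrite /= eqb0 negbK => /eqP.
Qed.

(** Used to pass to codewords of one weight parity: their distances are even, so that points halfway
    between two of them exist. *)
Lemma odd_hdist x y : odd (hdist x y) = odd (wt x) (+) odd (wt y).
Proof.
rewrite /hdist /wt !(big_morph odd oddD (erefl _)) -big_split /=.
by apply: eq_bigr => i _; do 2 case: (tnth _ _).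
Qed.

Lemma dset_flip x B : dset x (flip x B) = B.
Proof.
apply/setP => i; rewrite inE tnth_mktuple.
by case: (tnth x i); case: (i \in B).
Qed.

Lemma expr_hdist (S : comNzRingType) (a b : S) x z :
  a ^+ hdist x z * b ^+ (n - hdist x z) =
  \prod_(i < n) (if tnth x i != tnth z i then a else b).
Proof.
rewrite (bigID (fun i => tnth x i != tnth z i)) /=; congr (_ * _).
  rewrite (eq_bigr (fun=> a)) => [|i ->//]; rewrite prodr_const hdistE.
  by congr (_ ^+ _); apply: eq_card => i; rewrite inE.
rewrite (eq_bigr (fun=> b)) => [|i /negbTE ->//]; rewrite prodr_const hdistE.
have -> : (n - #|dset x z| = #|~: dset x z|)%N by rewrite [RHS]cardsCs finset.setCK card_ord.
by congr (_ ^+ _); apply: eq_card => i; rewrite !inE.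
Qed.

Variable R : realType.

Definition chi u x : R := \prod_(i < n) (if tnth u i && tnth x i then -1 else 1).

Lemma chi_sqr u x : chi u x * chi u x = 1.
Proof.
rewrite -big_split /= big1 // => i _.
by case: ifP => _; rewrite ?mulr1 ?mulrNN ?mulr1.
Qed.

(** The Krawtchouk polynomial K_j(d), encoded through its generating function: recurrences become
    identities between polynomials and their derivatives, and no alternating sum of binomials is
    needed. *)
Definition kraw (j d : nat) : R := ((1 - 'X) ^+ d * (1 + 'X) ^+ (n - d) : {poly R})`_j.

Lemma sum_chi_poly x y :
  \sum_(u : n.-tuple bool) (chi u x * chi u y) *: 'X^(wt u) =
  (1 - 'X) ^+ hdist x y * (1 + 'X) ^+ (n - hdist x y) :> {poly R}.
Proof.
rewrite expr_hdist.
pose F (i : 'I_n) (b : bool) : {poly R} :=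
  if b then (if tnth x i != tnth y i then -1 else 1) *: 'X else 1.
transitivity (\sum_(u : n.-tuple bool) \prod_(i < n) F i (tnth u i)).
  apply: eq_bigr => u _; rewrite /wt -prodrXr -big_split /= -scaler_prod.
  apply: eq_bigr => i _; rewrite /F; case: (tnth u i) => /=.
    by rewrite expr1; do 2 case: (tnth _ i) => /=; rewrite ?mulrNN ?mul1r ?mulr1 ?mulN1r ?opprK.
  by rewrite mulr1 scale1r expr0.
rewrite sum_tuple_prod; apply: eq_bigr => i _; rewrite /F.
by case: ifP => _; rewrite ?scaleN1r ?scale1r.
Qed.

(** Being a sum of products of characters, K_j of the distance is a positive semidefinite kernel on
    the cube; the linear programming bound rests on this positivity. *)
Lemma sum_chi_kraw j x y :
  \sum_(u : n.-tuple bool | wt u == j) chi u x * chi u y = kraw j (hdist x y).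
Proof.
rewrite /kraw -sum_chi_poly coef_sum big_mkcond /=; apply: eq_bigr => u _.
by rewrite coefZ coefXn eq_sym; case: eqP; rewrite ?mulr1 ?mulr0.
Qed.

Lemma sum_radial (G : nat -> R) (f : n.-tuple bool -> R) :
  \sum_(u : n.-tuple bool) G (wt u) * f u =
  \sum_(j < n.+1) G j * \sum_(u : n.-tuple bool | wt u == j) f u.
Proof.
under [RHS]eq_bigr do rewrite mulr_sumr big_mkcond /=.
rewrite exchange_big /=; apply: eq_bigr => u _.
have hu : (wt u < n.+1)%N by rewrite ltnS wt_le.
rewrite (bigD1 (Ordinal hu)) //= eqxx big1 ?addr0 // => j /eqP hj.
by case: eqP => // e; case: hj; apply: val_inj.
Qed.

Lemma krawj0 j : kraw j 0 = 'C(n, j)%:R.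
Proof.
rewrite /kraw expr0 mul1r subn0 exprDn coef_sum.
under eq_bigr do rewrite expr1n mul1r -mulr_natr -polyC_natr mulrC mul_polyC coefZ coefXn.
case: (leqP j n) => hj.
  rewrite (bigD1 (inord j)) //= inordK ?ltnS // eqxx mulr1 big1 ?addr0 // => i /eqP hi.
  case: eqP => e; rewrite ?mulr0 //; case: hi; apply: val_inj => /=.
  by rewrite inordK.
rewrite bin_small // big1 // => i _; case: eqP => e; rewrite ?mulr0 //.
by move: (ltn_ord i); rewrite -e ltnS leqNgt hj.
Qed.

Lemma card_wt j : #|[pred u : n.-tuple bool | wt u == j]| = 'C(n, j).
Proof.
apply/eqP; rewrite -(eqr_nat R) -krawj0 -(hdistxx [tuple of nseq n false]) -sum_chi_kraw.
by rewrite -sum1_card natr_sum; apply/eqP; apply: eq_bigr => u _; rewrite chi_sqr.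
Qed.

End Cube.

(** * Krawtchouk polynomials *)

Section Krawtchouk.
Variables (R : realType) (n : nat).

Local Notation K := (@kraw n R).
Local Notation P d := ((1 - 'X) ^+ d * (1 + 'X) ^+ (n - d) : {poly R}).

Lemma kraw_recd j d : (d.+1 < n)%N ->
  (n - d.+1)%:R * K j d.+2 = (n%:R - 2 * j%:R) * K j d.+1 - d.+1%:R * K j d.
Proof.
move=> dn; have [e ne] : exists e, n = (d + e).+2.
  by exists (n - d.+2)%N; lia.
have eqP : (n - d.+1)%:R *: P d.+2 = n%:R *: P d.+1 - 2 *: ('X * (P d.+1)^`()) - d.+1%:R *: P d.
  have -> : (n - d.+1 = e.+1)%N by lia.
  have -> : (n - d.+2 = e)%N by lia.
  have -> : (n - d = e.+2)%N by lia.
  rewrite derivM !deriv_exp !derivB !derivD derivX derivC /= ?add0r ?sub0r.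
  rewrite -!mul_polyC !polyC_natr ne !exprS.
  by ring.
have := congr1 (fun q : {poly R} => q`_j) eqP; rewrite /kraw !(coefB, coefZ, coefXM) => ->.
by case: j => [|j] /=; rewrite ?coef_deriv; ring.
Qed.

Lemma kraw_rec1 j : (0 < n)%N -> n%:R * K j 1 = (n%:R - 2 * j%:R) * K j 0.
Proof.
case: n => // m _.
have eqP : m.+1%:R *: ((1 - 'X) ^+ 1 * (1 + 'X) ^+ (m.+1 - 1)) =
    m.+1%:R *: ((1 - 'X) ^+ 0 * (1 + 'X) ^+ (m.+1 - 0)) -
    2 *: ('X * ((1 - 'X) ^+ 0 * (1 + 'X) ^+ (m.+1 - 0))^`()) :> {poly R}.
  rewrite subn1 subn0 expr0 expr1 !mul1r /=.
  rewrite !deriv_exp !derivD derivX derivC /= !add0r.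
  by rewrite -!mul_polyC !polyC_natr !exprS; ring.
have := congr1 (fun q : {poly R} => q`_j) eqP; rewrite /kraw !(coefB, coefZ, coefXM) => ->.
by case: j => [|j] /=; rewrite ?coef_deriv; ring.
Qed.

(** Coefficient of X^(j+1) in the differential equation (1 - X^2) P' = (n - 2d - n X) P of the
    generating function. Multiplication by n - 2d thus acts on Krawtchouk expansions as a
    tridiagonal operator. *)
Lemma kraw_recj j d : (d <= n)%N ->
  j.+2%:R * K j.+2 d + (n%:R - j%:R) * K j d = (n%:R - 2 * d%:R) * K j.+1 d.
Proof.
move=> dn; have [e ne] : exists e, n = (d + e)%N by exists (n - d)%N; lia.
have eqP : (1 - 'X ^+ 2) * (P d)^`() = ((n%:R - 2 * d%:R)%:P - n%:R *: 'X) * P d.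
  have -> : (n - d = e)%N by lia.
  rewrite ne natrD polyCB polyCM !polyCD !polyC_natr.
  case: d {ne dn} => [|d]; case: e => [|e]; rewrite ?expr0 ?mulr1 ?mul1r ?derivM ?deriv_exp ?derivB ?derivD ?derivX ?derivC /= ?derivC;
  by rewrite -?mul_polyC ?polyC_natr ?exprS ?mulr0 ?mul0r; ring.
have := congr1 (fun q : {poly R} => q`_j.+1) eqP.
rewrite mulrBl mul1r mulrBl !coefB coefCM expr2 -mulrA -scalerAl !coefZ !coefXM /= !coef_deriv.
rewrite -/(K j.+2 d) -/(K j.+1 d).
case: j => [|j] /=; rewrite ?coef_deriv /kraw => h; first by lra.
rewrite -[j.+2]addn1 -[j.+1]addn1 !natrD in h *; lra.
Qed.

Lemma kraw_rec0 d : (d <= n)%N -> K 1 d = (n%:R - 2 * d%:R) * K 0 d.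
Proof.
move=> dn.
have c0 m (s : R) : ((1 + s *: 'X) ^+ m : {poly R})`_0 = 1.
  by rewrite -horner_coef0 horner_exp !hornerE; rewrite ?mulr0 ?addr0 expr1n.
have c1 m (s : R) : ((1 + s *: 'X) ^+ m : {poly R})`_1 = s * m%:R.
  elim: m => [|m IH]; first by rewrite expr0 coefC mulr0.
  rewrite exprS mulrDl mul1r coefD IH -scalerAl coefZ coefXM /= c0 -[m.+1]addn1 natrD; ring.
have e1 : (1 - 'X : {poly R}) = 1 + (-1) *: 'X by rewrite scaleN1r.
have e2 : (1 + 'X : {poly R}) = 1 + 1 *: 'X by rewrite scale1r.
rewrite /kraw e1 e2 !coefM !big_ord_recr !big_ord0 /= ?subn0 ?subnn.
by rewrite !c0 !c1 natrB //; ring.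
Qed.

Lemma kraw_gt d j : (d <= n)%N -> (n < j)%N -> K j d = 0.
Proof.
move=> dn nj; rewrite /kraw nth_default //.
have s1 m : (size ((1 - 'X : {poly R}) ^+ m) <= m.+1)%N.
  apply: leq_trans (size_poly_exp_leq _ _) _; rewrite ltnS -[X in (_ <= X)%N]mul1n leq_mul2r.
  apply/orP; right; rewrite -ltnS prednK; last by rewrite lt0n size_poly_eq0 -size_poly_eq0 -opprB size_polyN -polyC1 size_XsubC.
  by rewrite -opprB size_polyN -polyC1 size_XsubC.
have s2 m : (size ((1 + 'X : {poly R}) ^+ m) <= m.+1)%N.
  apply: leq_trans (size_poly_exp_leq _ _) _; rewrite ltnS -[X in (_ <= X)%N]mul1n leq_mul2r.
  by rewrite addrC -polyC1 size_XaddC /= orbT.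
apply: leq_trans (size_polyMleq _ _) _.
by move: (s1 d) (s2 (n - d)%N); move: (size _) (size _) => a b; lia.
Qed.

Lemma sum_chi_ortho (u v : n.-tuple bool) :
  \sum_(x : n.-tuple bool) chi R u x * chi R v x = if u == v then 2 ^+ n else 0.
Proof.
pose F (i : 'I_n) (b : bool) : R :=
  (if tnth u i && b then -1 else 1) * (if tnth v i && b then -1 else 1).
transitivity (\sum_(x : n.-tuple bool) \prod_(i < n) F i (tnth x i)).
  by apply: eq_bigr => x _; rewrite -big_split.
rewrite sum_tuple_prod /F {F}; case: eqVneq => [->|uv].
  rewrite -[n in RHS]card_ord -prodr_const; apply: eq_bigr => i _.
  by case: (tnth v i) => /=; rewrite ?mulrNN !mulr1.
have [i hi] : exists i, tnth u i != tnth v i.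
  apply/existsP; apply: contraR uv; rewrite negb_exists => /forallP h.
  by apply/eqP/eq_from_tnth => i; apply/eqP; rewrite -[_ == _]negbK h.
rewrite (bigD1 i) //= (_ : _ + _ = 0) ?mul0r //.
by move: hi; do 2 case: (tnth _ i) => //=; rewrite ?mulr1 ?mul1r subrr.
Qed.

(** By orthogonality of characters the square norm of [K j] over the cube is 2^n C(n, j); only the
    C(n, d) points at distance [d] from the origin are kept. *)
Lemma kraw_parseval j d : (K j d) ^+ 2 * 'C(n, d)%:R <= 2 ^+ n * 'C(n, j)%:R.
Proof.
pose o : n.-tuple bool := [tuple of nseq n false].
have chio u : chi R u o = 1.
  by rewrite /chi big1 // => i _; rewrite tnth_nseq andbF.
have wto x : hdist x o = wt x.
  by apply: eq_bigr => i _; rewrite tnth_nseq; case: (tnth x i).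
have -> : 2 ^+ n * 'C(n, j)%:R = \sum_(x : n.-tuple bool) (K j (hdist x o)) ^+ 2.
  under eq_bigr => x _.
    rewrite -sum_chi_kraw expr2 big_distrlr /=.
    under eq_bigr do under eq_bigr do rewrite !chio !mulr1. over.
  rewrite /= exchange_big /=.
  under eq_bigr do rewrite exchange_big /=.
  under eq_bigr do under eq_bigr do rewrite sum_chi_ortho.
  rewrite (eq_bigr (fun=> 2 ^+ n)); last first.
    move=> u hu; rewrite (bigD1 u) //= eqxx big1 ?addr0 // => v.
    by move=> /andP[_ /negbTE]; rewrite eq_sym => ->.
  rewrite sumr_const -(card_wt n R j) mulr_natr.
  by congr (_ *+ _); apply: eq_card => u; rewrite !inE.
rewrite (bigID (fun x => wt x == d)) /=.
rewrite (eq_bigr (fun=> K j d ^+ 2)); last by move=> x /eqP hx; rewrite wto hx.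
rewrite sumr_const -(card_wt n R d) mulr_natr.
set A := (X in _ *+ X <= _); set B := (X in _ <= _ *+ X + _).
have -> : A = B by apply: eq_card => u; rewrite !inE.
by rewrite lerDl sumr_ge0 // => x _; rewrite sqr_ge0.
Qed.

(* The three-term recurrence propagates the ratio bound s as long as s lies
   between the two roots of (n - d) r^2 - (n - 2j) r + d. *)
Lemma kraw_ratio (s dl : R) j d : 0 < s -> s <= 1 -> (j <= n)%N ->
  (n%:R - 2 * j%:R) * s >= n%:R * (s ^+ 2 * (1 - dl) + dl) ->
  d%:R <= dl * n%:R -> (d < n)%N -> 0 < K j d /\ s * K j d <= K j d.+1.
Proof.
move=> s0 s1 jn hj; elim: d => [|d IH] hd dn.
  have n0 : (0 < n)%N by [].
  have n0R : (0 : R) < n%:R by rewrite ltr0n.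
  split; first by rewrite krawj0 ltr0n bin_gt0.
  have K0 : 0 <= K j 0 by rewrite krawj0 ler0n.
  rewrite -(ler_pM2l n0R) kraw_rec1 // mulrA ler_wpM2r //.
  rewrite -(ler_pM2r s0) (le_trans _ hj) // -mulrA ler_wpM2l ?ler0n //.
  have dl0 : 0 <= dl by move: hd; rewrite pmulr_lge0.
  have s2 : s ^+ 2 <= 1 by rewrite expr_le1 // ltW.
  by rewrite -expr2; nra.
have hd1 : d%:R <= dl * n%:R by apply: le_trans hd; rewrite ler_nat.
have [K0 K1] := IH hd1 (ltnW dn).
have K1' : 0 < K j d.+1 by apply: lt_le_trans K1; rewrite mulr_gt0.
split=> //.
have nd : (0 : R) < (n - d.+1)%:R by rewrite ltr0n subn_gt0.
rewrite -(ler_pM2l nd) kraw_recd // -(ler_pM2r s0) natrB 1?ltnW //.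
set D := d.+1%:R in hd *; set N := n%:R in hd hj *.
have D0 : 0 <= D by rewrite ler0n.
have e1 : D * (s * K j d) <= D * K j d.+1 by rewrite ler_wpM2l.
have e2 : (N * (s ^+ 2 * (1 - dl) + dl)) * K j d.+1 <= (N - 2 * j%:R) * s * K j d.+1.
  by rewrite ler_wpM2r // ltW.
have e3 : (N - D) * s ^+ 2 + D <= N * (s ^+ 2 * (1 - dl) + dl).
  have s2 : s ^+ 2 <= 1 by rewrite expr_le1 // ltW.
  by have : D * (1 - s ^+ 2) <= dl * N * (1 - s ^+ 2); [rewrite ler_wpM2r // subr_ge0|lra].
have e4 : ((N - D) * s ^+ 2 + D) * K j d.+1 <= (N * (s ^+ 2 * (1 - dl) + dl)) * K j d.+1.
  by rewrite ler_wpM2r // ltW.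
lra.
Qed.

End Krawtchouk.

(** Lagrange's identity: the right side minus the left is half of a double sum of squares with
    positive weights. *)
Lemma weighted_cauchy_schwarz (R : realFieldType) (I : finType) (P : pred I) (a b c : I -> R) :
  (forall i, P i -> 0 < c i) ->
  (\sum_(i | P i) a i * b i) ^+ 2 <=
  (\sum_(i | P i) a i ^+ 2 * c i) * (\sum_(i | P i) b i ^+ 2 / c i).
Proof.
move=> c0.
have h : 0 <= \sum_(i | P i) \sum_(j | P j) c i * c j * (a i * (b j / c j) - a j * (b i / c i)) ^+ 2.
  apply: sumr_ge0 => i Pi; apply: sumr_ge0 => j Pj.
  by rewrite mulr_ge0 ?sqr_ge0 // mulr_ge0 // ltW // c0.
set A := \sum_(i | P i) a i ^+ 2 * c i; set B := \sum_(i | P i) b i ^+ 2 / c i.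
set S := \sum_(i | P i) a i * b i.
suff e : \sum_(i | P i) \sum_(j | P j) c i * c j * (a i * (b j / c j) - a j * (b i / c i)) ^+ 2
    = 2 * (A * B - S ^+ 2) by rewrite -subr_ge0; move: h; rewrite e; lra.
transitivity (\sum_(i | P i) \sum_(j | P j) ((a i ^+ 2 * c i) * (b j ^+ 2 / c j)
    + (b i ^+ 2 / c i) * (a j ^+ 2 * c j) - 2 * ((a i * b i) * (a j * b j)))).
  apply: eq_bigr => i Pi; apply: eq_bigr => j Pj.
  have ci := c0 i Pi; have cj := c0 j Pj.
  by field; rewrite !gt_eqF.
have e1 i : \sum_(j | P j) ((a i ^+ 2 * c i) * (b j ^+ 2 / c j)
    + (b i ^+ 2 / c i) * (a j ^+ 2 * c j) - 2 * ((a i * b i) * (a j * b j)))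
  = (a i ^+ 2 * c i) * B + (b i ^+ 2 / c i) * A - 2 * S * (a i * b i).
  rewrite sumrB big_split /= -!mulr_sumr -/A -/B -/S; ring.
under eq_bigr do rewrite e1.
rewrite sumrB big_split /= -!mulr_suml -mulr_sumr -/A -/B -/S; ring.
Qed.

(** * The linear programming inequality *)

Section LP.
Variables (R : realType) (n : nat).
Implicit Types (Z : {set n.-tuple bool}) (G A : nat -> R).
Local Notation K := (@kraw n R).
Local Notation chi := (@chi n R).

(** The product of the two kernels expands over pairs of characters into the squares [c u v ^+ 2]
    with nonnegative weights. Only the terms u = v are kept, where [c u u] is the size of [Z]. *)
Lemma lp_positive Z G A : (forall j, 0 <= G j) -> (forall j, (j <= n)%N -> 0 <= A j) ->
  #|Z|%:R ^+ 2 * \sum_(j < n.+1) A j * G j * 'C(n, j)%:R <=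
  \sum_(x in Z) \sum_(y in Z)
    (\sum_(j < n.+1) A j * K j (hdist x y)) * (\sum_(j < n.+1) G j * K j (hdist x y)).
Proof.
move=> G0 A0.
have kE (H : nat -> R) (x y : n.-tuple bool) : \sum_(j < n.+1) H j * K j (hdist x y)
    = \sum_(u : n.-tuple bool) H (wt u) * (chi u x * chi u y).
  by rewrite sum_radial; apply: eq_bigr => j _; rewrite sum_chi_kraw.
pose c u v : R := \sum_(x in Z) chi u x * chi v x.
have -> : \sum_(x in Z) \sum_(y in Z)
    (\sum_(j < n.+1) A j * K j (hdist x y)) * (\sum_(j < n.+1) G j * K j (hdist x y)) =
    \sum_(u : n.-tuple bool) \sum_(v : n.-tuple bool) A (wt u) * G (wt v) * (c u v) ^+ 2.
  under eq_bigr do under eq_bigr do rewrite !kE big_distrlr /=.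
  under eq_bigr do rewrite exchange_big /=.
  rewrite exchange_big /=; apply: eq_bigr => u _.
  under eq_bigr do rewrite exchange_big /=.
  rewrite exchange_big /=; apply: eq_bigr => v _.
  rewrite /c expr2 big_distrlr /= mulr_sumr; apply: eq_bigr => x _.
  by rewrite mulr_sumr; apply: eq_bigr => y _; ring.
have -> : \sum_(j < n.+1) A j * G j * 'C(n, j)%:R = \sum_(u : n.-tuple bool) A (wt u) * G (wt u) * 1.
  rewrite (sum_radial (fun j => A j * G j)); apply: eq_bigr => j _.
  by rewrite -(card_wt n R j) -sum1_card natr_sum.
rewrite mulr_sumr; apply: ler_sum => u _; rewrite (bigD1 u) //= -[leLHS]addr0.
apply: lerD; last first.
  by apply: sumr_ge0 => v _; rewrite mulr_ge0 ?sqr_ge0 // mulr_ge0 // A0 // wt_le.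
have -> : c u u = #|Z|%:R; last by lra.
by rewrite /c -sum1_card natr_sum; apply: eq_bigr => x _; rewrite chi_sqr.
Qed.

(** The action on Krawtchouk coefficients of multiplication by n - 2d - l. At j = 0 the default
    [0.-1 = 0] is harmless, its term being multiplied by 0. *)
Definition shiftop (l : R) G j := j%:R * G j.-1 + (n%:R - j%:R) * G j.+1 - l * G j.

Lemma shiftop_kraw l G d : (d <= n)%N ->
  \sum_(j < n.+1) shiftop l G j * K j d = (n%:R - 2 * d%:R - l) * \sum_(j < n.+1) G j * K j d.
Proof.
move=> dn.
have -> : \sum_(j < n.+1) shiftop l G j * K j d =
   \sum_(j < n.+1) j%:R * G j.-1 * K j d + \sum_(j < n.+1) (n%:R - j%:R) * G j.+1 * K j d
    - l * \sum_(j < n.+1) G j * K j d.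
  rewrite mulr_sumr -big_split -sumrB /=; apply: eq_bigr => j _; rewrite /shiftop; ring.
rewrite mulrBl; congr (_ - _).
rewrite big_ord_recl /= !mul0r add0r [X in _ + X]big_ord_recr /= subrr !mul0r addr0.
under eq_bigr do rewrite /bump /= add1n.
have e : \sum_(i < n) i.+1%:R * G i * K i.+1 d =
    G 0%N * K 1 d + \sum_(i < n) i.+2%:R * G i.+1 * K i.+2 d.
  transitivity (\sum_(i < n.+1) i.+1%:R * G i * K i.+1 d).
    by rewrite big_ord_recr /= kraw_gt // mulr0 addr0.
  by rewrite big_ord_recl /= mul1r; congr (_ + _).
rewrite e kraw_rec0 // [in RHS]big_ord_recl /= mulrDr -addrA -big_split /=.
congr (_ + _); first by ring.
rewrite mulr_sumr; apply: eq_bigr => i _; rewrite /bump /= add1n.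
have := kraw_recj R i dn => h.
transitivity (G i.+1 * (i.+2%:R * K i.+2 d + (n%:R - i%:R) * K i d)); first by ring.
by rewrite h; ring.
Qed.

(* The weights s^j i (m + 1 - i), for j = b + i: the quadratic factor makes the
   truncated sequence an approximate eigenvector of [shiftop]. *)
Definition window (s : R) (b m j : nat) : R :=
  if (b <= j <= (b + m).+1)%N
  then s ^+ j * ((j%:R - b%:R) * (b%:R + m%:R + 1 - j%:R)) else 0.

Lemma window_ge0 (s : R) b m j : 0 < s -> 0 <= window s b m j.
Proof.
move=> s0; rewrite /window; case: ifP => // /andP[h1 h2].
apply: mulr_ge0; first by rewrite exprn_ge0 // ltW.
apply: mulr_ge0; rewrite subr_ge0 ?ler_nat //.
by rewrite -natrD natr1 ler_nat; lia.
Qed.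

Lemma window_out (s : R) b m j : ~~ (b < j <= b + m)%N -> window s b m j = 0.
Proof.
rewrite /window => h; case: ifP => // h2.
have [-> | ->] : j = b \/ j = (b + m).+1 by lia.
  by rewrite subrr mul0r mulr0.
by rewrite -[(b + m).+1]addn1 !natrD subrr !mulr0.
Qed.

(** Inside the window both j / s and (n - j) s are at least [s0], so the operator dominates [s0]
    times the sum of the two neighbours of the quadratic factor u, which is 2 u - 2. Since u >= m,
    the loss is a factor 1 - 1/m. The numbers j / s and (n - j) s agree at j = n s^2 / (1 + s^2),
    where twice their value is x^2 n = n - 2 [delta1] n. *)
Lemma shiftop_window (s s0 l : R) b m j : 0 < s -> (0 < b)%N -> (0 < m)%N -> (b + m < n)%N ->
  0 <= s0 -> s0 * s <= b%:R -> s0 <= (n - (b + m))%:R * s ->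
  l + 1 <= 2 * s0 * (1 - m%:R^-1) -> (j <= n)%N ->
  window s b m j <= shiftop l (window s b m) j.
Proof.
move=> s_gt0 b0 m0 bmn s00 hs1 hs2 hl jn.
have W0 i := window_ge0 b m i s_gt0.
case: (boolP (b < j <= b + m)%N) => hj; last first.
  rewrite /shiftop window_out // mulr0 subr0 addr_ge0 // mulr_ge0 // ?ler0n //.
  by rewrite subr_ge0 ler_nat.
have [i [ij i1 im]] : exists i, [/\ j = (b + i.+1)%N, (0 < i.+1)%N & (i.+1 <= m)%N].
  by exists (j - b).-1; split; lia.
have m0R : (0 : R) < m%:R by rewrite ltr0n.
pose u : R := (i%:R + 1) * (m%:R - i%:R).
have Wj : window s b m j = s ^+ j * u.
  rewrite /window ifT; last by lia.
  by rewrite ij natrD -natr1 /u; congr (_ * _); ring.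
have Wj1 : j%:R * window s b m j.-1 = (j%:R / s) * s ^+ j * (i%:R * (m%:R + 1 - i%:R)).
  rewrite /window ifT; last by lia.
  have -> : s ^+ j = s * s ^+ j.-1 by rewrite -exprS prednK // ij; lia.
  have -> : j.-1%:R = b%:R + i%:R :> R by rewrite -natrD; congr (_%:R); lia.
  by field; rewrite gt_eqF.
have Wj2 : window s b m j.+1 = s * s ^+ j * ((i%:R + 2) * (m%:R - i%:R - 1)).
  rewrite /window ifT; last by lia.
  by rewrite ij exprS -!natr1 natrD -natr1; ring.
have sj : 0 < s ^+ j by rewrite exprn_gt0.
have iR : (0 : R) <= i%:R by rewrite ler0n.
have imR : i%:R + 1 <= m%:R :> R by rewrite natr1 ler_nat.
have um : m%:R <= u by rewrite /u; nra.
have A1 : s0 <= j%:R / s by rewrite ler_pdivlMr // (le_trans hs1) // ler_nat; lia.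
have A2 : s0 <= (n%:R - j%:R) * s.
  by apply: le_trans hs2 _; rewrite ler_wpM2r ?(ltW s_gt0) // -natrB // ler_nat; lia.
rewrite /shiftop Wj Wj1 Wj2.
have B1 : s0 * (s ^+ j * (i%:R * (m%:R + 1 - i%:R))) <= j%:R / s * s ^+ j * (i%:R * (m%:R + 1 - i%:R)).
  rewrite -[leRHS]mulrA ler_wpM2r //; apply: mulr_ge0; first exact: ltW.
  by apply: mulr_ge0 => //; lra.
have B2 : s0 * (s ^+ j * ((i%:R + 2) * (m%:R - i%:R - 1))) <=
   (n%:R - j%:R) * (s * s ^+ j * ((i%:R + 2) * (m%:R - i%:R - 1))).
  have -> : (n%:R - j%:R) * (s * s ^+ j * ((i%:R + 2) * (m%:R - i%:R - 1))) =
    ((n%:R - j%:R) * s) * (s ^+ j * ((i%:R + 2) * (m%:R - i%:R - 1))) by ring.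
  rewrite ler_wpM2r //; apply: mulr_ge0; first exact: ltW.
  by apply: mulr_ge0; lra.
have B3 : (l + 1) * (s ^+ j * u) <= 2 * s0 * (1 - m%:R^-1) * (s ^+ j * u).
  by rewrite ler_wpM2r //; apply: mulr_ge0; [exact: ltW|lra].
have B4 : 2 * s0 * (1 - m%:R^-1) * (s ^+ j * u) <= 2 * s0 * (s ^+ j * (u - 1)).
  rewrite -mulrA [(1 - _) * _]mulrCA; apply: ler_wpM2l; first by lra.
  apply: ler_wpM2l; first exact: ltW.
  rewrite mulrBl mul1r lerD2l lerN2 -[leLHS](@mulVf _ m%:R) ?gt_eqF //.
  by rewrite ler_wpM2l // invr_ge0 ltW.
have e : s0 * (s ^+ j * (i%:R * (m%:R + 1 - i%:R))) + s0 * (s ^+ j * ((i%:R + 2) * (m%:R - i%:R - 1)))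
  = 2 * s0 * (s ^+ j * (u - 1)) by rewrite /u; ring.
lra.
Qed.

(** Positivity is applied to the window G and to [A = shiftop l G], whose kernels multiply to (n -
    2d - l) times a square: pairs farther apart than [a] contribute nothing positive. The [+ 1] in
    the hypothesis on [l] gives A >= G, so the diagonal is at least the sum of G^2 C(n, j), which
    Cauchy-Schwarz on the remaining pairs cancels. *)
Lemma lp_bound Z (s s0 l : R) (b m a : nat) : 0 < s -> (0 < b)%N -> (0 < m)%N -> (b + m < n)%N ->
  0 <= s0 -> s0 * s <= b%:R -> s0 <= (n - (b + m))%:R * s -> 0 <= l ->
  l + 1 <= 2 * s0 * (1 - m%:R^-1) -> (forall d, (a < d)%N -> n%:R - 2 * d%:R <= l) ->
  #|Z|%:R ^+ 2 <= n%:R * \sum_(x in Z) \sum_(y in Z | (hdist x y <= a)%N)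
     \sum_(j < n.+1 | (b < j <= b + m)%N) (K j (hdist x y)) ^+ 2 / 'C(n, j)%:R.
Proof.
move=> s_gt0 b0 m0 bmn s00 hs1 hs2 l0 hl ha.
pose G := window s b m; pose A := shiftop l G.
have G0 j : 0 <= G j by apply: window_ge0.
have AG j : (j <= n)%N -> G j <= A j by move=> jn; apply: (@shiftop_window s s0).
have A0 j : (j <= n)%N -> 0 <= A j by move=> /AG; apply: le_trans.
pose S2 := \sum_(j < n.+1 | (b < j <= b + m)%N) G j ^+ 2 * 'C(n, j)%:R.
have S2_gt0 : 0 < S2.
  have hb : (b.+1 < n.+1)%N by lia.
  rewrite /S2 (bigD1 (Ordinal hb)) /=; last by lia.
  apply: ltr_wpDr; first by apply: sumr_ge0 => j _; rewrite mulr_ge0 ?sqr_ge0 ?ler0n.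
  apply: mulr_gt0; last by rewrite ltr0n bin_gt0.
  apply: exprn_gt0; rewrite /G /window ifT; last by lia.
  apply: mulr_gt0; first exact: exprn_gt0.
  apply: mulr_gt0; rewrite subr_gt0 ?ltr_nat //.
  by rewrite -natrD natr1 ltr_nat; lia.
have h1 : #|Z|%:R ^+ 2 * S2 <= #|Z|%:R ^+ 2 * \sum_(j < n.+1) A j * G j * 'C(n, j)%:R.
  apply: ler_wpM2l; first exact: sqr_ge0.
  rewrite /S2 big_mkcond /=; apply: ler_sum => j _; case: ifP => _.
    by rewrite expr2 ler_wpM2r ?ler0n // ler_wpM2r // AG // -ltnS.
  by rewrite mulr_ge0 ?ler0n // mulr_ge0 // A0 // -ltnS.
rewrite -(ler_pM2r S2_gt0); apply: le_trans h1 _.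
apply: le_trans (lp_positive Z G0 A0) _.
rewrite -mulrA mulr_suml mulr_sumr; apply: ler_sum => x xZ.
rewrite big_mkcondr /= mulr_suml mulr_sumr; apply: ler_sum => y yZ.
rewrite shiftop_kraw ?hdist_le // -mulrA -expr2.
set d := hdist x y; set gh := \sum_(j < n.+1) G j * K j d.
case: leqP => hd; last first.
  rewrite mul0r mulr0 -oppr_ge0 -mulNr mulr_ge0 ?sqr_ge0 // oppr_ge0 subr_le0.
  exact: ha.
have cs : gh ^+ 2 <= S2 * \sum_(j < n.+1 | (b < j <= b + m)%N) K j d ^+ 2 / 'C(n, j)%:R.
  have -> : gh = \sum_(j < n.+1 | (b < j <= b + m)%N) G j * K j d.
    rewrite /gh [RHS]big_mkcond /=; apply: eq_bigr => j _; case: ifPn => // hj.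
    by rewrite /G window_out // mul0r.
  apply: weighted_cauchy_schwarz => j hj; by rewrite ltr0n bin_gt0 -ltnS.
apply: (@le_trans _ _ (n%:R * gh ^+ 2)).
  apply: ler_wpM2r; first exact: sqr_ge0.
  have : (0 : R) <= d%:R by rewrite ler0n.
  lra.
by rewrite ler_wpM2l ?ler0n // mulrC [leRHS]mulrC mulrC.
Qed.

End LP.

(** * Modes of binomial distributions and pointwise Krawtchouk bounds *)

(** The N + 1 terms sum to 1, so the largest is at least 1 / (N + 1); comparing it with the terms
    before and after locates its index. *)
Lemma binomial_mode (R : realType) (N : nat) (p : R) : 0 < p < 1 ->
  exists k, [/\ (k <= N)%N, 1 <= N.+1%:R * ('C(N, k)%:R * p ^+ k * (1 - p) ^+ (N - k)),
    k%:R <= N.+1%:R * p & N.+1%:R * p <= k.+1%:R].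
Proof.
move=> /andP[p0 p1]; have q0 : 0 < 1 - p by rewrite subr_gt0.
pose f (k : nat) : R := 'C(N, k)%:R * p ^+ k * (1 - p) ^+ (N - k).
pose k := [arg max_(i > (ord0 : 'I_N.+1)) f i]%O.
have kmax (i : nat) : (i <= N)%N -> f i <= f k.
  rewrite -ltnS => iN; rewrite /k; case: arg_maxP => // j _ /(_ (Ordinal iN) isT).
  by [].
have sumf : \sum_(i < N.+1) f i = 1.
  have := exprDn (1 - p) p N; rewrite subrK expr1n => ->.
  by apply: eq_bigr => i _; rewrite /f -mulr_natl; ring.
have kN : (k <= N)%N by rewrite -ltnS.
exists k; split => //.
- rewrite -[leLHS]sumf; apply: (@le_trans _ _ (\sum_(i < N.+1) f k)).
    by apply: ler_sum => i _; apply: kmax; rewrite -ltnS.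
  by rewrite sumr_const card_ord -[f k *+ _]mulr_natl.
- case: (nat_of_ord k) kN (kmax) => [|j] jN h; first by rewrite mulr_ge0 // ltW.
  have := h j (ltnW jN); rewrite /f exprS (_ : N - j = (N - j.+1).+1)%N; last by lia.
  rewrite exprS => {}h.
  have e : (N%:R - j%:R) * 'C(N, j)%:R = j.+1%:R * 'C(N, j.+1)%:R :> R.
    by rewrite -natrB ?(ltnW jN) // -!natrM; congr (_%:R); rewrite mul_bin_left.
  have pq : 0 < p ^+ j * (1 - p) ^+ (N - j.+1) by rewrite mulr_gt0 ?exprn_gt0.
  have h2 : 'C(N, j)%:R * (1 - p) <= 'C(N, j.+1)%:R * p.
    by rewrite -(ler_pM2r pq); move: h; congr (_ <= _); ring.
  have C0 : (0 : R) < 'C(N, j)%:R by rewrite ltr0n bin_gt0 ltnW.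
  have j0 : (0 : R) < j.+1%:R by rewrite ltr0n.
  have : j.+1%:R * ('C(N, j)%:R * (1 - p)) <= (N%:R - j%:R) * p * 'C(N, j)%:R.
    have -> : (N%:R - j%:R) * p * 'C(N, j)%:R = j.+1%:R * ('C(N, j.+1)%:R * p) by rewrite mulrA -e; ring.
    by rewrite ler_wpM2l ?ler0n.
  rewrite (_ : _ * (_ * _) = j.+1%:R * (1 - p) * 'C(N, j)%:R); last by ring.
  by rewrite ler_pM2r // -!natr1; lra.
- case: (ltnP k N) => [jN|/(conj kN)/andP]; last first.
    rewrite -eqn_leq => /eqP ->; rewrite -[leRHS]mulr1 ler_wpM2l ?ler0n //; exact: ltW.
  move: (nat_of_ord k) jN kmax => j jN h.
  have := h j.+1 jN; rewrite /f exprS (_ : N - j = (N - j.+1).+1)%N; last by lia.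
  rewrite exprS => {}h.
  have e : (N%:R - j%:R) * 'C(N, j)%:R = j.+1%:R * 'C(N, j.+1)%:R :> R.
    by rewrite -natrB ?(ltnW jN) // -!natrM; congr (_%:R); rewrite mul_bin_left.
  have pq : 0 < p ^+ j * (1 - p) ^+ (N - j.+1) by rewrite mulr_gt0 ?exprn_gt0.
  have h2 : 'C(N, j.+1)%:R * p <= 'C(N, j)%:R * (1 - p).
    by rewrite -(ler_pM2r pq); move: h; congr (_ <= _); ring.
  have C0 : (0 : R) < 'C(N, j)%:R by rewrite ltr0n bin_gt0 ltnW.
  have : (N%:R - j%:R) * p * 'C(N, j)%:R <= j.+1%:R * ('C(N, j)%:R * (1 - p)).
    have -> : (N%:R - j%:R) * p * 'C(N, j)%:R = j.+1%:R * ('C(N, j.+1)%:R * p) by rewrite mulrA -e; ring.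
    by rewrite ler_wpM2l ?ler0n.
  rewrite (_ : _ * (_ * (1 - p)) = j.+1%:R * (1 - p) * 'C(N, j)%:R); last by ring.
  by rewrite ler_pM2r // -!natr1; lra.
Qed.

Lemma leq_bin_half n k d : (k <= d)%N -> (d.*2 <= n)%N -> ('C(n, k) <= 'C(n, d))%N.
Proof.
move=> /subnKC <-; elim: (d - k)%N => [|e IH] h; first by rewrite addn0.
rewrite addnS in h *; apply: leq_trans (IH _) _; first by lia.
rewrite -(@leq_pmul2l (k + e).+1) // mul_bin_left leq_mul2r; apply/orP; right; lia.
Qed.

Section KrawBound.
Variables (R : realType) (n : nat).
Local Notation K := (@kraw n R).

(** Here [k] is the mode for [dl], so that (1 + g)^n is about C(n, k) g^k. Up to [k], the ratio
    bound with s = sqrt g, for which s^2 (1 - dl) + dl = 2 dl, compares K_j(d) with K_j(k), and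
    Parseval bounds the latter. From [k] to [a] Parseval at [d] is enough, at the price of the
    factor g^(a - k). *)
Lemma kraw_bound (g dl : R) (j k a d : nat) : 0 < g < 1 -> dl = g / (1 + g) ->
  (j <= n)%N -> 2 * dl * n%:R <= (n%:R - 2 * j%:R) * Num.sqrt g ->
  (k <= n)%N -> 1 <= n.+1%:R * ('C(n, k)%:R * dl ^+ k * (1 - dl) ^+ (n - k)) ->
  k%:R <= n.+1%:R * dl -> (k <= a)%N -> (a.*2 <= n)%N -> (d <= a)%N ->
  K j d ^+ 2 * ((1 + g) ^+ n * g ^+ (a - k)) <= n.+1%:R * 2 ^+ n * g ^+ d * 'C(n, j)%:R.
Proof.
move=> /andP[g0 g1] dlE jn hj kn hmode hk ka an da.
have g1' : 0 < 1 + g by lra.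
have dl01 : 0 < dl < 1.
  by rewrite dlE divr_gt0 //= ltr_pdivrMr // mul1r ltrDr.
have odl : 1 - dl = (1 + g)^-1 by rewrite dlE; field; rewrite gt_eqF.
have hC : (1 + g) ^+ n <= n.+1%:R * 'C(n, k)%:R * g ^+ k.
  rewrite -[leLHS]mulr1 -[leLHS]mulrC.
  have -> : n.+1%:R * 'C(n, k)%:R * g ^+ k =
      n.+1%:R * ('C(n, k)%:R * dl ^+ k * (1 - dl) ^+ (n - k)) * (1 + g) ^+ n.
    have nE : (1 + g) ^+ n = (1 + g) ^+ k * (1 + g) ^+ (n - k) by rewrite -exprD subnKC.
    rewrite odl dlE nE exprMn !exprVn.
    by field; rewrite !expf_neq0 // gt_eqF.
  by rewrite ler_pM2r ?exprn_gt0.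
have n0 : (0 : R) <= n.+1%:R by rewrite ler0n.
have par := @kraw_parseval R n j.
set s := Num.sqrt g in hj.
have s2 : s ^+ 2 = g by rewrite sqr_sqrtr ?ltW.
have s0 : 0 < s by rewrite sqrtr_gt0.
have s1 : s <= 1 by rewrite -sqrtr1 ler_sqrt // ltW.
have ak : 0 <= g ^+ (a - k) <= 1 by rewrite exprn_ge0 ?exprn_ile1 // ltW.
case: (leqP d k) => dk.
  have aux e : (e < k - d)%N ->
      [/\ ((k - e.+1).+1 <= k)%N, (k - e.+1 < n)%N & (k - e.+1).+1 = (k - e)%N].
    by clear -kn; split; lia.
  have step e : (e <= k - d)%N -> g ^+ e * K j (k - e)%N ^+ 2 <= K j k ^+ 2.
    elim: e => [|e IH] he; first by rewrite expr0 mul1r subn0.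
    apply: le_trans (IH (ltnW he)); rewrite exprSr -mulrA ler_wpM2l ?exprn_ge0 ?(ltW g0) //.
    have [e1 e2 e3] := aux e he.
    have [] // := @kraw_ratio R n s dl j (k - e.+1) s0 s1 jn.
    - by rewrite s2 odl; move: hj; rewrite dlE; congr (_ <= _); field; rewrite gt_eqF.
    - have : (k - e.+1)%:R + 1 <= n.+1%:R * dl by apply: le_trans hk; rewrite natr1 ler_nat.
      by case/andP: dl01 => _; rewrite -natr1; lra.
    move=> K0; rewrite e3.
    move=> h; rewrite -s2 -exprMn ler_pXn2r ?nnegrE //.
      by rewrite mulr_ge0 // ltW.
    by apply: le_trans h; rewrite mulr_ge0 // ltW.
  have := step (k - d)%N (leqnn _); rewrite subKn // => {}step.
  apply: (@le_trans _ _ (K j d ^+ 2 * (1 + g) ^+ n)).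
    apply: ler_wpM2l; first exact: sqr_ge0.
    rewrite -[leRHS]mulr1 ler_wpM2l ?exprn_ge0 ?(ltW g1') //; by case/andP: ak.
  apply: (@le_trans _ _ (K j d ^+ 2 * (n.+1%:R * 'C(n, k)%:R * g ^+ k))).
    by rewrite ler_wpM2l ?sqr_ge0.
  rewrite -{2}(subnKC dk) exprD.
  have -> : K j d ^+ 2 * (n.+1%:R * 'C(n, k)%:R * (g ^+ d * g ^+ (k - d))) =
     (n.+1%:R * g ^+ d) * ((g ^+ (k - d) * K j d ^+ 2) * 'C(n, k)%:R) by ring.
  have -> : n.+1%:R * 2 ^+ n * g ^+ d * 'C(n, j)%:R = (n.+1%:R * g ^+ d) * (2 ^+ n * 'C(n, j)%:R).
    by ring.
  apply: ler_wpM2l; first by rewrite mulr_ge0 // exprn_ge0 // ltW.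
  by apply: le_trans (par k); rewrite ler_wpM2r ?ler0n.
apply: (@le_trans _ _ (K j d ^+ 2 * (n.+1%:R * 'C(n, d)%:R * g ^+ d))).
  apply: ler_wpM2l; first exact: sqr_ge0.
  apply: (@le_trans _ _ (n.+1%:R * 'C(n, k)%:R * g ^+ k * g ^+ (a - k))).
    by rewrite ler_wpM2r //; case/andP: ak.
  rewrite -mulrA -exprD subnKC //; apply: ler_pM; rewrite ?mulr_ge0 ?ler0n ?exprn_ge0 ?(ltW g0) //.
    by rewrite ler_wpM2l // ler_nat leq_bin_half ?(ltnW dk) //; apply: leq_trans an; rewrite leq_double.
  by rewrite ler_wiXn2l ?(ltW g0) ?(ltW g1).
have -> : K j d ^+ 2 * (n.+1%:R * 'C(n, d)%:R * g ^+ d) =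
     (n.+1%:R * g ^+ d) * (K j d ^+ 2 * 'C(n, d)%:R) by ring.
have -> : n.+1%:R * 2 ^+ n * g ^+ d * 'C(n, j)%:R = (n.+1%:R * g ^+ d) * (2 ^+ n * 'C(n, j)%:R).
  by ring.
by apply: ler_wpM2l; rewrite // mulr_ge0 // exprn_ge0 // ltW.
Qed.

End KrawBound.

(** * Overlaps of midpoint sets *)

Section Midpoints.
Variables (R : realType) (n : nat).
Implicit Types x y z : n.-tuple bool.

(** At such a [z] the two codewords are equally likely, so a maximum-likelihood decoder errs for at
    least one of them. *)
Definition mid x y r : {set n.-tuple bool} := [set z | (hdist x z == r) && (hdist y z == r)].

(** From [x], flip [h] of the 2h coordinates where [y] differs and [k] of the others: both distances
    become h + k. *)
Lemma card_mid x y h k : hdist x y = h.*2 ->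
  ('C(h.*2, h) * 'C(n - h.*2, k) <= #|mid x y (h + k)|)%N.
Proof.
move=> xy; have [A AE] : exists A, A = dset x y by exists (dset x y).
have cA : #|A| = h.*2 by rewrite AE -hdistE.
have cAC : #|~: A| = (n - h.*2)%N by rewrite [LHS]cardsCs finset.setCK card_ord cA.
pose D (E : {set 'I_n}) m := [set B : {set 'I_n} | B \subset E & #|B| == m].
have <- : #|finset.setX (D A h) (D (~: A) k)| = ('C(h.*2, h) * 'C(n - h.*2, k))%N.
  by rewrite cardsX !cards_draws cA cAC.
pose F (B : {set 'I_n} * {set 'I_n}) := flip x (B.1 :|: B.2).
rewrite -(@card_in_imset _ _ F); last first.
  move=> [B1 B2] [C1 C2]; rewrite !inE /= => /andP[/andP[hB1 _] /andP[hB2 _]] /andP[/andP[hC1 _] /andP[hC2 _]].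
  move=> /(congr1 (dset x)); rewrite !dset_flip => e.
  have aux (U V : {set 'I_n}) : U \subset A -> V \subset ~: A -> (U :|: V) :&: A = U /\ (U :|: V) :&: ~: A = V.
    move=> hU hV; split; apply/setP => i; rewrite !inE.
      case: (boolP (i \in U)) => [/(fintype.subsetP hU) -> //|_] /=.
      by case: (boolP (i \in V)) => [/(fintype.subsetP hV)|_] //=; rewrite inE => /negbTE.
    case: (boolP (i \in V)) => [/(fintype.subsetP hV)|_]; first by rewrite inE orbT.
    by case: (boolP (i \in U)) => [/(fintype.subsetP hU) ->|].
  have [e1 e2] := aux _ _ hB1 hB2; have [e3 e4] := aux _ _ hC1 hC2.
  by move: e => /= e; congr (_, _); [rewrite -e1 e e3|rewrite -e2 e e4].
apply: subset_leq_card; apply/fintype.subsetP => z /imsetP[[B1 B2]].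
rewrite !inE /= => /andP[/andP[hB1 /eqP c1] /andP[hB2 /eqP c2]] ->.
have dis : [disjoint B1 & B2].
  rewrite -setI_eq0; apply/eqP/setP => i; rewrite !inE; apply/negP => /andP[/(fintype.subsetP hB1) h1 /(fintype.subsetP hB2)].
  by rewrite inE h1.
have -> : hdist x (F (B1, B2)) = (h + k)%N.
  by rewrite hdistE dset_flip cardsU c1 c2 (eqP (_ : B1 :&: B2 == finset.set0)) ?setI_eq0 // cards0 subn0.
rewrite eqxx /= hdistE.
have -> : dset y (F (B1, B2)) = (A :\: B1) :|: B2.
  apply/setP => i; rewrite !inE tnth_mktuple inE.
  have : (i \in B1) ==> (i \in A) by apply/implyP/(fintype.subsetP hB1).
  have : (i \in B2) ==> (i \notin A) by apply/implyP => /(fintype.subsetP hB2); rewrite inE.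
  by rewrite AE !inE; do 2 case: (i \in _); do 2 case: (tnth _ i).
have dis2 : (A :\: B1) :&: B2 = finset.set0.
  apply/setP => i; rewrite !inE; apply/negP => /andP[/andP[_ h1] /(fintype.subsetP hB2)].
  by rewrite !inE h1.
rewrite cardsU dis2 cards0 subn0 c2 cardsD (finset.setIidPr hB1) cA c1 -addnn addnK.
by [].
Qed.

Lemma prod_ord_if (S : comNzRingType) (P : pred 'I_n) (a b : S) :
  \prod_(i < n) (if P i then a else b) = a ^+ #|P| * b ^+ (n - #|P|).
Proof.
rewrite (bigID P) /=; congr (_ * _).
  by rewrite (eq_bigr (fun=> a)) => [|i ->//]; rewrite prodr_const.
rewrite (eq_bigr (fun=> b)) => [|i /negbTE ->//]; rewrite prodr_const.
have <- : (#|P| + #|[predC P]| - #|P| = n - #|P|)%N by rewrite cardC card_ord.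
by rewrite addKn; congr (_ ^+ _); apply: eq_card.
Qed.

(* Chernoff bound with the tilt at which three points of a typical triangle
   with sides 2 rho (1 - rho) are seen from a common midpoint. *)
Lemma card_mid3 x y y' r e (rh : R) : 0 <= rh <= 1 ->
  (e.*2 = hdist x y + hdist x y' + hdist y y')%N ->
  #|mid x y r :&: mid x y' r|%:R * (rh ^+ r * (1 - rh) ^+ (n - r)) ^+ 3 <=
  (rh * (1 - rh)) ^+ e * (1 - 3 * (rh * (1 - rh))) ^+ (n - e).
Proof.
move=> /andP[r0 r1] he.
pose V c z := rh ^+ hdist c z * (1 - rh) ^+ (n - hdist c z).
have V0 c z : 0 <= V c z by rewrite mulr_ge0 ?exprn_ge0 ?subr_ge0.
apply: (@le_trans _ _ (\sum_z V x z * V y z * V y' z)).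
  rewrite -sum1_card natr_sum mulr_suml.
  rewrite [leRHS](bigID (mem (mid x y r :&: mid x y' r))) /= -[leLHS]addr0 lerD //; last first.
    by apply: sumr_ge0 => z _; apply: mulr_ge0 => //; apply: mulr_ge0.
  rewrite le_eqVlt; apply/orP; left; apply/eqP; apply: eq_bigr => z.
  rewrite !inE => /andP[/andP[/eqP h1 /eqP h2] /andP[_ /eqP h3]].
  by rewrite /V h1 h2 h3; ring.
pose P := [pred i | (tnth x i != tnth y i) || (tnth x i != tnth y' i)].
have eP : e = #|P|.
  apply/eqP; rewrite -(eqn_pmul2l (isT : 0 < 2)%N) mul2n he.
  rewrite /hdist -!big_split /= -sum1_card big_distrr /= [X in _ == X]big_mkcond /=.
  apply/eqP; apply: eq_bigr => i _; rewrite /P inE /=.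
  by do 3 case: (tnth _ i).
rewrite eP -prod_ord_if le_eqVlt; apply/orP; left; apply/eqP.
pose f (i : 'I_n) c (b : bool) := if tnth c i != b then rh else 1 - rh.
transitivity (\sum_(z : n.-tuple bool) \prod_(i < n) (f i x (tnth z i) * f i y (tnth z i) * f i y' (tnth z i))).
  by apply: eq_bigr => z _; rewrite /V !expr_hdist -!big_split.
rewrite (sum_tuple_prod (fun i b => f i x b * f i y b * f i y' b)); apply: eq_bigr => i _.
by rewrite /f /P /=; do 3 case: (tnth _ i) => /=; ring.
Qed.

End Midpoints.

(** With c(z) the number of sets containing z, Cauchy-Schwarz on the union U gives (sum c)^2 <= |U|
    sum c^2, and sum c^2 counts the pairwise intersections. *)
Lemma second_moment_union (R : realType) (I T : finType) (Y : {set I}) (A : I -> {set T}) (M : R) :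
  0 <= M ->
  (forall y, y \in Y -> \sum_(y' in Y) #|A y :&: A y'|%:R <= M * #|A y|%:R) ->
  \sum_(y in Y) #|A y|%:R <= M * #|\bigcup_(y in Y) A y|%:R.
Proof.
move=> M0 hM; set U := \bigcup_(y in Y) A y.
pose c z : R := \sum_(y in Y) (z \in A y)%:R.
have cU z : z \notin U -> c z = 0.
  move=> zU; rewrite /c big1 // => y yY.
  case: (boolP (z \in A y)) => // zA; case/negP: zU; apply/bigcupP; by exists y.
have cardE (B : {set T}) : #|B|%:R = \sum_z (z \in B)%:R :> R.
  rewrite -sum1_card natr_sum big_mkcond /=; apply: eq_bigr => z _.
  by case: (z \in B).
have s1 : \sum_(z in U) c z = \sum_(y in Y) #|A y|%:R.
  transitivity (\sum_z c z).
    by rewrite [RHS](bigID (mem U)) /= [X in _ + X]big1 ?addr0.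
  by rewrite /c exchange_big /=; apply: eq_bigr => y yY; rewrite -cardE.
have s2 : \sum_(z in U) c z ^+ 2 <= M * \sum_(y in Y) #|A y|%:R.
  apply: (@le_trans _ _ (\sum_(y in Y) \sum_(y' in Y) #|A y :&: A y'|%:R)).
    rewrite le_eqVlt; apply/orP; left; apply/eqP.
    transitivity (\sum_z c z ^+ 2).
      by rewrite [RHS](bigID (mem U)) /= [X in _ + X]big1 ?addr0 // => z /cU ->; rewrite expr0n.
    under eq_bigr do rewrite /c expr2 big_distrlr /=.
    rewrite exchange_big /=; apply: eq_bigr => y yY.
    rewrite exchange_big /=; apply: eq_bigr => y' yY'.
    by rewrite cardE; apply: eq_bigr => z _; rewrite inE -natrM mulnb.
  by rewrite mulr_sumr; apply: ler_sum.
have cs := @weighted_cauchy_schwarz R T (mem U) (fun=> 1) c (fun=> 1) (fun _ _ => ltr01).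
set S := \sum_(y in Y) #|A y|%:R in s1 s2 *.
have {cs} cs : S ^+ 2 <= #|U|%:R * \sum_(z in U) c z ^+ 2.
  rewrite -s1; move: cs; under eq_bigr do rewrite mul1r.
  under [in leRHS]eq_bigr do rewrite expr1n mul1r.
  under [X in _ * X]eq_bigr do rewrite divr1.
  by rewrite sumr_const.
have : 0 <= S by rewrite sumr_ge0.
rewrite le_eqVlt => /predU1P[<-|S0]; first by rewrite mulr_ge0 ?ler0n.
rewrite -(ler_pM2r S0) -expr2; apply: le_trans cs _.
by apply: le_trans (ler_wpM2l (ler0n _ _) s2) _; rewrite mulrCA mulrA.
Qed.

(** * Unnormalised error probability of a family of codewords *)

Section Qerr.
Variables (R : realType) (p : R).
Hypotheses (p0 : 0 <= p) (p1 : p <= 1).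

(** The size of the code times [Pe], but for indexed families, since suffixes of distinct codewords
    may coincide. Without the factor 1 / M the error is superadditive in the family. *)
Definition qerr n (I : finType) (S : {set I}) (c : I -> n.-tuple bool) : R :=
  \sum_(z : n.-tuple bool)
    (\sum_(i in S) W p z (c i) - \big[Num.max/0]_(i in S) W p z (c i)).

Lemma W_ge0 n (z x : n.-tuple bool) : 0 <= W p z x.
Proof. by rewrite mulr_ge0 ?exprn_ge0 ?subr_ge0. Qed.

Lemma sum_W n (x : n.-tuple bool) : \sum_z W p z x = 1.
Proof.
pose F (i : 'I_n) (b : bool) : R := if tnth x i != b then p else 1 - p.
transitivity (\sum_(z : n.-tuple bool) \prod_(i < n) F i (tnth z i)).
  by apply: eq_bigr => z _; rewrite /W expr_hdist.
rewrite sum_tuple_prod big1 // => i _; rewrite /F.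
by case: (tnth x i) => /=; lra.
Qed.

Lemma bigmax_attained (I : finType) (S : {set I}) (f : I -> R) (i0 : I) : i0 \in S ->
  (forall i, 0 <= f i) ->
  exists2 j, j \in S & \big[Num.max/0]_(i in S) f i = f j /\ (forall i, i \in S -> f i <= f j).
Proof.
move=> i0S f0; case: (@arg_maxP _ _ _ i0 (mem S) f i0S) => j jS jmax.
exists j => //; split => //; apply/eqP; rewrite eq_le; apply/andP; split.
  by apply/bigmax_leP; split.
by rewrite (bigmax_sup j).
Qed.

Lemma sum_sub_max (I : finType) (S : {set I}) (f : I -> R) : (forall i, 0 <= f i) ->
  S != finset.set0 ->
  exists2 j, j \in S & \sum_(i in S) f i - \big[Num.max/0]_(i in S) f i = \sum_(i in S :\ j) f i.
Proof.
move=> f0 /set0Pn[i0 i0S]; have [j jS [-> _]] := bigmax_attained i0S f0.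
exists j => //; rewrite (big_setD1 j) //=; lra.
Qed.

Lemma max_le_sum (I : finType) (S : {set I}) (f : I -> R) : (forall i, 0 <= f i) ->
  \big[Num.max/0]_(i in S) f i <= \sum_(i in S) f i.
Proof.
move=> f0; have [->|S0] := eqVneq S finset.set0; first by rewrite !big_set0.
have [j _ e] := sum_sub_max f0 S0; rewrite -subr_ge0 e.
exact: sumr_ge0.
Qed.

Lemma qerr_ge0 n (I : finType) (S : {set I}) (c : I -> n.-tuple bool) : 0 <= qerr S c.
Proof.
apply: sumr_ge0 => z _; rewrite subr_ge0; apply: max_le_sum => i; exact: W_ge0.
Qed.

Lemma qerrU n (I : finType) (S1 S2 : {set I}) (c : I -> n.-tuple bool) : [disjoint S1 & S2] ->
  qerr S1 c + qerr S2 c <= qerr (S1 :|: S2) c.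
Proof.
move=> dis; rewrite /qerr -big_split /=; apply: ler_sum => z _.
have -> : \sum_(i in S1 :|: S2) W p z (c i) = \sum_(i in S1) W p z (c i) + \sum_(i in S2) W p z (c i).
  by rewrite -bigU //=; apply: eq_bigl => i; rewrite !inE.
suff : \big[Num.max/0]_(i in S1 :|: S2) W p z (c i) <=
  \big[Num.max/0]_(i in S1) W p z (c i) + \big[Num.max/0]_(i in S2) W p z (c i) by lra.
have W0 i := W_ge0 z (c i).
have m0 (S : {set I}) : 0 <= \big[Num.max/0]_(i in S) W p z (c i) by apply: bigmax_ge_id.
apply/bigmax_leP; split; first exact: addr_ge0.
move=> i; rewrite inE => /orP[] iS.
  by apply: ler_wpDr => //; apply: (bigmax_sup i).
by apply: ler_wpDl => //; apply: (bigmax_sup i).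
Qed.

Lemma qerr_sub n (I : finType) (S1 S2 : {set I}) (c : I -> n.-tuple bool) : S1 \subset S2 ->
  qerr S1 c <= qerr S2 c.
Proof.
move=> s12; rewrite -(finset.setID S2 S1) (finset.setIidPr s12).
apply: le_trans (qerrU _ _); first by rewrite lerDl qerr_ge0.
by rewrite disjoint_sym finset.disjoints_subset; apply/fintype.subsetP => i; rewrite !inE => /andP[].
Qed.

(** If [z] lies in one of the unions, at least two codewords of [X] are at distance [r] from it.
    With N >= 2 such codewords the error at [z] is at least N - 1 >= N / 2 times their common
    likelihood, whence the factor 2. *)
Lemma qerr_union n (X X' : {set n.-tuple bool}) (Y : n.-tuple bool -> {set n.-tuple bool}) r :
  X' \subset X -> (forall x, x \in X' -> Y x \subset X :\ x) ->
  p ^+ r * (1 - p) ^+ (n - r) * \sum_(x in X') #|\bigcup_(y in Y x) mid x y r|%:R <= 2 * qerr X id.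
Proof.
move=> sX hY; set Pr := p ^+ r * _.
have Pr0 : 0 <= Pr by rewrite mulr_ge0 ?exprn_ge0 ?subr_ge0.
have cardE (B : {set n.-tuple bool}) : #|B|%:R = \sum_z (z \in B)%:R :> R.
  rewrite -sum1_card natr_sum big_mkcond /=; apply: eq_bigr => z _.
  by case: (z \in B).
under eq_bigr do rewrite cardE.
rewrite exchange_big /= mulr_sumr /qerr mulr_sumr; apply: ler_sum => z _.
pose Xr := [set x in X | hdist x z == r].
have key x : x \in X' -> z \in \bigcup_(y in Y x) mid x y r -> (x \in Xr) /\ exists2 y, y \in Xr & y != x.
  move=> xX' /bigcupP[y yY]; rewrite inE => /andP[xz yz].
  have := fintype.subsetP (hY x xX') y yY; rewrite !inE => /andP[yx yX].
  split; first by rewrite xz andbT (fintype.subsetP sX).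
  by exists y => //; rewrite inE yX yz.
have Wr x : x \in Xr -> W p z x = Pr by rewrite inE => /andP[_ /eqP e]; rewrite /W e.
have W0 x := W_ge0 z x.
have : \sum_(x in X') (z \in \bigcup_(y in Y x) mid x y r)%:R <= (if (1 < #|Xr|)%N then #|Xr|%:R else 0 : R).
  case: ifPn => hX.
    rewrite -sum1_card natr_sum big_mkcond [leRHS]big_mkcond /=; apply: ler_sum => x _.
    case: ifP => xX'; last by case: ifP.
    case: (boolP (z \in _)) => [/(key x xX')[-> _]//|_]; by case: ifP.
  rewrite big1 // => x xX'; case: (boolP (z \in _)) => // /(key x xX')[xr [y yr yx]].
  case/negP: hX; rewrite (cardsD1 x) xr (cardsD1 y) !inE yx.
  by move: yr; rewrite !inE => ->.
move=> /(ler_wpM2l Pr0)/le_trans; apply.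
case: ifPn => hX; last first.
  by rewrite mulr0 mulr_ge0 // subr_ge0 max_le_sum.
have X0 : X != finset.set0.
  apply/set0Pn; have /card_gt0P[x] : (0 < #|Xr|)%N by apply: ltn_trans hX.
  by rewrite inE => /andP[xX _]; exists x.
have [j jX ->] := sum_sub_max W0 X0.
apply: (@le_trans _ _ (2 * \sum_(i in Xr :\ j) W p z i)); last first.
  rewrite ler_pM2l // [leRHS](bigID (mem (Xr :\ j))) /= -[leLHS]addr0 lerD ?sumr_ge0 //.
  rewrite le_eqVlt; apply/orP; left; apply/eqP; apply: eq_bigl => i; rewrite !inE.
  by case: (i == j); case: (i \in X); case: (hdist i z == r).
rewrite (eq_bigr (fun=> Pr)); last by move=> i; rewrite inE => /andP[_]; apply: Wr.
rewrite sumr_const -[Pr *+ _]mulr_natl mulrCA mulrC mulrA ler_wpM2r //.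
rewrite -natrM ler_nat; have := cardsD1 j Xr.
by move: hX; move: #|Xr| #|Xr :\ j| (j \in Xr) => c1 c2 []; clear; lia.
Qed.

Lemma Pe_qerr n (C : {set n.-tuple bool}) : C != finset.set0 ->
  #|C|%:R * Pe C p = qerr C id.
Proof.
move=> C0; have cC : (#|C|%:R : R) != 0 by rewrite pnatr_eq0 -lt0n card_gt0.
rewrite /Pe mulrBr mulr1 mulrA divff // mul1r /qerr sumrB; congr (_ - _).
by rewrite exchange_big /= (eq_bigr (fun=> 1)) => [|c _]; rewrite ?sumr_const ?sum_W.
Qed.

End Qerr.

(** * Selection of the distance and control of the overlaps *)

Section Levels.
Variables (R : realType) (n : nat).
Implicit Types (X Z : {set n.-tuple bool}).

Definition nbr Z (x : n.-tuple bool) v : {set n.-tuple bool} := [set y in Z | hdist x y == v].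

(** Go through the distances in increasing order, deleting at each one the words with too many
    neighbours there. If every deletion concerned fewer than |X| / (2 n) words, at least half would
    survive distance [a], and the hypothesis would produce among them a word that had to be
    deleted. *)
Lemma level_selection X (T : nat -> R) (a : nat) : (0 < n)%N -> (a <= n)%N ->
  (forall Z, Z \subset X -> (#|X| <= #|Z| * 2)%N ->
     exists2 x, x \in Z & exists2 v, (0 < v <= a)%N & T v < #|nbr Z x v|%:R) ->
  exists w Z, [/\ (0 < w <= a)%N, Z \subset X,
    forall x v, x \in Z -> (0 < v < w)%N -> #|nbr Z x v|%:R <= T v &
    (#|X| <= 2 * n * #|[set x in Z | (T w < #|nbr Z x w|%:R)%R]|)%N].
Proof.
move=> n0 an lp.
pose good w Z := [/\ Z \subset X, (forall x v, x \in Z -> (0 < v < w)%N -> #|nbr Z x v|%:R <= T v) &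
   ((2 * n - w.-1) * #|X| <= 2 * n * #|Z|)%N].
suff : forall k, (k <= a)%N -> (exists w Z, [/\ (0 < w <= a)%N, Z \subset X,
    forall x v, x \in Z -> (0 < v < w)%N -> #|nbr Z x v|%:R <= T v &
    (#|X| <= 2 * n * #|[set x in Z | (T w < #|nbr Z x w|%:R)%R]|)%N]) \/ exists Z, good k.+1 Z.
  case/(_ a (leqnn _)) => // -[Z [ZX hZ cZ]].
  have cZ2 : (#|X| <= #|Z| * 2)%N.
    rewrite -(leq_pmul2l n0) [(#|Z| * 2)%N]mulnC mulnA [(n * 2)%N]mulnC; apply: leq_trans cZ.
    by rewrite leq_mul2r; apply/orP; right; move: an; clear; rewrite /=; lia.
  have [] := lp Z ZX cZ2.
  move=> x xZ [v /andP[v0 va]]; rewrite ltNge hZ // v0 /=; lia.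
elim=> [|k IH] ka.
  right; exists X; split=> //; last by rewrite subn0.
  by move=> x v _ /andP[v0]; rewrite ltnS leqNgt v0.
have [|[Z [ZX hZ cZ]]] := IH (ltnW ka); first by left.
pose Z1 := [set x in Z | (T k.+1 < #|nbr Z x k.+1|%:R)%R].
case: (leqP #|X| (2 * n * #|Z1|)) => hc; first by left; exists k.+1, Z.
right; exists (Z :\: Z1); have sub : Z :\: Z1 \subset Z by apply: finset.subsetDl.
split; first exact: fintype.subset_trans sub ZX.
  move=> x v; rewrite inE => /andP[xZ1 xZ] /andP[v0]; rewrite ltnS leq_eqVlt => hv.
  apply: (@le_trans _ _ #|nbr Z x v|%:R).
    rewrite ler_nat subset_leq_card //; apply/fintype.subsetP => y; rewrite !inE => /andP[/andP[_ ->]].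
    by [].
  case/predU1P: hv => [->|hv]; last by apply: hZ => //; rewrite v0.
  by move: xZ1; rewrite inE xZ /= -leNgt.
have s1 : Z1 \subset Z by apply/fintype.subsetP => x; rewrite inE => /andP[].
rewrite cardsD (finset.setIidPr s1) /=; have := subset_leq_card s1.
have e : ((2 * n - k.+1) * #|X| + #|X| = (2 * n - k) * #|X|)%N.
  by rewrite -mulSnr; congr (_ * _)%N; move: ka an; clear; lia.
rewrite mulnBr; move: hc cZ e; rewrite /=.
move: (2 * n * #|Z1|)%N (2 * n * #|Z|)%N ((2 * n - k.+1) * #|X|)%N ((2 * n - k) * #|X|)%N.
by move: #|X| => c A B C D; clear; lia.
Qed.

(** Group the y' in [Y] by their distance v to y. For 0 < v < w there are at most [T v], since y has
    few neighbours in [Z]; for v >= w there are at most |Y|, kept below [T w + 1] by discarding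
    surplus neighbours. Either way the count is at most [T (minn v w) + 1], and the n + 1 values of
    v give the factor (n + 1)(kap + 1). *)
Lemma union_overlap Z (x : n.-tuple bool) (T : nat -> R) (w r : nat) (kap : R) :
  (0 < w)%N -> 0 <= kap -> (forall v, 0 <= T v) ->
  (forall y v, y \in Z -> (0 < v < w)%N -> #|nbr Z y v|%:R <= T v) ->
  T w < #|nbr Z x w|%:R ->
  (forall y y', hdist x y = w -> hdist x y' = w -> (0 < hdist y y')%N ->
     #|mid x y r :&: mid x y' r|%:R * T (minn (hdist y y') w) <= kap * #|mid x y r|%:R) ->
  exists2 Y : {set n.-tuple bool}, Y \subset nbr Z x w & forall J : R,
    (forall y, hdist x y = w -> J <= #|mid x y r|%:R) -> 0 <= J ->
    T w * J <= n.+1%:R * (kap + 1) * #|\bigcup_(y in Y) mid x y r|%:R.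
Proof.
move=> w0 kap0 T0 hZ hT hov.
have [m [m1 m2 m3]] : exists m : nat, [/\ T w <= m%:R, m%:R <= T w + 1 & (m <= #|nbr Z x w|)%N].
  exists (Num.trunc (T w)).+1; have /andP[t1 t2] := truncn_itv (T0 w).
  split; [exact: ltW|by rewrite -natr1 lerD2r|].
  by rewrite -(ltr_nat R); apply: le_lt_trans hT.
have [Y YN cY] : exists2 Y : {set n.-tuple bool}, Y \subset nbr Z x w & #|Y| = m.
  exists [set y in take m (enum (nbr Z x w))].
    apply/fintype.subsetP => y; rewrite inE => /mem_take; by rewrite mem_enum.
  have u : uniq (take m (enum (nbr Z x w))) by rewrite take_uniq // enum_uniq.
  by rewrite cardsE (card_uniqP u) size_takel // -cardE.
exists Y => // J hJ J0.
have Yp y : y \in Y -> y \in Z /\ hdist x y = w.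
  by move=> /(fintype.subsetP YN); rewrite inE => /andP[-> /eqP].
have M0 : 0 <= n.+1%:R * (kap + 1) by rewrite mulr_ge0 ?ler0n // addr_ge0.
apply: le_trans (@second_moment_union R _ _ Y (fun y => mid x y r) _ M0 _).
  apply: (@le_trans _ _ (m%:R * J)); first by rewrite ler_wpM2r.
  rewrite mulr_natl -cY -sumr_const; apply: ler_sum => y /Yp[_ h]; exact: hJ.
move=> y /[dup] yY /Yp[yZ xy]; set Ay := #|mid x y r|%:R.
have Ay0 : 0 <= Ay by rewrite ler0n.
have lev v : \sum_(y' in Y | hdist y y' == v) #|mid x y r :&: mid x y' r|%:R <= (kap + 1) * Ay.
  case: (posnP v) => [->|v0].
    apply: (@le_trans _ _ (\sum_(y' in Y | hdist y y' == 0%N) (if y' == y then Ay else 0))).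
      apply: ler_sum => y' /andP[_]; rewrite hdist_eq0 eq_sym => /eqP ->; rewrite eqxx ler_nat.
      by rewrite finset.setIid.
    rewrite -big_mkcondr /=.
    apply: (@le_trans _ _ (\sum_(y' | y' == y) Ay)); last by rewrite big_pred1_eq mulrDl mul1r lerDr mulr_ge0.
    rewrite big_mkcond [leRHS]big_mkcond /=; apply: ler_sum => y' _.
    by case: (y' == y); rewrite ?andbF //; case: ifP.
  have bnd y' : y' \in Y -> hdist y y' = v -> #|mid x y r :&: mid x y' r|%:R * T (minn v w) <= kap * Ay.
    by move=> /Yp[_ xy'] yv; rewrite -yv; apply: hov => //; rewrite yv.
  have bnd1 y' : #|mid x y r :&: mid x y' r|%:R <= Ay.
    by rewrite ler_nat subset_leq_card // finset.subsetIl.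
  pose c := #|[set y' in Y | hdist y y' == v]|.
  have cb : c%:R <= T (minn v w) + 1.
    case: (ltnP v w) => vw.
      apply: ler_wpDr => //.
      apply: le_trans (hZ y v yZ _); last by rewrite v0.
      rewrite ler_nat subset_leq_card //; apply/fintype.subsetP => y'; rewrite !inE => /andP[/Yp[-> _] ->].
      by [].
    apply: le_trans m2; rewrite ler_nat -cY subset_leq_card //.
    by apply/fintype.subsetP => y'; rewrite inE => /andP[].
  case: (posnP c) => [c0|cp].
    rewrite big_pred0; first by rewrite mulr_ge0 // addr_ge0.
    move=> y'; apply/negbTE/negP => h; have : y' \in [set y' in Y | hdist y y' == v] by rewrite inE.
    by move/eqP: c0; rewrite cards_eq0 => /eqP ->; rewrite inE.
  have cR : (0 : R) < c%:R by rewrite ltr0n.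
  rewrite -(ler_pM2l cR) mulr_sumr.
  apply: (@le_trans _ _ (\sum_(y' in Y | hdist y y' == v) (kap + 1) * Ay)).
    apply: ler_sum => y' /andP[y'Y /eqP yv].
    apply: le_trans (ler_wpM2r (ler0n _ _) cb) _.
    by rewrite mulrDl mul1r [T _ * _]mulrC mulrDl mul1r lerD // bnd.
  rewrite sumr_const -[_ *+ _]mulr_natl ler_wpM2r ?mulr_ge0 ?addr_ge0 // ler_nat.
  by rewrite /c cardsE.
rewrite (partition_big (fun y' => inord (hdist y y') : 'I_n.+1) predT) //=.
rewrite -mulrA mulr_natl -[X in _ *+ X]card_ord -sumr_const; apply: ler_sum => v _.
apply: le_trans (lev v); rewrite le_eqVlt; apply/orP; left; apply/eqP; apply: eq_bigl => y'.
by rewrite -val_eqE /= inordK // ltnS hdist_le.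
Qed.

End Levels.

(** * Logarithmic inequalities *)

Section Derivatives.
Variable R : realType.
Implicit Types (f g : R -> R) (x a b c : R).

Lemma isd_eq f x a b : is_derive x 1 f a -> a = b -> is_derive x 1 f b.
Proof. by move=> h <-. Qed.

Lemma isd_cst x c : is_derive x 1 (fun=> c) 0.
Proof. exact: is_derive_cst. Qed.

Lemma isd_id x : is_derive x 1 (fun t : R => t) 1.
Proof. exact: is_derive_id. Qed.

Lemma isdD f g x a b : is_derive x 1 f a -> is_derive x 1 g b ->
  is_derive x 1 (fun t => f t + g t) (a + b).
Proof. by move=> hf hg; exact: is_deriveD. Qed.

Lemma isdN f x a : is_derive x 1 f a -> is_derive x 1 (fun t => - f t) (- a).
Proof. by move=> hf; exact: is_deriveN. Qed.

Lemma isdM f g x a b : is_derive x 1 f a -> is_derive x 1 g b ->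
  is_derive x 1 (fun t => f t * g t) (f x * b + g x * a).
Proof. by move=> hf hg; exact: is_deriveM. Qed.

Lemma isdX f n x a : is_derive x 1 f a ->
  is_derive x 1 (fun t => f t ^+ n) (n%:R * f x ^+ n.-1 * a).
Proof.
move=> hf; have -> : (fun t => f t ^+ n) = f ^+ n; last exact: is_deriveX.
by apply/funext => t; rewrite fctE.
Qed.

Lemma isdV f x a : f x != 0 -> is_derive x 1 f a ->
  is_derive x 1 (fun t => (f t)^-1) (- (f x ^- 2) * a).
Proof. by move=> fx hf; exact: is_deriveV. Qed.

Lemma isd_ln f x a : 0 < f x -> is_derive x 1 f a ->
  is_derive x 1 (fun t => ln (f t)) ((f x)^-1 * a).
Proof. by move=> fx hf; apply: (@is_derive1_comp R (@ln R) f) => //; exact: is_derive1_ln. Qed.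

Lemma deriv_ge0_le f (df : R -> R) a b : a <= b ->
  (forall x, a <= x <= b -> is_derive x 1 f (df x)) ->
  (forall x, a <= x <= b -> 0 <= df x) -> f a <= f b.
Proof.
move=> ab hd hp.
have [x||c] := @MVT_segment R f df a b ab.
- by rewrite in_itv /= => /andP[h1 h2]; apply: hd; rewrite !ltW.
- apply: derivable_within_continuous => y; rewrite in_itv /= => h.
  by have [] := hd y h.
by rewrite in_itv /= => h e; rewrite -subr_ge0 e mulr_ge0 ?subr_ge0 // hp.
Qed.

End Derivatives.

(** Differentiates by recursion on the syntax, leaving the side conditions of [ln] and of the
    inverse as goals; the last cases treat eta-contracted functions. *)
Ltac isd := lazymatch goal with
  | |- is_derive _ _ (fun t => t) _ => eapply isd_id
  | |- is_derive _ _ (fun _ => ?c) _ => eapply isd_cst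
  | |- is_derive _ _ (fun t => @?f t + @?g t) _ => eapply isdD; isd
  | |- is_derive _ _ (fun t => - @?f t) _ => eapply isdN; isd
  | |- is_derive _ _ (fun t => ln (@?f t)) _ => eapply isd_ln; [cbv beta|isd]
  | |- is_derive _ _ (fun t => (@?f t) ^+ ?n) _ => eapply isdX; isd
  | |- is_derive _ _ (fun t => (@?f t)^-1) _ => eapply isdV; [cbv beta|isd]
  | |- is_derive _ _ (fun t => @?f t * @?g t) _ => eapply isdM; isd
  | |- is_derive ?x ?v (+%R ?c) ?d => change (is_derive x v (fun t => c + id t) d); isd
  | |- is_derive ?x ?v ( *%R ?c) ?d => change (is_derive x v (fun t => c * id t) d); isd
  | |- is_derive ?x ?v -%R ?d => change (is_derive x v (fun t => - id t) d); isd
  | |- is_derive ?x ?v (@ln ?R) ?d => change (is_derive x v (fun t : R => ln (id t)) d); isd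
  | |- is_derive _ _ id _ => eapply isd_id
  end.

Section LogBounds.
Variable R : realType.
Implicit Types (s x y z : R).

Lemma ln_le_subr1 y : 0 < y -> ln y <= y - 1.
Proof.
move=> y0; have := @le_ln1Dx R (y - 1).
by rewrite [1 + _]addrC subrK; apply; lra.
Qed.

Lemma ln_tangent y z : 0 < y -> 0 < z -> ln y <= ln z + y / z - 1.
Proof.
move=> y0 z0; have := ln_le_subr1 (divr_gt0 y0 z0).
by rewrite ln_div ?posrE //; lra.
Qed.

(** This and the next Taylor bounds compare derivatives; here the difference of the two sides has
    derivative t^4 / (1 + t). *)
Lemma ln1D_ge s : 0 <= s -> s - s ^+ 2 / 2 + s ^+ 3 / 3 - s ^+ 4 / 4 <= ln (1 + s).
Proof.
move=> s0.
pose f t : R := ln (1 + t) - (t - t ^+ 2 / 2 + t ^+ 3 / 3 - t ^+ 4 / 4).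
suff : f 0 <= f s by rewrite /f !expr0n /= addr0 ln1; lra.
apply: (@deriv_ge0_le R f (fun t => (1 + t)^-1 - (1 - t + t ^+ 2 - t ^+ 3)) 0 s) => [|t /andP[t0 ts]|t /andP[t0 ts]]; first by lra.
  apply: isd_eq; first by rewrite /f; isd; lra.
  by rewrite /=; field; rewrite gt_eqF //; lra.
have t1 : 0 < 1 + t by lra.
rewrite subr_ge0 -(ler_pM2r t1) mulVf ?gt_eqF //.
have : 0 <= t ^+ 4 by rewrite exprn_ge0.
by rewrite (_ : _ * _ = 1 - t ^+ 4); [lra|ring].
Qed.

(** The coefficient 1/3 of s^4, instead of 1/4, absorbs the rest of the series: the difference has
    derivative t^3 (1 - 4 t) / (3 (1 - t)), whence the range up to 1/4. *)
Lemma ln1B_ge s : 0 <= s <= 1 / 4 -> - (s + s ^+ 2 / 2 + s ^+ 3 / 3 + s ^+ 4 / 3) <= ln (1 - s).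
Proof.
move=> /andP[s0 s1].
pose f t : R := ln (1 - t) - - (t + t ^+ 2 / 2 + t ^+ 3 / 3 + t ^+ 4 / 3).
suff : f 0 <= f s by rewrite /f !expr0n /= subr0 ln1; lra.
apply: (@deriv_ge0_le R f (fun t => - (1 - t)^-1 + (1 + t + t ^+ 2 + 4 / 3 * t ^+ 3)) 0 s) => [|t /andP[t0 ts]|t /andP[t0 ts]]; first by lra.
  apply: isd_eq; first by rewrite /f; isd; lra.
  by rewrite /=; field; rewrite gt_eqF //; lra.
have t1 : 0 < 1 - t by lra.
rewrite addrC subr_ge0 -(ler_pM2r t1) mulVf ?gt_eqF //.
have : 0 <= t ^+ 3 * (1 - 4 * t) by rewrite mulr_ge0 ?exprn_ge0 //; lra.
by rewrite (_ : (1 + _ + _ + _) * _ = 1 + (t ^+ 3 * (1 - 4 * t)) / 3); [lra|field].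
Qed.

Lemma ln1D_le z : 0 <= z -> ln (1 + z) <= z - z ^+ 2 / 2 + z ^+ 3 / 3.
Proof.
move=> s0.
pose f t : R := - ln (1 + t) - (- t + t ^+ 2 / 2 - t ^+ 3 / 3).
suff : f 0 <= f z by rewrite /f !expr0n /= addr0 ln1; lra.
apply: (@deriv_ge0_le R f (fun t => (1 - t + t ^+ 2) - (1 + t)^-1) 0 z) => [|t /andP[t0 ts]|t /andP[t0 ts]]; first by lra.
  apply: isd_eq; first by rewrite /f; isd; lra.
  by rewrite /=; field; rewrite gt_eqF //; lra.
have t1 : 0 < 1 + t by lra.
rewrite subr_ge0 -(ler_pM2r t1) mulVf ?gt_eqF //.
have : 0 <= t ^+ 3 by rewrite exprn_ge0.
by rewrite (_ : _ * _ = 1 + t ^+ 3); [lra|ring].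
Qed.

Lemma ln1B_le s : 0 <= s < 1 -> ln (1 - s) <= - (s + s ^+ 2 / 2).
Proof.
move=> /andP[s0 s1].
pose f t : R := - ln (1 - t) - (t + t ^+ 2 / 2).
suff : f 0 <= f s by rewrite /f !expr0n /= subr0 ln1; lra.
apply: (@deriv_ge0_le R f (fun t => (1 - t)^-1 - (1 + t)) 0 s) => [|t /andP[t0 ts]|t /andP[t0 ts]]; first by lra.
  apply: isd_eq; first by rewrite /f; isd; lra.
  by rewrite /=; field; rewrite gt_eqF //; lra.
have t1 : 0 < 1 - t by lra.
rewrite subr_ge0 -(ler_pM2r t1) mulVf ?gt_eqF //.
have : 0 <= t ^+ 2 by rewrite exprn_ge0.
by rewrite (_ : _ * _ = 1 - t ^+ 2); [lra|ring].
Qed.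

Lemma artanh_ge x : 0 <= x < 1 ->
  2 * (x + x ^+ 3 / 3 + x ^+ 5 / 5 + x ^+ 7 / 7) <= ln (1 + x) - ln (1 - x).
Proof.
move=> /andP[x0 x1].
pose f t : R := ln (1 + t) - ln (1 - t) - 2 * (t + t ^+ 3 / 3 + t ^+ 5 / 5 + t ^+ 7 / 7).
suff : f 0 <= f x by rewrite /f !expr0n /= subr0 addr0 ln1; lra.
apply: (@deriv_ge0_le R f (fun t => 2 * ((1 - t ^+ 2)^-1 - (1 + t ^+ 2 + t ^+ 4 + t ^+ 6))) 0 x) => [|t /andP[t0 ts]|t /andP[t0 ts]]; first by lra.
  have t1 : 0 < 1 - t by lra.
  have t2 : 0 < 1 + t by lra.
  apply: isd_eq; first by rewrite /f; isd; lra.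
  have t3 : 1 - t ^+ 2 = (1 - t) * (1 + t) by ring.
  by rewrite /= t3; field; rewrite !gt_eqF.
have t1 : 0 < 1 - t ^+ 2 by nra.
apply: mulr_ge0; first by lra.
rewrite subr_ge0 -(ler_pM2r t1) mulVf ?gt_eqF //.
have : 0 <= t ^+ 8 by rewrite exprn_ge0.
by rewrite (_ : _ * _ = 1 - t ^+ 8); [lra|ring].
Qed.

(** In nats, [ln 2] minus the entropy of (1 - x) / 2; at x = 1 - 2 rho this is [Rcrit]. *)
Definition gfun x : R := ((1 + x) * ln (1 + x) + (1 - x) * ln (1 - x)) / 2.

Lemma gfun_ge x : 0 <= x < 1 ->
  x ^+ 2 / 2 + x ^+ 4 / 12 + x ^+ 6 / 30 + x ^+ 8 / 56 <= gfun x.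
Proof.
move=> /andP[x0 x1].
pose f t : R := gfun t - (t ^+ 2 / 2 + t ^+ 4 / 12 + t ^+ 6 / 30 + t ^+ 8 / 56).
suff : f 0 <= f x by rewrite /f /gfun !expr0n /= subr0 addr0 ln1; lra.
apply: (@deriv_ge0_le R f (fun t => (ln (1 + t) - ln (1 - t)) / 2 - (t + t ^+ 3 / 3 + t ^+ 5 / 5 + t ^+ 7 / 7)) 0 x) => [|t /andP[t0 ts]|t /andP[t0 ts]]; first by lra.
  have t1 : 0 < 1 - t by lra.
  have t2 : 0 < 1 + t by lra.
  apply: isd_eq; first by rewrite /f /gfun; isd; lra.
  by rewrite /=; field; rewrite !gt_eqF.
have := @artanh_ge t; rewrite t0 (le_lt_trans ts x1) => /(_ isT); lra.
Qed.

(** The numbers 2, 8/5, 7/3 and 14/3, from which the tangent points below are formed, are built from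
    powers of 5/4 and factors close to 1, where short Taylor polynomials are accurate enough. *)
Lemma ln54 : ln (5 / 4 : R) <= 279 / 1250.
Proof.
have -> : (5 / 4 : R) = (1 - 1 / 5)^-1 by field.
rewrite lnV ?posrE; last by lra.
by have := @ln1B_ge (1 / 5); rewrite !expr_div_n !expr1n; lra.
Qed.

Lemma ln128_125 : ln (128 / 125 : R) <= 2372 / 100 / 1000.
Proof.
have -> : (128 / 125 : R) = 1 + 3 / 125 by field.
by have := @ln1D_le (3 / 125); lra.
Qed.

Lemma ln_mul y z : 0 < y -> 0 < z -> ln (y * z) = ln y + ln z.
Proof. by move=> y0 z0; rewrite lnM. Qed.

Lemma ln54X n : ln ((5 / 4 : R) ^+ n) = ln (5 / 4) *+ n.
Proof. by rewrite lnXn //; lra. Qed.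

Lemma ln2_le : ln (2 : R) <= 52 / 75.
Proof.
have -> : (2 : R) = (5 / 4) ^+ 3 * (128 / 125) by field.
have h1 : 0 < (5 / 4 : R) ^+ 3 by lra.
have h2 : 0 < (128 / 125 : R) by lra.
rewrite (ln_mul h1 h2) ln54X; have := ln54; have := ln128_125; lra.
Qed.

Lemma ln85 : ln (8 / 5 : R) <= 2351 / 5000.
Proof.
have -> : (8 / 5 : R) = (5 / 4) ^+ 2 * (128 / 125) by field.
have h1 : 0 < (5 / 4 : R) ^+ 2 by lra.
have h2 : 0 < (128 / 125 : R) by lra.
rewrite (ln_mul h1 h2) ln54X; have := ln54; have := ln128_125; lra.
Qed.

Lemma ln73 : ln (7 / 3 : R) <= 2119 / 2500.
Proof.
have -> : (7 / 3 : R) = (5 / 4) ^+ 4 * (1 - 83 / 1875) by field.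
have h1 : 0 < (5 / 4 : R) ^+ 4 by lra.
have h2 : 0 < (1 - 83 / 1875 : R) by lra.
have h3 : 0 <= (83 / 1875 : R) < 1 by lra.
rewrite (ln_mul h1 h2) ln54X; have := ln54; have := ln1B_le h3; lra.
Qed.

Lemma ln14_3 : ln (14 / 3 : R) <= 1541 / 1000.
Proof.
have -> : (14 / 3 : R) = 2 * (7 / 3) by field.
have h1 : 0 < (2 : R) by lra.
have h2 : 0 < (7 / 3 : R) by lra.
rewrite (ln_mul h1 h2); have := ln2_le; have := ln73; lra.
Qed.

End LogBounds.

(** * Numerical inequalities between entropies *)

Section EntropyInequalities.
Variable R : realType.
Implicit Types (s t x y z : R).

(* Entropy of s^2 / (1 + s^2), in nats. *)
Definition htau s : R := ln (1 + s ^+ 2) - 2 * s ^+ 2 / (1 + s ^+ 2) * ln s.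

(** The tangent to [ln] at [z], evaluated at 1 / s. With z = 14/3 it is exact at s = 3/14, the end
    of the range. *)
Lemma ln_ge_inv s z : 0 < s -> 0 < z -> - (ln z + s^-1 / z - 1) <= ln s.
Proof.
move=> s0 z0; have is0 : 0 < s^-1 by rewrite invr_gt0.
have := ln_tangent is0 z0; rewrite lnV ?posrE //; lra.
Qed.

(** In the Taylor bound of [gfun], multiplied by 1 + s^2, insert x^2 = 2 s / (1 + s^2) and bound the
    powers (1 + s^2)^-k from below by 1 - k s^2: a polynomial in [s] remains. *)
Lemma gfun_ge_rational s x : 0 < s -> 0 <= x < 1 -> x ^+ 2 = 2 * s / (1 + s ^+ 2) ->
  s + s ^+ 2 * (1 - s ^+ 2) / 3 + 4 * s ^+ 3 * (1 - 2 * s ^+ 2) / 15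
   + 2 * s ^+ 4 * (1 - 3 * s ^+ 2) / 7 <= (1 + s ^+ 2) * gfun x.
Proof.
move=> s0 x01 xE; have q0 : 0 < 1 + s ^+ 2 by rewrite ltr_wpDr ?sqr_ge0.
have s2 : 0 < s ^+ 2 by rewrite exprn_gt0.
set i := (1 + s ^+ 2)^-1.
have i0 : 0 < i by rewrite invr_gt0.
have i1 : 1 - s ^+ 2 <= i.
  by rewrite -(ler_pM2r q0) mulVf ?gt_eqF //; nra.
have i2 : 1 - 2 * s ^+ 2 <= i ^+ 2.
  have [h|h] := leP (1 - 2 * s ^+ 2) 0; first by rewrite (le_trans h) ?sqr_ge0.
  by nra.
have qi : (1 + s ^+ 2) * i = 1 by rewrite mulfV ?gt_eqF.
have i3 : 1 - 3 * s ^+ 2 <= i ^+ 3.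
  have [h|h] := leP (1 - 3 * s ^+ 2) 0; first by rewrite (le_trans h) // exprn_ge0 // ltW.
  have : (1 - 2 * s ^+ 2) * (1 - s ^+ 2) <= i ^+ 2 * i by apply: ler_pM => //; nra.
  by rewrite -exprSr; nra.
have := gfun_ge x01; move/(ler_wpM2l (ltW q0)); apply: le_trans.
have -> : (1 + s ^+ 2) * (x ^+ 2 / 2 + x ^+ 4 / 12 + x ^+ 6 / 30 + x ^+ 8 / 56)
  = s + s ^+ 2 * i / 3 + 4 * s ^+ 3 * i ^+ 2 / 15 + 2 * s ^+ 4 * i ^+ 3 / 7.
  have -> : x ^+ 4 = (x ^+ 2) ^+ 2 by ring.
  have -> : x ^+ 6 = (x ^+ 2) ^+ 3 by ring.
  have -> : x ^+ 8 = (x ^+ 2) ^+ 4 by ring.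
  by rewrite xE /i; field; rewrite gt_eqF.
have s3 : 0 < s ^+ 3 by rewrite exprn_gt0.
have s4 : 0 < s ^+ 4 by rewrite exprn_gt0.
have e1 := ler_wpM2l (ltW s2) i1.
have e2 := ler_wpM2l (ltW s3) i2.
have e3 := ler_wpM2l (ltW s4) i3.
by lra.
Qed.

(** [T0] is the tangent point for ln (1 + 6 s + s^2), whose argument runs from 1 to about 7/3; three
    tangents cover the range. High powers of [s] are bounded by multiples of s^2, and (s - a)(b - s)
    >= 0 on each interval reduces the rest to linear arithmetic. *)
Lemma overlap_poly s (c1 l3 T0 : R) : 0 < s -> s <= 3 / 14 ->
  c1 <= 1541 / 1000 ->
  [\/ s <= 3 / 50 /\ T0 = 1 /\ l3 <= 0,
      3 / 50 <= s <= 13 / 100 /\ T0 = 8 / 5 /\ l3 <= 2351 / 5000 |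
      13 / 100 <= s /\ T0 = 7 / 3 /\ l3 <= 2119 / 2500] ->
  0 <= s + s ^+ 2 * (1 - s ^+ 2) / 3 + 4 * s ^+ 3 * (1 - 2 * s ^+ 2) / 15
   + 2 * s ^+ 4 * (1 - 3 * s ^+ 2) / 7
   + 2 * (1 + s) ^+ 2 * (s - s ^+ 2 / 2 + s ^+ 3 / 3 - s ^+ 4 / 4)
   - (1 - s) ^+ 2 / 2 * (s + s ^+ 2 / 2 + s ^+ 3 / 3 + s ^+ 4 / 3)
   - 2 * (1 + s ^+ 2) * (s ^+ 2 - s ^+ 4 / 2 + s ^+ 6 / 3)
   - 2 * s ^+ 2 * (c1 - 1) - 3 / 7 * s
   - (1 + 6 * s + s ^+ 2) / 4 * (l3 + (1 + 6 * s + s ^+ 2) / T0 - 1).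
Proof.
move=> s0 sb hc.
have s2 : 0 < s ^+ 2 by rewrite exprn_gt0.
have e1 : s ^+ 2 * (c1 - 1) <= s ^+ 2 * (541 / 1000) by rewrite ler_pM2l //; lra.
have T : 0 < 1 + 6 * s + s ^+ 2 by lra.
have g2 : s ^+ 2 <= 23 / 500.
  have : s * s <= 3 / 14 * (3 / 14) by apply: ler_pM => //; exact: ltW.
  by rewrite -expr2; lra.
have g3 : s ^+ 3 <= 3 / 14 * s ^+ 2 by rewrite exprS ler_pM2r.
have g4 : s ^+ 4 <= 23 / 500 * s ^+ 2 by rewrite (exprD s 2 2) ler_pM2r.
have g5 : s ^+ 5 <= 1 / 100 * s ^+ 2.
  have : s * s ^+ 4 <= 3 / 14 * s ^+ 4 by rewrite ler_pM2r // exprn_gt0.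
  by rewrite -exprS; lra.
have g6 : s ^+ 6 <= 1 / 450 * s ^+ 2.
  have : s * s ^+ 5 <= 3 / 14 * s ^+ 5 by rewrite ler_pM2r // exprn_gt0.
  by rewrite -exprS; lra.
have g8 : s ^+ 8 <= 1 / 5000 * s ^+ 2.
  have : s ^+ 2 * s ^+ 6 <= 23 / 500 * s ^+ 6 by rewrite ler_pM2r // exprn_gt0.
  by rewrite -exprD; lra.
have main (a b : R) : a <= s -> s <= b -> 0 <= (s - a) * (b - s).
  by move=> h1 h2; rewrite mulr_ge0 // subr_ge0.
clear hc s2; case=> [[h [-> hl]]|[/andP[h1 h2] [-> hl]]|[h [-> hl]]];
  have e2 := ler_wpM2l (ltW T) hl.
- have e3 := main _ _ (ltW s0) h; clear main hl; lra.
- have e3 := main _ _ h1 h2; clear main hl; lra.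
- have e3 := main _ _ h sb; clear main hl; lra.
Qed.

(* Negativity of the exponent of the overlap of two error events, at the
   critical triangle with all sides (1 - x^2) / 2. *)
Lemma overlap_entropy s x : 0 < s -> s <= 3 / 14 -> 0 <= x < 1 ->
  x ^+ 2 = 2 * s / (1 + s ^+ 2) ->
  htau s <= gfun x + (1 + x ^+ 2) * ln (1 + x ^+ 2) + (1 - x ^+ 2) * ln (1 - x ^+ 2) / 4
     - (1 + 3 * x ^+ 2) * ln (1 + 3 * x ^+ 2) / 4.
Proof.
move=> s0 sb x01 xE; have q0 : 0 < 1 + s ^+ 2 by rewrite ltr_wpDr ?sqr_ge0.
have s2 : 0 < s ^+ 2 by rewrite exprn_gt0.
have T0 : 0 < 1 + 6 * s + s ^+ 2 by lra.
have ps : 0 < 1 + s by lra.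
have ms : 0 < 1 - s by lra.
have E1 : 1 + x ^+ 2 = (1 + s) ^+ 2 / (1 + s ^+ 2) by rewrite xE; field; rewrite gt_eqF.
have E2 : 1 - x ^+ 2 = (1 - s) ^+ 2 / (1 + s ^+ 2) by rewrite xE; field; rewrite gt_eqF.
have E3 : 1 + 3 * x ^+ 2 = (1 + 6 * s + s ^+ 2) / (1 + s ^+ 2) by rewrite xE; field; rewrite gt_eqF.
rewrite E1 E2 E3 !ln_div ?posrE ?exprn_gt0 // !lnXn //.
rewrite -(ler_pM2l q0) -subr_ge0.
have G := gfun_ge_rational s0 x01 xE.
set L1 := ln (1 + s); set L2 := ln (1 - s); set L3 := ln (1 + 6 * s + s ^+ 2).
set Lq := ln (1 + s ^+ 2); set Ls := ln s; set g := gfun x in G *.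
have -> : (1 + s ^+ 2) * (g + (1 + s) ^+ 2 / (1 + s ^+ 2) * (L1 *+ 2 - Lq) +
     (1 - s) ^+ 2 / (1 + s ^+ 2) * (L2 *+ 2 - Lq) / 4 -
     (1 + 6 * s + s ^+ 2) / (1 + s ^+ 2) * (L3 - Lq) / 4) - (1 + s ^+ 2) * htau s =
   (1 + s ^+ 2) * g + 2 * (1 + s) ^+ 2 * L1 + (1 - s) ^+ 2 / 2 * L2
    - (1 + 6 * s + s ^+ 2) / 4 * L3 - 2 * (1 + s ^+ 2) * Lq + 2 * (s ^+ 2 * Ls).
  by rewrite /htau -/Lq -/Ls; field; rewrite gt_eqF.
have b1 : (1 + s) ^+ 2 * (s - s ^+ 2 / 2 + s ^+ 3 / 3 - s ^+ 4 / 4) <= (1 + s) ^+ 2 * L1.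
  by rewrite ler_wpM2l ?sqr_ge0 // ln1D_ge // ltW.
have b2 : (1 - s) ^+ 2 * - (s + s ^+ 2 / 2 + s ^+ 3 / 3 + s ^+ 4 / 3) <= (1 - s) ^+ 2 * L2.
  by rewrite ler_wpM2l ?sqr_ge0 // ln1B_ge //; lra.
have b3 : (1 + s ^+ 2) * Lq <= (1 + s ^+ 2) * (s ^+ 2 - s ^+ 4 / 2 + s ^+ 6 / 3).
  rewrite ler_wpM2l ?(ltW q0) //; have := ln1D_le (ltW s2).
  by rewrite -!exprM.
have b4 : - (s ^+ 2 * (ln (14 / 3) - 1)) - 3 / 14 * s <= s ^+ 2 * Ls.
  have h14 : 0 < (14 / 3 : R) by lra.
  have := ler_wpM2l (ltW s2) (ln_ge_inv s0 h14); apply: le_trans.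
  by rewrite le_eqVlt; apply/orP; left; apply/eqP; field; rewrite gt_eqF.
have tang z : 0 < z -> (1 + 6 * s + s ^+ 2) * L3 <= (1 + 6 * s + s ^+ 2) * (ln z + (1 + 6 * s + s ^+ 2) / z - 1).
  by move=> z0; rewrite ler_wpM2l ?(ltW T0) // ln_tangent.
have [z [z0 hz]] : exists z, 0 < z /\ [\/ s <= 3 / 50 /\ z = 1 /\ ln z <= 0,
      3 / 50 <= s <= 13 / 100 /\ z = 8 / 5 /\ ln z <= 2351 / 5000 |
      13 / 100 <= s /\ z = 7 / 3 /\ ln z <= 2119 / 2500].
  have [h1|h1] := leP s (3 / 50).
    by exists 1; split; [lra|apply: Or31; rewrite ln1].
  have [h2|h2] := leP s (13 / 100).
    exists (8 / 5); split; first by lra.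
    by apply: Or32; split; [rewrite (ltW h1)|split; [|exact: ln85]].
  exists (7 / 3); split; first by lra.
  by apply: Or33; split; [exact: ltW|split; [|exact: ln73]].
have P := @overlap_poly s (ln (14 / 3)) (ln z) z s0 sb (ln14_3 R) hz.
have tz := tang z z0.
move: P tz G b1 b2 b3 b4; clearbody L1 L2 L3 Lq Ls g; move: (ln (14 / 3)) (ln z) => c1 lz; clear; lra.
Qed.

(** This is the sign of the derivative in [entropy_decrease]. The tangent to the logarithm is taken
    at 1 / t = 28/3 below t = 27/200 and at 35/6 above; these are 14/3 times 2 and 14/3 times
    5/4. *)
Lemma entropy_slope t dl : 0 < t -> t <= 3 / 14 -> 59 / 200 <= dl ->
  - 2 * t * ln t <= (1 - t ^+ 2) * (2 * t / (1 + t ^+ 2) + dl).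
Proof.
move=> t0 tb hd; have q0 : 0 < 1 + t ^+ 2 by rewrite ltr_wpDr ?sqr_ge0.
have t2 : 0 < t ^+ 2 by rewrite exprn_gt0.
have i1 : 1 - t ^+ 2 <= (1 + t ^+ 2)^-1.
  by rewrite -(ler_pM2r q0) mulVf ?gt_eqF //; nra.
have m0 : 0 <= 1 - t ^+ 2 by nra.
apply: (@le_trans _ _ ((1 - t ^+ 2) * (2 * t * (1 - t ^+ 2) + 59 / 200))); last first.
  rewrite ler_wpM2l // lerD // ler_wpM2l //; lra.
have tang z : 0 < z -> - 2 * t * ln t <= 2 * t * (ln z - 1) + 2 / z.
  move=> z0; have := ler_wpM2l (ltW t0) (ln_ge_inv t0 z0).
  have -> : t * - (ln z + t^-1 / z - 1) = - (t * (ln z - 1)) - 1 / z.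
    by field; rewrite !gt_eqF.
  by lra.
have t4 : 0 <= t * t ^+ 4 by rewrite mulr_ge0 ?exprn_ge0 // ltW.
have chord (a b : R) : 0 <= a -> a <= t -> t <= b ->
    0 <= (t - a) * (b - t) /\ 0 <= (t - a) * (b - t) * (t + a + b).
  move=> a0 h1 h2; have h : 0 <= (t - a) * (b - t) by rewrite mulr_ge0 // subr_ge0.
  by split=> //; apply: mulr_ge0 => //; lra.
have tangM (y z c d : R) : 0 < y -> 0 < z -> ln y <= c -> ln z <= d ->
    - 2 * t * ln t <= 2 * t * (c + d - 1) + 2 / (y * z).
  move=> y0 z0 hc hd'; have := tang _ (mulr_gt0 y0 z0); rewrite ln_mul // => h.
  have e : t * (ln y + ln z) <= t * (c + d) by rewrite ler_pM2l // lerD.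
  by lra.
have [h|h] := leP t (27 / 200).
  have [e3 e4] := chord 0 _ (lexx 0) (ltW t0) h.
  apply: le_trans (tangM (14 / 3) 2 _ _ _ _ (ln14_3 R) (ln2_le R)) _; try lra.
have [e3 e4] := chord (27 / 200) _ ltac:(lra) (ltW h) tb.
apply: le_trans (tangM (14 / 3) (5 / 4) _ _ _ _ (ln14_3 R) (ln54 R)) _; try lra.
Qed.

(** Put u = 2 t / (1 + t^2). If x^2 = 1 - 2 dl and y^2 = (x^2 - u)(1 + u), then y^2 / 2 = x^2 / 2 -
    dl u - u^2 / 2, so the expression is htau t + y^2 / 2 up to a constant. That is the quantity
    minimised in [R1] over alpha = (1 - y) / 2, with y^2 / 2 in place of [gfun y]. *)
Lemma entropy_decrease t s dl : 0 < t -> t <= s -> s <= 3 / 14 -> 59 / 200 <= dl ->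
  htau s - (2 * s / (1 + s ^+ 2)) ^+ 2 / 2 - dl * (2 * s / (1 + s ^+ 2)) <=
  htau t - (2 * t / (1 + t ^+ 2)) ^+ 2 / 2 - dl * (2 * t / (1 + t ^+ 2)).
Proof.
move=> t0 ts sb hd.
pose f y : R := - (ln (1 + y ^+ 2) - 2 * y ^+ 2 / (1 + y ^+ 2) * ln y
   - (2 * y / (1 + y ^+ 2)) ^+ 2 / 2 - dl * (2 * y / (1 + y ^+ 2))).
suff : f t <= f s by rewrite /f /htau; lra.
pose df y : R := 2 / (1 + y ^+ 2) ^+ 2 * ((1 - y ^+ 2) * (2 * y / (1 + y ^+ 2) + dl) - - 2 * y * ln y).
apply: (@deriv_ge0_le R f df t s) => [|y /andP[ty ys]|y /andP[ty ys]]; first by [].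
  have y0 : 0 < y by lra.
  have q0 : 0 < 1 + y ^+ 2 by rewrite ltr_wpDr ?sqr_ge0.
  apply: isd_eq; first by rewrite /f; isd; rewrite ?gt_eqF.
  by rewrite /df /=; field; rewrite !gt_eqF.
have y0 : 0 < y by lra.
have q0 : 0 < 1 + y ^+ 2 by rewrite ltr_wpDr ?sqr_ge0.
apply: mulr_ge0; first by rewrite divr_ge0 // exprn_ge0 // ltW.
by rewrite subr_ge0 entropy_slope //; lra.
Qed.

Lemma htau_le_half s : 0 < s -> s <= 3 / 14 -> htau s <= s / (1 + s ^+ 2).
Proof.
move=> s0 sb; have q0 : 0 < 1 + s ^+ 2 by rewrite ltr_wpDr ?sqr_ge0.
have s2 : 0 < s ^+ 2 by rewrite exprn_gt0.
rewrite -(ler_pM2l q0).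
have -> : (1 + s ^+ 2) * (s / (1 + s ^+ 2)) = s by field; rewrite gt_eqF.
have -> : (1 + s ^+ 2) * htau s = (1 + s ^+ 2) * ln (1 + s ^+ 2) - 2 * (s ^+ 2 * ln s).
  by rewrite /htau; field; rewrite gt_eqF.
have b1 : (1 + s ^+ 2) * ln (1 + s ^+ 2) <= (1 + s ^+ 2) * s ^+ 2.
  by rewrite ler_pM2l // le_ln1Dx //; lra.
have h14 : 0 < (14 / 3 : R) by lra.
have := ler_wpM2l (ltW s2) (ln_ge_inv s0 h14).
have -> : s ^+ 2 * - (ln (14 / 3) + s^-1 / (14 / 3) - 1) = - (s ^+ 2 * (ln (14 / 3) - 1)) - 3 / 14 * s.
  by field; rewrite gt_eqF.
have e : s ^+ 2 * (ln (14 / 3) - 1) <= s ^+ 2 * (541 / 1000).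
  by rewrite ler_pM2l //; have := ln14_3 R; lra.
have f2 : s ^+ 2 <= 3 / 14 * s by rewrite expr2 ler_pM2r.
have f4 : s ^+ 4 <= 1 / 16 * s ^+ 2.
  rewrite (exprD s 2 2) ler_pM2r // (le_trans f2) //; lra.
move: b1 e f2 f4; move: (ln (14 / 3)) (ln s) (ln (1 + s ^+ 2)) => l1 l2 l3; lra.
Qed.

Lemma htau_gt0 s : 0 < s -> s < 1 -> 0 < htau s.
Proof.
move=> s0 s1; have q0 : 0 < 1 + s ^+ 2 by rewrite ltr_wpDr ?sqr_ge0.
have s2 : 0 < s ^+ 2 by rewrite exprn_gt0.
rewrite /htau subr_gt0; apply: (@lt_trans _ _ 0); last by rewrite ln_gt0 // ltrDl.
rewrite nmulr_llt0 ?divr_gt0 ?mulr_gt0 //; by rewrite ln_lt0 // s0.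
Qed.

End EntropyInequalities.

(** * Error probability of codes at the linear programming rate *)

(** A coordinate at which the three words do not all agree is counted exactly twice in the
    perimeter. *)
Lemma hdist_triple n (x y z : n.-tuple bool) :
  exists2 e, (e <= n)%N & (e.*2 = hdist x y + hdist x z + hdist y z)%N.
Proof.
exists #|[pred i | (tnth x i != tnth y i) || (tnth x i != tnth z i)]|.
  by rewrite -[X in (_ <= X)%N]card_ord max_card.
apply/eqP; rewrite -mul2n /hdist -!big_split /= -sum1_card big_distrr /= big_mkcond /=.
by apply/eqP; apply: eq_bigr => i _; rewrite inE /=; do 3 case: (tnth _ i).
Qed.

Lemma exprn_expR (R : realType) (a : R) k : 0 < a -> a ^+ k = expR (k%:R * ln a).
Proof. by move=> a0; rewrite expRM_natl lnK. Qed.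

(* [2 sqrt (p (1 - p))], [delta1], [p] and [rho] in terms of [x = 1 - 2 rho]. *)
Definition gamx (R : realType) (x : R) : R := (1 - x ^+ 2) / (1 + x ^+ 2).
Definition dlx (R : realType) (x : R) : R := (1 - x ^+ 2) / 2.
Definition px (R : realType) (x : R) : R := (1 - x) ^+ 2 / (2 * (1 + x ^+ 2)).
Definition rhx (R : realType) (x : R) : R := (1 - x) / 2.

(* The condition [s <= 3 / 14], i.e. [x^2 <= 84 / 205], is slightly weaker than
   [p >= 0.046]. *)
Definition adm (R : realType) (x s : R) : Prop :=
  [/\ 0 < s, s <= 3 / 14, 0 < x, x < 1 & x ^+ 2 = 2 * s / (1 + s ^+ 2)].

Section Base.
Variables (R : realType) (x s : R).

Local Notation gam := (gamx x).
Local Notation dl := (dlx x).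
Local Notation p := (px x).
Local Notation rh := (rhx x).

Lemma admP : adm x s ->
  [/\ 0 < x /\ x < 1, 0 < 1 + x ^+ 2, 0 < x ^+ 2 & x ^+ 2 < 1].
Proof.
case=> _ _ x0 x1 _; split; [by [] | | by rewrite exprn_gt0 | by rewrite expr_lt1 // ltW].
by rewrite ltr_wpDr ?sqr_ge0.
Qed.

Lemma gam01 : adm x s -> 0 < gam < 1.
Proof. by move/admP=> [[x0 x1] q0 x20 x21]; rewrite /gamx divr_gt0 ?subr_gt0 //= ltr_pdivrMr // mul1r; lra. Qed.

Lemma dl_gam : adm x s -> dl = gam / (1 + gam).
Proof. by move/admP=> [[x0 x1] q0 x20 x21]; rewrite /dlx /gamx; field; rewrite gt_eqF //= gt_eqF //; lra. Qed.

Lemma p01 : adm x s -> 0 < p < 1.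
Proof.
move/admP=> [[x0 x1] q0 x20 x21]; have h : 0 < (1 - x) ^+ 2 by rewrite exprn_gt0 // subr_gt0.
have d0 : 0 < 2 * (1 + x ^+ 2) by rewrite mulr_gt0.
by rewrite /px; apply/andP; split; [rewrite divr_gt0|rewrite ltr_pdivrMr // mul1r; nra].
Qed.

Lemma pE : adm x s -> 1 - p = (1 + x) ^+ 2 / (2 * (1 + x ^+ 2)).
Proof. by move/admP=> [[x0 x1] q0 x20 x21]; rewrite /px; field; rewrite gt_eqF. Qed.

Lemma p_gam : adm x s -> 4 * (p * (1 - p)) = gam ^+ 2.
Proof. by move=> /[dup] /pE -> /admP[[x0 x1] q0 x20 x21]; rewrite /px /gamx; field; rewrite gt_eqF. Qed.

Lemma rh_gt0 : adm x s -> 0 < rh /\ 0 < 1 - rh.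
Proof. by move/admP=> [[x0 x1] _ _ _]; rewrite /rhx; split; lra. Qed.

Lemma gam_x : adm x s -> (1 + gam) * (1 + x ^+ 2) = 2.
Proof. by move/admP=> [_ q0 _ _]; rewrite /gamx; field; rewrite gt_eqF. Qed.

Lemma sqrt_gam : adm x s -> Num.sqrt gam = (1 - s) / (1 + s).
Proof.
move=> /[dup] /admP[_ q0 x20 x21] [s0 sle x0 x1 xs]; have s1 : 0 < 1 + s by lra.
have qs : 0 < 1 + s ^+ 2 by rewrite ltr_wpDr ?sqr_ge0.
have h : 0 <= (1 - s) / (1 + s) by rewrite divr_ge0 //; lra.
rewrite -[RHS]ger0_norm // -sqrtr_sqr; congr Num.sqrt.
rewrite /gamx xs; field; rewrite !gt_eqF //=; nra.
Qed.

(** Growth rate of the logarithm of the overlap ratio in [overlap_exponent] with the common side [w]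
    of an equilateral triangle. *)
Definition slope : R :=
  3 / 2 * (ln (1 - x) + ln (1 + x) - ln (1 + 3 * x ^+ 2))
  - 2 * (ln (1 - x) + ln (1 + x) - ln (1 + x ^+ 2))
  - x / (1 + x ^+ 2) * (ln (1 - x) - ln (1 + x)).

(** Larger triangles are therefore worse, and the largest [w] decides. Bounding each group of
    logarithms to first order leaves three multiples of x^2 / (1 + x^2) that cancel exactly. *)
Lemma slope_ge0 : adm x s -> 0 <= slope.
Proof.
move/admP=> [[x0 x1] q0 x20 x21].
have T : 0 < 1 + 3 * x ^+ 2 by lra.
have mx : 0 < 1 - x by lra.
have ppx : 0 < 1 + x by lra.
have h1 : ln (1 + 3 * x ^+ 2) - ln (1 + x ^+ 2) <= 2 * x ^+ 2 / (1 + x ^+ 2).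
  rewrite -ln_div ?posrE //; apply: le_trans (ln_le_subr1 (divr_gt0 T q0)) _.
  by rewrite le_eqVlt; apply/orP; left; apply/eqP; field; rewrite gt_eqF.
have h2 : ln (1 - x) + ln (1 + x) - ln (1 + x ^+ 2) <= - (2 * x ^+ 2 / (1 + x ^+ 2)).
  rewrite -lnM ?posrE // -ln_div ?posrE ?mulr_gt0 //.
  apply: le_trans (ln_le_subr1 (divr_gt0 (mulr_gt0 mx ppx) q0)) _.
  by rewrite le_eqVlt; apply/orP; left; apply/eqP; field; rewrite gt_eqF.
have h3 : 2 * x <= ln (1 + x) - ln (1 - x).
  have := @artanh_ge R x; rewrite (ltW x0) x1 => /(_ isT).
  have := exprn_ge0 3 (ltW x0); have := exprn_ge0 5 (ltW x0); have := exprn_ge0 7 (ltW x0).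
  by lra.
have h4 : x / (1 + x ^+ 2) * (2 * x) <= x / (1 + x ^+ 2) * (ln (1 + x) - ln (1 - x)).
  by rewrite ler_wpM2l // divr_ge0 // ltW.
have e : x / (1 + x ^+ 2) * (2 * x) = 2 * x ^+ 2 / (1 + x ^+ 2) by field; rewrite gt_eqF.
by rewrite /slope; lra.
Qed.

(** Compares the Chernoff bound for a triple overlap, weighted by the growth of the threshold at
    distance [v], with the size of a single midpoint set. The gain exp(- n htau s) is what a code of
    rate [htau s] uses up. *)
Lemma overlap_exponent (n w v e r : nat) (D : R) : adm x s -> (v <= w)%N -> (2 * w + v <= 2 * e)%N ->
  (e <= n)%N -> (r <= n)%N -> r%:R <= w%:R / 2 + p * (n%:R - w%:R) + 1 ->
  w%:R <= dl * n%:R + D ->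
  (rh * (1 - rh)) ^+ e * (1 - 3 * (rh * (1 - rh))) ^+ (n - e) *
     (p ^+ r * (1 - p) ^+ (n - r)) * (1 + gam) ^+ n <=
  expR (slope * D + (ln (1 + x) - ln (1 - x)) - n%:R * htau s) *
    (2 ^+ n * gam ^+ v * gam ^+ w * (rh ^+ r * (1 - rh) ^+ (n - r)) ^+ 3).
Proof.
move=> A vw we en rn hr hw; have [s0 sle x0 x1 xs] := A; have [_ q0 x20 x21] := admP A.
have T0 : 0 < 1 + 3 * x ^+ 2 by lra.
have mx : 0 < 1 - x by lra.
have ppx : 0 < 1 + x by lra.
have [gam0 gam1]   := andP (gam01 A).
have l2 : 0 < (2 : R) by lra.
have rh0 : 0 < rh by rewrite /rhx; lra.
have rhE : 1 - rh = (1 + x) / 2 by rewrite /rhx; field.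
have rh1 : 0 < 1 - rh by rewrite rhE; lra.
have [p0 p1] := andP (p01 A).
have t3E : 1 - 3 * (rh * (1 - rh)) = (1 + 3 * x ^+ 2) / 4 by rewrite /rhx; field.
have g1E : 1 + gam = 2 / (1 + x ^+ 2) by rewrite /gamx; field; rewrite gt_eqF.
have L1 : ln rh = ln (1 - x) - ln 2 by rewrite /rhx ln_div ?posrE.
have L2 : ln (1 - rh) = ln (1 + x) - ln 2 by rewrite rhE ln_div ?posrE.
have L4 : ln (4 : R) = 2 * ln 2.
  by have -> : (4 : R) = 2 ^+ 2 by [ring]; rewrite lnXn // mulr2n; ring.
have L3 : ln (1 - 3 * (rh * (1 - rh))) = ln (1 + 3 * x ^+ 2) - 2 * ln 2.
  by rewrite t3E ln_div ?posrE // L4.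
have L5 : ln p = 2 * ln (1 - x) - ln 2 - ln (1 + x ^+ 2).
  rewrite /px ln_div ?posrE ?mulr_gt0 ?exprn_gt0 // lnXn // lnM ?posrE // mulr2n; ring.
have L6 : ln (1 - p) = 2 * ln (1 + x) - ln 2 - ln (1 + x ^+ 2).
  rewrite (pE A) ln_div ?posrE ?mulr_gt0 ?exprn_gt0 // lnXn // lnM ?posrE // mulr2n; ring.
have L7 : ln (1 + gam) = ln 2 - ln (1 + x ^+ 2) by rewrite g1E ln_div ?posrE.
have L8 : ln gam = ln (1 - x) + ln (1 + x) - ln (1 + x ^+ 2).
  have -> : gam = (1 - x) * (1 + x) / (1 + x ^+ 2) by rewrite /gamx; field; rewrite gt_eqF.
  by rewrite ln_div ?posrE ?mulr_gt0 // lnM ?posrE.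
have L9 : ln (rh * (1 - rh)) = ln (1 - x) + ln (1 + x) - 2 * ln 2.
  by rewrite lnM ?posrE // L1 L2; ring.
have p1' : 0 < 1 - p by lra.
have t30 : 0 < 1 - 3 * (rh * (1 - rh)) by rewrite t3E; lra.
have g10 : 0 < 1 + gam by lra.
rewrite (exprn_expR e (mulr_gt0 rh0 rh1)) (exprn_expR _ t30) (exprn_expR r p0) (exprn_expR _ p1').
rewrite (exprn_expR n g10) (exprn_expR n l2) (exprn_expR v gam0) (exprn_expR w gam0).
rewrite (exprn_expR r rh0) (exprn_expR _ rh1) -!expRD -(expRM_natl 3) -!expRD ler_expR.
rewrite !natrB // L1 L2 L3 L5 L6 L7 L8 L9.
have A1 : ln (1 - x) + ln (1 + x) <= ln (1 + 3 * x ^+ 2).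
  by rewrite -lnM ?posrE // ler_ln ?posrE ?mulr_gt0 //; nra.
have A2 : ln (1 - x) + ln (1 + x) + ln (1 + 3 * x ^+ 2) <= 2 * ln (1 + x ^+ 2).
  have -> : 2 * ln (1 + x ^+ 2) = ln ((1 + x ^+ 2) ^+ 2) by rewrite lnXn // mulr2n; ring.
  rewrite -!lnM ?posrE ?mulr_gt0 // ler_ln ?posrE ?mulr_gt0 ?exprn_gt0 //; nra.
have A3 : ln (1 - x) <= ln (1 + x) by rewrite ler_ln ?posrE //; lra.
have x01 : 0 <= x < 1 by rewrite (ltW x0) x1.
have I1 := overlap_entropy s0 sle x01 xs.
have sl0 := (slope_ge0 A).
have nR : (0 : R) <= n%:R by [].
have vR : v%:R <= w%:R :> R by rewrite ler_nat.
have eR : 2 * w%:R + v%:R <= 2 * e%:R :> R by rewrite -!natrM -natrD ler_nat.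
move: (htau s) I1 => H.
have -> : ln (1 - x ^+ 2) = ln (1 - x) + ln (1 + x).
  by rewrite -lnM ?posrE //; congr ln; ring.
rewrite /gfun => I1.
have sE : slope = 3 / 2 * (ln (1 - x) + ln (1 + x) - ln (1 + 3 * x ^+ 2))
  - 2 * (ln (1 - x) + ln (1 + x) - ln (1 + x ^+ 2))
  - x / (1 + x ^+ 2) * (ln (1 - x) - ln (1 + x)) by [].
move: slope sE sl0 => c1 c1E c10.
move: (ln (1 - x)) (ln (1 + x)) (ln (1 + 3 * x ^+ 2)) (ln (1 + x ^+ 2)) A1 A2 A3 I1 c1E => m q T a A1 A2 A3 I1 c1E.
have hpE : p = 1 / 2 - x / (1 + x ^+ 2) by rewrite /px; field; rewrite gt_eqF.
(* All is now linear in [e], [r], [v] and [w]. [B1] to [B4] move each of them to its extreme value,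
   reaching the triangle with all sides [dl * n + D]; there [overlap_entropy] concludes through
   [B5]. *)
have B1 : e%:R * (m + q - T) <= (w%:R + v%:R / 2) * (m + q - T).
  by rewrite ler_wnM2r ?subr_le0 //; lra.
have B2 : r%:R * (q - m) <= (w%:R / 2 + p * (n%:R - w%:R) + 1) * (q - m).
  by rewrite ler_wpM2r // subr_ge0.
have B3 : v%:R * (2 * a - (m + q + T)) <= w%:R * (2 * a - (m + q + T)).
  by rewrite ler_wpM2r // subr_ge0.
have B4 : c1 * w%:R <= c1 * (dl * n%:R + D) by rewrite ler_wpM2l.
pose c0 := T - 2 * a - q - p * (m - q).
have c0E : c0 + dl * c1 = - (((1 + x) * q + (1 - x) * m) / 2 + (1 + x ^+ 2) * a
    + (1 - x ^+ 2) * (m + q) / 4 - (1 + 3 * x ^+ 2) * T / 4).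
  by rewrite /c0 c1E /px /dlx; field; rewrite gt_eqF.
have B5 : n%:R * (c0 + dl * c1) <= n%:R * (- H) by rewrite ler_wpM2l // c0E; lra.
have c1w : c1 * w%:R = w%:R * (3 / 2 * (m + q - T) - 2 * (m + q - a) + (1 / 2 - p) * (q - m)).
  by rewrite c1E hpE; ring.
move: B1 B2 B3 B4 B5 c1w; rewrite /c0; clear; lra.
Qed.

(** The single radius h + k2 carries the whole Bhattacharyya factor [gam ^+ h.*2] up to (n + 1)^2:
    C(2h, h) is about 4^h, 4 p (1 - p) is gam^2, and [k2] is the mode of the noise on the
    coordinates where the two words agree. *)
Lemma mid_lower (n : nat) (h k2 : nat) (y z : n.-tuple bool) : adm x s -> hdist y z = h.*2 ->
  1 <= (n - h.*2).+1%:R * ('C(n - h.*2, k2)%:R * p ^+ k2 * (1 - p) ^+ (n - h.*2 - k2)) ->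
  (k2 <= n - h.*2)%N ->
  gam ^+ h.*2 <= n.+1%:R ^+ 2 * (p ^+ (h + k2) * (1 - p) ^+ (n - (h + k2))) * #|mid y z (h + k2)|%:R.
Proof.
move=> A yz hm hk; have [p0 p1] := andP (p01 A).
have hn : (h.*2 <= n)%N by rewrite -yz hdist_le.
have h2 : 4 ^+ h <= (h.*2).+1%:R * 'C(h.*2, h)%:R :> R.
  have [|k [kn k1 k2' k3]] := @binomial_mode R h.*2 (1 / 2); first by lra.
  have kh : k = h.
    have a1 : (2 * k <= h.*2.+1)%N.
      by rewrite -(ler_nat R) natrM; move: k2'; lra.
    have a2 : (h.*2.+1 <= 2 * k.+1)%N.
      by rewrite -(ler_nat R) natrM; move: k3; lra.
    by move: a1 a2; clear; rewrite -mul2n; lia.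
  move: k1; rewrite kh (_ : h.*2 - h = h)%N; last by rewrite -addnn addnK.
  have -> : (1 - 1 / 2 : R) = 1 / 2 by field.
  rewrite -mulrA -exprMn => k1; have f4 : 0 < 4 ^+ h :> R by rewrite exprn_gt0.
  rewrite -[leLHS]mulr1; apply: le_trans (ler_wpM2l (ltW f4) k1) _.
  rewrite le_eqVlt; apply/orP; left; apply/eqP.
  rewrite mulrCA [4 ^+ h * _]mulrCA -exprMn.
  by rewrite (_ : 4 * (1 / 2 * (1 / 2)) = 1 :> R) ?expr1n ?mulr1 //; field.
have q0 : 0 < 1 - p by lra.
have c : 'C(h.*2, h)%:R * 'C(n - h.*2, k2)%:R <= #|mid y z (h + k2)|%:R :> R.
  by rewrite -natrM ler_nat card_mid.
have pq0 : 0 < p ^+ (h + k2) * (1 - p) ^+ (n - (h + k2)) by rewrite mulr_gt0 ?exprn_gt0.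
apply: (@le_trans _ _ (n.+1%:R ^+ 2 * (p ^+ (h + k2) * (1 - p) ^+ (n - (h + k2))) *
    ('C(h.*2, h)%:R * 'C(n - h.*2, k2)%:R))); last first.
  by rewrite ler_wpM2l // mulr_ge0 ?(ltW pq0) // exprn_ge0.
have -> : gam ^+ h.*2 = 4 ^+ h * (p * (1 - p)) ^+ h by rewrite -mul2n exprM -(p_gam A) exprMn.
have -> : n.+1%:R ^+ 2 * (p ^+ (h + k2) * (1 - p) ^+ (n - (h + k2))) *
    ('C(h.*2, h)%:R * 'C(n - h.*2, k2)%:R) =
  (n.+1%:R * 'C(h.*2, h)%:R) * (p * (1 - p)) ^+ h *
  (n.+1%:R * ('C(n - h.*2, k2)%:R * p ^+ k2 * (1 - p) ^+ (n - h.*2 - k2))).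
  have -> : (n - (h + k2) = h + (n - h.*2 - k2))%N by move: hk hn; clear; rewrite -mul2n; lia.
  rewrite !exprD [(p * (1 - p)) ^+ h]exprMn.
  by move: (p ^+ h) (p ^+ k2) ((1 - p) ^+ h) ((1 - p) ^+ _) ('C(h.*2, h)%:R) ('C(n - h.*2, k2)%:R) n.+1%:R => *; ring.
rewrite -[leLHS]mulr1; apply: ler_pM => //.
- by rewrite mulr_ge0 // exprn_ge0 // (mulr_ge0 (ltW p0) (ltW q0)).
- rewrite ler_wpM2r ?(exprn_ge0 _ (mulr_ge0 (ltW p0) (ltW q0))) //.
  by apply: le_trans h2 _; rewrite ler_wpM2r // ler_nat ltnS.
- apply: le_trans hm _; rewrite ler_wpM2r ?ler_nat ?ltnS ?leq_subr //.
  apply: mulr_ge0; last exact: exprn_ge0 (ltW q0).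
  by apply: mulr_ge0 => //; exact: exprn_ge0 (ltW p0).
Qed.

End Base.

Section BaseFinite.
Variables (R : realType) (x s : R) (n : nat).

#[local] Opaque gamx dlx px rhx.

Local Notation gam := (gamx x).
Local Notation dl := (dlx x).
Local Notation p := (px x).
Local Notation rh := (rhx x).
Local Notation K := (@kraw n R).

(** N / (8 n^2) divided by the bound of [kraw_bound] summed over a window of [m] degrees; [c] is the
    excess of the largest distance considered over the mode [k]. *)
Definition threshold (N : R) (m c v : nat) : R :=
  N * (1 + gam) ^+ n * gam ^+ c / (8 * n%:R ^+ 2 * n.+1%:R * m%:R * 2 ^+ n * gam ^+ v).

Lemma threshold_gt0 N m c v : adm x s -> 0 < N -> (0 < n)%N -> (0 < m)%N -> 0 < threshold N m c v.
Proof.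
move=> A N0 n0 m0; have [gam0 gam1] := andP (gam01 A); have g1 : 0 < 1 + gam by lra.
by rewrite /threshold divr_gt0 ?mulr_gt0 ?exprn_gt0 ?ltr0n.
Qed.

Lemma sum_nbr (Z : {set n.-tuple bool}) (y : n.-tuple bool) (f : nat -> R) (a : nat) :
  \sum_(z in Z | (hdist y z <= a)%N) f (hdist y z) = \sum_(v < a.+1) #|nbr Z y v|%:R * f v.
Proof.
rewrite (partition_big (fun z => inord (hdist y z) : 'I_a.+1) predT) //=.
apply: eq_bigr => v _.
rewrite (eq_bigl (mem (nbr Z y v))); last first.
  move=> z; rewrite !inE -andbA; congr (_ && _).
  apply/andP/eqP => [[h1 /eqP <-]|->]; first by rewrite inordK.
  by split; [rewrite -ltnS | rewrite inord_val].
rewrite (eq_bigr (fun=> f v)); last by move=> z /=; rewrite inE => /andP[_ /eqP ->].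
by rewrite sumr_const mulr_natl.
Qed.

Lemma card_window (b m : nat) : (b + m < n)%N ->
  #|[pred j : 'I_n.+1 | (b < j <= b + m)%N]| = m.
Proof.
move=> bmn; rewrite -sum1_card.
rewrite -(big_mkord (fun j => (b < j <= b + m)%N) (fun=> 1%N)).
rewrite (big_cat_nat _ (n := b.+1)) //=; last by rewrite ltnS; lia.
rewrite big_nat_cond big_pred0 ?add0n; last by move=> j; lia.
rewrite (big_cat_nat _ (n := (b + m).+1)) //=; try lia.
rewrite [X in (_ + X)%N]big_nat_cond [X in (_ + X)%N]big_pred0 ?addn0; last by move=> j; lia.
rewrite big_nat_cond (eq_bigl (fun j => b.+1 <= j < (b + m).+1)%N); last by move=> j; lia.
by rewrite -big_nat sum_nat_const_nat; lia.
Qed.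

(** If no level exceeded its threshold, the distances 1 to k + c would contribute at most N / (8 n)
    to each row and the diagonal at most [m * Cm]; [lp_bound] would then give |Z| <= N / 4, against
    |Z| >= N / 2. *)
Lemma lp_level (X : {set n.-tuple bool}) (b m k c : nat) (s0 l Cm : R) :
  adm x s -> (0 < n)%N -> (0 < #|X|)%N ->
  (0 < b)%N -> (0 < m)%N -> (b + m < n)%N ->
  0 <= s0 -> s0 * s <= b%:R -> s0 <= (n - (b + m))%:R * s -> 0 <= l ->
  l + 1 <= 2 * s0 * (1 - m%:R^-1) -> (forall d, (k + c < d)%N -> n%:R - 2 * d%:R <= l) ->
  (forall j, (j <= b + m)%N -> 2 * dl * n%:R <= (n%:R - 2 * j%:R) * Num.sqrt gam) ->
  (k <= n)%N -> 1 <= n.+1%:R * ('C(n, k)%:R * dl ^+ k * (1 - dl) ^+ (n - k)) ->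
  k%:R <= n.+1%:R * dl -> ((k + c).*2 <= n)%N ->
  (forall j, (j <= b + m)%N -> 'C(n, j)%:R <= Cm) -> 8 * n%:R * m%:R * Cm <= #|X|%:R ->
  forall Z : {set n.-tuple bool}, Z \subset X -> (#|X| <= #|Z| * 2)%N ->
    exists2 y, y \in Z & exists2 v, (0 < v <= k + c)%N & threshold #|X|%:R m c v < #|nbr Z y v|%:R.
Proof.
move=> A n0 X0 b0 m0 bmn s00 hs1 hs2 l0 hl hd hj kn hmode hk ka hC hN Z ZX cZ.
have [gam0 gam1] := andP (gam01 A).
set N := #|X|%:R; set T := threshold N m c; set a := (k + c)%N.
pose good y := [exists v : 'I_a.+1, (0 < v)%N && (T v < #|nbr Z y v|%:R)].
case: (boolP [exists y in Z, good y]) => [/exists_inP[y yZ /existsP[v /andP[v0 hv]]]|].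
  by exists y => //; exists v => //; rewrite v0 /= -ltnS.
rewrite negb_exists_in => /forall_inP bad; exfalso.
have {}bad y v : y \in Z -> (0 < v <= a)%N -> #|nbr Z y v|%:R <= T v.
  move=> yZ /andP[v0 va]; have := bad y yZ; rewrite /good negb_exists => /forallP /(_ (inord v)).
  by rewrite inordK ?ltnS // v0 /= -leNgt.
have n0R : (0 : R) < n%:R by rewrite ltr0n.
have n1R : (0 : R) < n.+1%:R by rewrite ltr0n.
have m0R : (0 : R) < m%:R by rewrite ltr0n.
have N0 : 0 < N by rewrite ltr0n.
have g1 : 0 < (1 + gam) ^+ n by rewrite exprn_gt0 //; lra.
have gc : 0 < gam ^+ c by rewrite exprn_gt0.
have w2 : (0 : R) < 2 ^+ n by rewrite exprn_gt0.
pose phi d := \sum_(j < n.+1 | (b < j <= b + m)%N) (K j d) ^+ 2 / 'C(n, j)%:R.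
have win (f : nat -> R) B : (forall j, (j <= b + m)%N -> f j <= B) ->
    \sum_(j < n.+1 | (b < j <= b + m)%N) f j <= m%:R * B.
  move=> hf; apply: (@le_trans _ _ (\sum_(j < n.+1 | (b < j <= b + m)%N) B)).
    by apply: ler_sum => j /andP[_]; apply: hf.
  by rewrite sumr_const (card_window bmn) mulr_natl.
have Cp j : (j <= b + m)%N -> (0 : R) < 'C(n, j)%:R.
  by move=> h; rewrite ltr0n bin_gt0; move: h bmn; clear; lia.
have phi0 : phi 0%N <= m%:R * Cm.
  apply: (win (fun j => K j 0 ^+ 2 / 'C(n, j)%:R)) => j jb.
  by rewrite krawj0 expr2 -mulrA mulfV ?mulr1 ?hC // gt_eqF // Cp.
have phiv v : (v <= a)%N -> phi v <= m%:R * (n.+1%:R * 2 ^+ n * gam ^+ v / ((1 + gam) ^+ n * gam ^+ c)).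
  move=> va; apply: (win (fun j => K j v ^+ 2 / 'C(n, j)%:R)) => j jb.
  rewrite ler_pdivrMr ?Cp // mulrAC ler_pdivlMr ?mulr_gt0 //.
  have jn : (j <= n)%N by move: jb bmn; clear; lia.
  have := @kraw_bound R n gam dl j k a v (gam01 A) (dl_gam A) jn (hj j jb) kn hmode hk (leq_addr _ _) ka va.
  by rewrite /a addKn.
have T0 v : 0 < T v by apply: threshold_gt0.
have Tphi v : (0 < v <= a)%N -> T v * phi v <= N / (8 * n%:R ^+ 2).
  move=> /andP[v0 va]; apply: le_trans (ler_wpM2l (ltW (T0 v)) (phiv v va)) _.
  rewrite le_eqVlt; apply/orP; left; apply/eqP; rewrite /T /threshold.
  have gv : 0 < gam ^+ v by rewrite exprn_gt0.
  by field; rewrite !gt_eqF.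
have lp := @lp_bound R n Z s s0 l b m a.
have [s_gt0 _ _ _ _] := A.
have {}lp := lp s_gt0 b0 m0 bmn s00 hs1 hs2 l0 hl hd.
have phi_ge0 v : 0 <= phi v.
  by apply: sumr_ge0 => j _; rewrite divr_ge0 ?sqr_ge0.
have row y : y \in Z -> \sum_(z in Z | (hdist y z <= a)%N) phi (hdist y z) <= m%:R * Cm + N / (8 * n%:R).
  move=> yZ; rewrite sum_nbr big_ord_recl /=; apply: lerD.
    have -> : nbr Z y 0 = [set y].
      apply/setP => z; rewrite !inE hdist_eq0 [y == z]eq_sym.
      by case: eqP => [->|]; rewrite ?yZ ?andbF.
    by rewrite cards1 mul1r.
  apply: (@le_trans _ _ (\sum_(v < a) N / (8 * n%:R ^+ 2))).
    apply: ler_sum => v _; rewrite /bump /= add1n.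
    apply: le_trans (Tphi v.+1 (ltn_ord v)).
    have H0 := bad y v.+1 yZ (ltn_ord v); exact: (ler_wpM2r (phi_ge0 v.+1) H0).
  rewrite sumr_const card_ord -[_ *+ _]mulr_natl.
  have an : a%:R <= n%:R :> R by rewrite ler_nat; move: ka; clear; rewrite -addnn; lia.
  apply: (@le_trans _ _ (n%:R * (N / (8 * n%:R ^+ 2)))).
    by rewrite ler_wpM2r // divr_ge0 ?mulr_ge0 ?exprn_ge0 // ltW.
  by rewrite le_eqVlt; apply/orP; left; apply/eqP; field; rewrite gt_eqF.
have {}lp : #|Z|%:R ^+ 2 <= #|Z|%:R * (n%:R * (m%:R * Cm + N / (8 * n%:R))).
  set B := m%:R * Cm + _.
  have h : \sum_(y in Z) \sum_(z in Z | (hdist y z <= a)%N) phi (hdist y z) <= \sum_(y in Z) B.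
    by apply: ler_sum => y yZ; exact: (row y yZ).
  apply: le_trans lp _; rewrite [leRHS]mulrCA; apply: ler_wpM2l => //.
  by move: h; rewrite sumr_const -[B *+ _]mulr_natl.
have Z0 : (0 : R) < #|Z|%:R by rewrite ltr0n; move: cZ X0; clear; lia.
move: lp; rewrite expr2 ler_pM2l // => lp.
have e : n%:R * (m%:R * Cm + N / (8 * n%:R)) = 8 * n%:R * m%:R * Cm / 8 + N / 8.
  by field; rewrite gt_eqF.
rewrite e in lp.
have hZ : N <= #|Z|%:R * 2 by rewrite -natrM ler_nat.
by move: lp hZ hN N0; rewrite -/N; clear; lra.
Qed.

Lemma base_finite (X : {set n.-tuple bool}) (b m k c : nat) (s0 l Cm kap : R) :
  adm x s -> (0 < n)%N -> (0 < #|X|)%N ->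
  {in X &, forall y z, ~~ odd (hdist y z)} ->
  (0 < b)%N -> (0 < m)%N -> (b + m < n)%N ->
  0 <= s0 -> s0 * s <= b%:R -> s0 <= (n - (b + m))%:R * s -> 0 <= l ->
  l + 1 <= 2 * s0 * (1 - m%:R^-1) -> (forall d, (k + c < d)%N -> n%:R - 2 * d%:R <= l) ->
  (forall j, (j <= b + m)%N -> 2 * dl * n%:R <= (n%:R - 2 * j%:R) * Num.sqrt gam) ->
  (k <= n)%N -> 1 <= n.+1%:R * ('C(n, k)%:R * dl ^+ k * (1 - dl) ^+ (n - k)) ->
  k%:R <= n.+1%:R * dl -> ((k + c).*2 <= n)%N ->
  (forall j, (j <= b + m)%N -> 'C(n, j)%:R <= Cm) -> 8 * n%:R * m%:R * Cm <= #|X|%:R ->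
  0 <= kap ->
  (forall w v e r, (w <= k + c)%N -> (v <= w)%N -> (2 * w + v <= 2 * e)%N -> (e <= n)%N -> (r <= n)%N ->
     r%:R <= w%:R / 2 + p * (n%:R - w%:R) + 1 ->
     #|X|%:R * ((rh * (1 - rh)) ^+ e * (1 - 3 * (rh * (1 - rh))) ^+ (n - e) *
       (p ^+ r * (1 - p) ^+ (n - r)) * (1 + gam) ^+ n) * n.+1%:R ^+ 2 <=
     kap * (2 ^+ n * gam ^+ v * gam ^+ w * (rh ^+ r * (1 - rh) ^+ (n - r)) ^+ 3)) ->
  #|X|%:R ^+ 2 * gam ^+ c <=
    (1 + x ^+ 2) ^+ n * (32 * n%:R ^+ 3 * n.+1%:R ^+ 4 * m%:R * (kap + 1)) * qerr p X id.
Proof.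
move=> A n0 X0 Xev b0 m0 bmn s00 hs1 hs2 l0 hl hd hj kn hmode hk ka hC hN kap0 hov.
have lpl := lp_level A n0 X0 b0 m0 bmn s00 hs1 hs2 l0 hl hd hj kn hmode hk ka hC hN.
have [gam0 gam1] := andP (gam01 A).
have [p0 p1] := andP (p01 A).
have [[x0 x1] q0 x20 x21] := admP A.
have n0R : (0 : R) < n%:R by rewrite ltr0n.
have n1R : (0 : R) < n.+1%:R by rewrite ltr0n.
have m0R : (0 : R) < m%:R by rewrite ltr0n.
set N := #|X|%:R in lpl hov *.
have N0 : 0 < N by rewrite ltr0n.
have an : (k + c <= n)%N by move: ka; clear; rewrite -addnn; lia.
have g1 : 0 < (1 + gam) ^+ n by rewrite exprn_gt0 //; lra.
have gc : 0 < gam ^+ c by rewrite exprn_gt0.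
have w2 : (0 : R) < 2 ^+ n by rewrite exprn_gt0.
pose T := threshold N m c.
have T0 v : 0 < T v by apply: threshold_gt0.
have [w [Z [/andP[w0 wa] ZX hZ cX]]] := level_selection n0 an lpl.
set X' := [set y in Z | _] in cX.
have X'0 : (0 < #|X'|)%N by move: cX X0; clear; case: #|X'| => [|//]; rewrite muln0; lia.
have [h wE] : exists h, w = h.*2.
  have /card_gt0P[y] := X'0; rewrite inE => /andP[yZ hy].
  have /card_gt0P[z] : (0 < #|nbr Z y w|)%N.
    by rewrite -(ltr_nat R); apply: le_lt_trans hy; apply: ltW.
  rewrite inE => /andP[zZ /eqP yz].
  have := Xev _ _ (fintype.subsetP ZX _ yZ) (fintype.subsetP ZX _ zZ); rewrite yz => ew.
  by exists w./2; rewrite -[LHS]odd_double_half (negbTE ew).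
have wn : (w <= n)%N by apply: leq_trans wa an.
(* Half of the disagreements plus the most likely noise on the other n - w coordinates: the typical
   radius of the error event. *)
have [k2 [k2n k2m k2le _]] := @binomial_mode R (n - w) p (p01 A).
pose r := (h + k2)%N.
have rn : (r <= n)%N by move: k2n wn; rewrite /r wE -addnn; clear; lia.
have rR : r%:R <= w%:R / 2 + p * (n%:R - w%:R) + 1.
  have e : h%:R = w%:R / 2 :> R by rewrite wE -mul2n natrM; field.
  rewrite natrD e -natrB // -addrA lerD2l; apply: le_trans k2le _.
  by rewrite -natr1 mulrDl mul1r mulrC lerD2l ltW.
set Pr := p ^+ r * (1 - p) ^+ (n - r).
have Pr0 : 0 < Pr by rewrite mulr_gt0 ?exprn_gt0 ?subr_gt0.
pose J : R := gam ^+ w / (n.+1%:R ^+ 2 * Pr).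
have nP : 0 < n.+1%:R ^+ 2 * Pr by exact: mulr_gt0 (exprn_gt0 2 n1R) Pr0.
have J0 : 0 < J by exact: divr_gt0 (exprn_gt0 w gam0) nP.
have midJ (y z : n.-tuple bool) : hdist y z = w -> J <= #|mid y z r|%:R.
  move=> yz; rewrite /J ler_pdivrMr // [leRHS]mulrC.
  by move: k2m k2n yz; rewrite wE => k2m' k2n' yz'; exact: (@mid_lower R x s n h k2 y z A yz' k2m' k2n').
pose q3 := (rh ^+ r * (1 - rh) ^+ (n - r)) ^+ 3.
have [rh0 rh1] := rh_gt0 A.
have q30 : 0 < q3 by rewrite exprn_gt0 // mulr_gt0 ?exprn_gt0.
have ov (y z z' : n.-tuple bool) : hdist y z = w -> hdist y z' = w -> (0 < hdist z z')%N ->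
    #|mid y z r :&: mid y z' r|%:R * T (minn (hdist z z') w) <= kap * #|mid y z r|%:R.
  move=> yz yz' zz'; set v := minn _ w.
  have vw : (v <= w)%N by rewrite geq_minr.
  have [e en eE] := hdist_triple y z z'.
  have we : (2 * w + v <= 2 * e)%N.
    by rewrite !mul2n eE yz yz' addnn leq_add2l geq_minl.
  have H := hov w v e r wa vw we en rn rR.
  have rh01' : 0 <= rh <= 1 by rewrite (ltW rh0) -subr_ge0 (ltW rh1).
  have C3 := @card_mid3 R n y z z' r e rh rh01' eE.
  set M := #|_ :&: _|%:R in C3 *.
  have gv : 0 < gam ^+ v by rewrite exprn_gt0.
  have Tv : T v <= N * (1 + gam) ^+ n / (2 ^+ n * gam ^+ v).
    rewrite /T /threshold ler_pdivrMr ?mulr_gt0 ?exprn_gt0 //.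
    have -> : N * (1 + gam) ^+ n / (2 ^+ n * gam ^+ v) * (8 * n%:R ^+ 2 * n.+1%:R * m%:R * 2 ^+ n * gam ^+ v)
      = N * (1 + gam) ^+ n * (8 * n%:R ^+ 2 * n.+1%:R * m%:R) by field; rewrite !gt_eqF.
    rewrite ler_wpM2l ?mulr_ge0 ?(ltW N0) ?(ltW g1) //.
    apply: (@le_trans _ _ 1); first by rewrite exprn_ile1 ?(ltW gam0) ?(ltW gam1).
    by rewrite -natrX -!natrM ler1n; move: n0 m0; clear; nia.
  have M0 : 0 <= M by [].
  have D0 : 0 < q3 * Pr * n.+1%:R ^+ 2 * (2 ^+ n * gam ^+ v).
    exact: mulr_gt0 (mulr_gt0 (mulr_gt0 q30 Pr0) (exprn_gt0 2 n1R)) (mulr_gt0 w2 gv).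
  rewrite -(ler_pM2r D0).
  apply: (@le_trans _ _ (M * (N * (1 + gam) ^+ n / (2 ^+ n * gam ^+ v)) * (q3 * Pr * n.+1%:R ^+ 2 * (2 ^+ n * gam ^+ v)))).
    by rewrite ler_wpM2r ?(ltW D0) // ler_wpM2l.
  have -> : M * (N * (1 + gam) ^+ n / (2 ^+ n * gam ^+ v)) * (q3 * Pr * n.+1%:R ^+ 2 * (2 ^+ n * gam ^+ v))
    = (M * q3) * (N * (1 + gam) ^+ n * Pr * n.+1%:R ^+ 2) by field; rewrite !gt_eqF.
  apply: le_trans (ler_wpM2r _ C3) _; first by exact: mulr_ge0 (mulr_ge0 (mulr_ge0 (ltW N0) (ltW g1)) (ltW Pr0)) (exprn_ge0 2 (ltW n1R)).
  set E := (rh * (1 - rh)) ^+ e * _ in H *.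
  have -> : E * (N * (1 + gam) ^+ n * Pr * n.+1%:R ^+ 2) = N * (E * Pr * (1 + gam) ^+ n) * n.+1%:R ^+ 2 by ring.
  apply: le_trans H _; rewrite -/q3.
  have hJ := midJ y z yz; rewrite /J ler_pdivrMr // in hJ.
  have -> : kap * (2 ^+ n * gam ^+ v * gam ^+ w * q3) = (kap * (2 ^+ n * gam ^+ v * q3)) * gam ^+ w by ring.
  apply: le_trans (ler_wpM2l _ hJ) _.
    by apply: mulr_ge0 => //; apply: mulr_ge0; [apply: mulr_ge0; exact: ltW|exact: ltW].
  by rewrite le_eqVlt; apply/orP; left; apply/eqP; ring.
have : forall y : n.-tuple bool, exists Y : {set n.-tuple bool}, y \in X' ->
   Y \subset nbr Z y w /\ T w * J <= n.+1%:R * (kap + 1) * #|\bigcup_(z in Y) mid y z r|%:R.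
  move=> y; case: (boolP (y \in X')) => [|_]; last by exists finset.set0.
  rewrite inE => /andP[yZ hy].
  have [Y sY hY] := @union_overlap R n Z y T w r kap w0 kap0 (fun v => ltW (T0 v)) hZ hy (ov y).
  by exists Y => _; split=> //; apply: hY; [exact: midJ|exact: ltW].
move=> /choice[Y hY].
have X'X : X' \subset X.
  by apply/fintype.subsetP => y; rewrite inE => /andP[yZ _]; apply: (fintype.subsetP ZX).
have YX y : y \in X' -> Y y \subset X :\ y.
  move=> yX'; have [sY _] := hY y yX'; apply/fintype.subsetP => z /(fintype.subsetP sY).
  rewrite !inE => /andP[zZ /eqP yz]; rewrite (fintype.subsetP ZX _ zZ) andbT.
  by apply: contraTneq w0 => zy; rewrite -yz zy hdistxx.
have QU := @qerr_union R p (ltW p0) (ltW p1) n X X' Y r X'X YX.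
rewrite -/Pr in QU.
have S1 : #|X'|%:R * (T w * J) <= n.+1%:R * (kap + 1) * \sum_(y in X') #|\bigcup_(z in Y y) mid y z r|%:R.
  rewrite mulr_natl -sumr_const mulr_sumr; apply: ler_sum => y yX'.
  by have [_] := hY y yX'.
have NX' : N <= 2 * n%:R * #|X'|%:R by rewrite -!natrM ler_nat.
set S := \sum_(y in X') _ in QU S1.
have B1 : N * (T w * J) <= 2 * n%:R * (n.+1%:R * (kap + 1) * S).
  apply: le_trans (ler_wpM2r _ NX') _; first by rewrite mulr_ge0 ?(ltW (T0 w)) ?(ltW J0).
  have nn : 0 <= 2 * n%:R :> R by rewrite mulr_ge0.
  by rewrite -[leLHS]mulrA; exact: (ler_wpM2l nn S1).
have B2 : N * (T w * J) * Pr <= 2 * n%:R * (n.+1%:R * (kap + 1)) * (2 * qerr p X id).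
  apply: le_trans (ler_wpM2r (ltW Pr0) B1) _.
  have -> : 2 * n%:R * (n.+1%:R * (kap + 1) * S) * Pr = 2 * n%:R * (n.+1%:R * (kap + 1)) * (Pr * S) by ring.
  rewrite ler_wpM2l // mulr_ge0 ?mulr_ge0 ?addr_ge0 ?(ltW n0R) ?(ltW n1R) //.
have gw : 0 < gam ^+ w by rewrite exprn_gt0.
have q1 : 0 < (1 + x ^+ 2) ^+ n by rewrite exprn_gt0.
have gE : (1 + gam) ^+ n * (1 + x ^+ 2) ^+ n = 2 ^+ n.
  by rewrite -exprMn (gam_x A).
(* The [gam ^+ w] of [J] cancels the one in the denominator of the threshold, and (1 + gam)(1 + x^2)
   = 2 turns the rest into (1 + x^2)^-n: [w] disappears. *)
have E : N ^+ 2 * gam ^+ c = N * (T w * J) * Pr * (8 * n%:R ^+ 2 * n.+1%:R ^+ 3 * m%:R) * (1 + x ^+ 2) ^+ n.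
  have -> : (1 + x ^+ 2) ^+ n = 2 ^+ n / (1 + gam) ^+ n by rewrite -gE mulrAC mulfV ?mul1r // gt_eqF.
  by rewrite /T /threshold /J; field; rewrite !gt_eqF.
rewrite E.
have F0 : 0 <= (8 * n%:R ^+ 2 * n.+1%:R ^+ 3 * m%:R) * (1 + x ^+ 2) ^+ n.
  by rewrite !mulr_ge0 ?exprn_ge0 ?(ltW q0).
rewrite -mulrA; apply: le_trans (ler_wpM2r F0 B2) _.
by rewrite le_eqVlt; apply/orP; left; apply/eqP; ring.
Qed.

End BaseFinite.

(** * Asymptotic choice of the parameters *)

Lemma archi_linear (R : realType) (C e : R) : 0 < e -> exists n0, forall n, (n0 <= n)%N -> C <= e * n%:R.
Proof.
move=> e0; exists (Num.trunc (`|C| / e)).+1 => n hn.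
have h0 : 0 <= `|C| / e by rewrite divr_ge0 // ltW.
have /andP[_ h] := truncn_itv h0.
apply: le_trans (ler_norm C) _; rewrite mulrC -ler_pdivrMr //.
by apply: le_trans (ltW h) _; rewrite ler_nat.
Qed.

Lemma poly_le_expR (R : realType) (C e : R) k : 0 < e ->
  exists n0, forall n, (n0 <= n)%N -> C * n.+1%:R ^+ k <= expR (e * n%:R).
Proof.
move=> e0; have f0 : (0 : R) < k.+1`!%:R by rewrite ltr0n fact_gt0.
have [n0 hn0] := @archi_linear R (`|C| * 2 ^+ k * k.+1`!%:R) (e ^+ k.+1) (exprn_gt0 _ e0).
exists n0.+1 => n hn; have n1 : (0 < n)%N by apply: leq_trans hn.
have nR : (0 : R) < n%:R by rewrite ltr0n.
have en : 0 <= e * n%:R by rewrite mulr_ge0 // ltW.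
have := @expR_ge1Dxn R (e * n%:R) k en; apply: le_trans.
apply: (@le_trans _ _ ((e * n%:R) ^+ k.+1 / k.+1`!%:R)); last by rewrite lerDr.
rewrite ler_pdivlMr // exprMn [n%:R ^+ k.+1]exprS mulrA.
have h1 : C * n.+1%:R ^+ k <= `|C| * (2 * n%:R) ^+ k.
  apply: (@le_trans _ _ (`|C| * n.+1%:R ^+ k)).
    by rewrite ler_wpM2r ?exprn_ge0 // ler_norm.
  have e2n : n.+1%:R <= 2 * n%:R :> R by rewrite -natrM ler_nat; move: n1; clear; lia.
  by apply: ler_wpM2l => //; apply: lerXn2r; rewrite ?nnegrE ?mulr_ge0.
apply: le_trans (ler_wpM2r (ltW f0) h1) _.
have -> : `|C| * (2 * n%:R) ^+ k * k.+1`!%:R = `|C| * 2 ^+ k * k.+1`!%:R * n%:R ^+ k.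
  by rewrite exprMn; ring.
by rewrite ler_wpM2r ?exprn_ge0 ?(ltW nR) // hn0 // ltnW.
Qed.

(** A single term of the expansion of (1 + s^2)^n. At B = n s^2 / (1 + s^2) the exponent is
    [n * htau s]. *)
Lemma binomial_le_expR (R : realType) (s : R) n j (B : R) : 0 < s -> s <= 1 -> (j <= n)%N -> j%:R <= B ->
  'C(n, j)%:R <= expR (n%:R * ln (1 + s ^+ 2) - 2 * B * ln s).
Proof.
move=> s0 s1 jn jB; have q0 : 0 < 1 + s ^+ 2 by rewrite ltr_wpDr ?sqr_ge0.
have s2 : 0 < s ^+ 2 by rewrite exprn_gt0.
have h : 'C(n, j)%:R * s ^+ 2 ^+ j <= (1 + s ^+ 2) ^+ n.
  rewrite exprDn (bigD1 (inord j)) //= inordK ?ltnS // expr1n mul1r -[(_ ^+ j) *+ _]mulr_natl.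
  by rewrite lerDl sumr_ge0 // => i _; rewrite mulrn_wge0 // mulr_ge0 ?exprn_ge0 // ltW.
rewrite -(ler_pM2r (exprn_gt0 j s2)); apply: le_trans h _.
rewrite (exprn_expR n q0) (exprn_expR j s2) -expRD ler_expR.
have -> : ln (s ^+ 2) = 2 * ln s by rewrite lnXn // mulr2n; ring.
have ls : ln s <= 0 by apply: ln_le0.
have : 0 <= (B - j%:R) * (- ln s) by rewrite mulr_ge0 ?subr_ge0 ?oppr_ge0.
by lra.
Qed.

Section BaseAsymptotic.
Variables (R : realType) (x s : R).

Local Notation gam := (gamx x).
Local Notation dl := (dlx x).
Local Notation p := (px x).
Local Notation rh := (rhx x).

(** The window lies at least [kp * n] below tau n, where tau = s^2 / (1 + s^2). Its binomials are
    then smaller than exp(n htau s) by a factor exp(- n kp Lam), half of whose exponent is left to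
    the code as [nu]. The eigenvalue drops by O(kp n) only, which is paid for by admitting distances
    up to [c] = O(kp n) above the mode. *)
Lemma base_even (eps : R) : adm x s -> 0 < eps ->
  exists2 nu : R, 0 < nu <= eps & exists n0, forall n, (n0 <= n)%N -> forall X : {set n.-tuple bool},
    {in X &, forall y z, ~~ odd (hdist y z)} ->
    expR (n%:R * (htau s - nu)) <= #|X|%:R -> #|X|%:R <= expR (n%:R * htau s) ->
    #|X|%:R * expR (- (n%:R * (ln (1 + x ^+ 2) - htau s + eps))) <= qerr p X id.
Proof.
move=> A eps0; have [s0 sle x0 x1 xs] := A; have [_ q0 x20 x21] := admP A.
have [gam0 gam1] := andP (gam01 A).
have qs : 0 < 1 + s ^+ 2 by rewrite ltr_wpDr ?sqr_ge0.
have s1 : s < 1 by lra.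
have s2 : 0 < s ^+ 2 by rewrite exprn_gt0.
pose H := htau s; pose tau := s ^+ 2 / (1 + s ^+ 2); pose Lam := - 2 * ln s; pose lg := - ln gam.
pose sl := slope x; pose A0 := ln (1 + x ^+ 2).
have tau0 : 0 < tau by rewrite divr_gt0.
have sl0 : 0 <= sl by apply: slope_ge0 A.
have Lam0 : 0 < Lam by have := @ln_lt0 R s; rewrite s0 s1 => /(_ isT); rewrite /Lam; lra.
have lg0 : 0 < lg by have := @ln_lt0 R gam; rewrite gam0 gam1 => /(_ isT); rewrite /lg; lra.
have HE : H = ln (1 + s ^+ 2) + tau * Lam by rewrite /H /htau /tau /Lam; field; rewrite gt_eqF.
have etaE : x ^+ 2 = 2 * (tau / s) by rewrite xs /tau; field; rewrite !gt_eqF.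
have dlE : dl = (1 - x ^+ 2) / 2 by [].
pose si := s^-1.
have is0 : 1 <= si by rewrite /si -invr1 lef_pV2 ?posrE // ltW.
have issE : si * s = 1 by rewrite mulVf // gt_eqF.
pose big := 1 + Lam + 6 * lg * si + 8 * sl * si.
have big0 : 0 < big.
  have := mulr_ge0 (ltW lg0) (le_trans ler01 is0); have := mulr_ge0 sl0 (le_trans ler01 is0).
  by rewrite /big; lra.
have [kp [kp0 kp1 kp2 kp3]] : exists kp, [/\ 0 < kp, 8 * kp <= tau, 13 * kp * si <= x ^+ 2 & kp * big <= eps / 4].
  exists (Num.min (Num.min (tau / 8) (x ^+ 2 / (13 * si))) (eps / 4 / big)).
  have is00 : 0 < 13 * si by lra.
  split.
  - by rewrite !lt_min !divr_gt0 // divr_gt0.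
  - rewrite mulrC -ler_pdivlMr //; by rewrite !ge_min lexx.
  - rewrite mulrAC mulrC -ler_pdivlMr //; by rewrite !ge_min lexx orbT.
  - by rewrite -ler_pdivlMr // ge_min lexx orbT.
have kpL : kp * Lam <= eps / 4.
  apply: le_trans kp3; rewrite ler_wpM2l ?(ltW kp0) // /big.
  have := mulr_ge0 (ltW lg0) (le_trans ler01 is0); have := mulr_ge0 sl0 (le_trans ler01 is0); lra.
have kpL0 : 0 < kp * Lam by rewrite mulr_gt0.
exists (kp * Lam / 2); first by rewrite divr_gt0 //=; lra.
have ikp : 0 <= kp^-1 by rewrite invr_ge0 ltW.
pose m := (Num.trunc kp^-1).+1.
have mR : m%:R^-1 <= kp.
  have /andP[_ h] := truncn_itv ikp.
  by rewrite -[leRHS]invrK lef_pV2 ?posrE ?invr_gt0 ?ltr0n // ltW.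
have m0 : (0 < m)%N by [].
have m0R : (0 : R) < m%:R by rewrite ltr0n.
pose C0 := ln (1 + x) - ln (1 - x).
have [n1 hn1] := @archi_linear R (m%:R + 1) kp kp0.
have kL2 : 0 < kp * Lam / 2 by rewrite divr_gt0.
have [n2 hn2] := @poly_le_expR R (8 * m%:R) (kp * Lam / 2) 1 kL2.
have eps4 : 0 < eps / 4 by rewrite divr_gt0.
have [n3 hn3] := @poly_le_expR R (64 * m%:R * expR C0) (eps / 4) 9 eps4.
exists (maxn n1 (maxn n2 n3)).+1 => n hn X Xev hX1 hX2.
have [hna hnb hnc n0] : [/\ (n1 <= n)%N, (n2 <= n)%N, (n3 <= n)%N & (0 < n)%N].
  by move: hn; clear; split; lia.
have {hn1}hn1 := hn1 n hna; have {hn2}hn2 := hn2 n hnb; have {hn3}hn3 := hn3 n hnc.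
have nR : (0 : R) < n%:R by rewrite ltr0n.
set kn := kp * n%:R in hn1.
have kn1 : 1 <= kn by move: hn1 m0R; clear; lra.
have kni : kn <= kn * si by rewrite ler_peMr //; move: kn1; clear; lra.
have X0 : (0 < #|X|)%N by rewrite -(ltr_nat R); apply: lt_le_trans hX1; apply: expR_gt0.
have tn : 0 <= (tau - 2 * kp) * n%:R by rewrite mulr_ge0 ?(ltW nR) //; move: kp1 kp0; clear; lra.
have [b [b1 b2]] : exists b : nat, b%:R <= (tau - 2 * kp) * n%:R /\ (tau - 2 * kp) * n%:R < b%:R + 1.
  have /andP[t1 t2] := truncn_itv tn.
  by exists (Num.trunc ((tau - 2 * kp) * n%:R)); rewrite natr1.
have tauk : 8 * kn <= tau * n%:R by rewrite /kn mulrA ler_wpM2r // ltW.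
have b3 : (tau - 3 * kp) * n%:R <= b%:R by move: b2 kn1; rewrite /kn; clear; lra.
have b0 : (0 < b)%N.
  rewrite -(ltr_nat R); by apply: lt_le_trans b3; move: tauk kn1; rewrite /kn; clear; lra.
have bm : (b + m)%:R <= (tau - kp) * n%:R.
  by rewrite natrD; move: b1 hn1; rewrite /kn; clear; lra.
have tau1 : tau < 1 by rewrite /tau ltr_pdivrMr // mul1r ltrDr.
have bmn : (b + m < n)%N.
  rewrite -(ltr_nat R); apply: le_lt_trans bm _; have : tau * n%:R < 1 * n%:R by rewrite ltr_pM2r.
  by move: kn1; rewrite /kn; clear; lra.
(* A lower bound for j / s on the window; (n - j) s is at least (1 - tau) n s = tau n / s there. *)
pose s00 := (tau - 3 * kp) * n%:R * si.
have tk3 : 0 <= (tau - 3 * kp) * n%:R by move: tauk kn1; rewrite /kn; clear; lra.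
have is_ge0 : 0 <= si by apply: le_trans is0.
have s00_ge0 : 0 <= s00 by rewrite mulr_ge0.
have hs1 : s00 * s <= b%:R by rewrite /s00 -mulrA issE mulr1.
have taus : tau * si = (1 - tau) * s by rewrite /tau /si; field; rewrite !gt_eqF.
have hs2 : s00 <= (n - (b + m))%:R * s.
  have e1 : (1 - tau) * n%:R <= (n - (b + m))%:R.
    by rewrite natrB ?(ltnW bmn) //; move: bm kn1; rewrite /kn; clear; lra.
  apply: (@le_trans _ _ ((1 - tau) * n%:R * s)); last by rewrite ler_wpM2r // ltW.
  rewrite mulrAC -taus /s00 mulrAC ler_wpM2r ?(ltW nR) // ler_wpM2r //; move: kp0; clear; lra.
pose l := 2 * s00 * (1 - m%:R^-1) - 1.
have lE : x ^+ 2 * n%:R - 9 * kn * si <= l.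
  have e1 : 2 * s00 * (1 - kp) <= 2 * s00 * (1 - m%:R^-1).
    by apply: ler_wpM2l; [exact: mulr_ge0 (ler0n R 2) s00_ge0|move: mR; clear; lra].
  have e2 : x ^+ 2 * n%:R - 8 * kn * si <= 2 * s00 * (1 - kp).
    have -> : x ^+ 2 * n%:R - 8 * kn * si = 2 * (n%:R * si) * (tau - 4 * kp).
      by rewrite etaE /kn -/si; ring.
    have -> : 2 * s00 * (1 - kp) = 2 * (n%:R * si) * ((tau - 3 * kp) * (1 - kp)) by rewrite /s00; ring.
    apply: ler_wpM2l; first exact: mulr_ge0 (ler0n R 2) (mulr_ge0 (ltW nR) is_ge0).
    have : kp * tau <= kp * 1 by rewrite ler_wpM2l // ltW.
    by have := mulr_ge0 (ltW kp0) (ltW kp0); clear; lra.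
  by rewrite /l; move: e1 e2 kni kn1; clear; lra.
have kni13 : 13 * (kn * si) <= x ^+ 2 * n%:R.
  by have := ler_wpM2r (ltW nR) kp2; rewrite /kn; clear; lra.
have l0 : 0 <= l by apply: le_trans lE; move: kni13 kni kn1; clear; lra.
have hl : l + 1 <= 2 * s00 * (1 - m%:R^-1) by rewrite /l subrK.
have dl01 : 0 < dl < 1 by rewrite dlE; move: x20 x21; clear => h1 h2; apply/andP; split; lra.
have [k [kn_le hmode hk1 hk2]] := @binomial_mode R n dl dl01.
have cge0 : 0 <= 5 * (kn * si) by move: kni kn1; clear; lra.
(* [l] falls short of x^2 n by at most 9 kn si; distances exceeding dl n by more than half of that
   satisfy n - 2d <= l. *)
have [c [c1 c2]] : exists c : nat, 5 * (kn * si) <= c%:R /\ c%:R <= 5 * (kn * si) + 1.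
  exists (Num.trunc (5 * (kn * si))).+1; have /andP[t1 t2] := truncn_itv cge0.
  by split; [exact: ltW|rewrite -natr1 lerD2r].
have ndl : n.+1%:R * dl <= dl * n%:R + 1 by rewrite -natr1; move: dl01; clear; lra.
have ndl2 : dl * n%:R <= n.+1%:R * dl by rewrite -natr1; move: dl01; clear; lra.
have hd d : (k + c < d)%N -> n%:R - 2 * d%:R <= l.
  move=> hd; have : (k + c).+1%:R <= d%:R :> R by rewrite ler_nat.
  rewrite -addSn natrD => hd'; apply: le_trans lE.
  have e : dl * n%:R = (n%:R - x ^+ 2 * n%:R) / 2 by rewrite dlE; field.
  by move: hd' hk2 ndl2 c1 e kni kn1; clear; lra.
have hj j : (j <= b + m)%N -> 2 * dl * n%:R <= (n%:R - 2 * j%:R) * Num.sqrt gam.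
  move=> jb; rewrite (sqrt_gam A).
  have jR : j%:R <= tau * n%:R.
    apply: (@le_trans _ _ (b + m)%:R); first by rewrite ler_nat.
    by apply: le_trans bm _; rewrite ler_wpM2r ?(ltW nR) //; move: kp0; clear; lra.
  have s1' : 0 < 1 + s by apply: addr_gt0.
  have sg : 0 <= (1 - s) / (1 + s) by rewrite divr_ge0 ?subr_ge0 ?(ltW s1) ?(ltW s1').
  have -> : 2 * dl * n%:R = ((1 - 2 * tau) * n%:R) * ((1 - s) / (1 + s)).
    by rewrite dlE xs /tau; move: s1' qs; clear => h1 h2; field; rewrite !gt_eqF.
  by rewrite ler_wpM2r //; move: jR; clear; lra.
have ka : ((k + c).*2 <= n)%N.
  rewrite -(ler_nat R) -mul2n natrM natrD.
  have e : dl * n%:R = (n%:R - x ^+ 2 * n%:R) / 2 by rewrite dlE; field.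
  have ndl' : n.+1%:R * dl <= dl * n%:R + 1 / 2 by rewrite -natr1 dlE; move: x20; clear; lra.
  by move: hk1 ndl' c2 e kni13 kni kn1; clear; lra.
pose Cm := expR (n%:R * (H - kp * Lam)).
have hC j : (j <= b + m)%N -> 'C(n, j)%:R <= Cm.
  move=> jb; have jn : (j <= n)%N by apply: leq_trans jb (ltnW bmn).
  have jR : j%:R <= (tau - kp) * n%:R by apply: le_trans bm; rewrite ler_nat.
  apply: le_trans (binomial_le_expR s0 (ltW s1) jn jR) _; rewrite ler_expR HE /Lam.
  by rewrite le_eqVlt; apply/orP; left; apply/eqP; ring.
have hN : 8 * n%:R * m%:R * Cm <= #|X|%:R.
  apply: le_trans hX1; have -> : n%:R * (htau s - kp * Lam / 2) = kp * Lam / 2 * n%:R + n%:R * (H - kp * Lam).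
    by rewrite /H; field.
  rewrite expRD ler_wpM2r ?expR_ge0 //; apply: le_trans hn2; rewrite expr1 mulrAC ler_wpM2l ?mulr_ge0 //.
  by rewrite ler_nat.
pose D := 8 * (kn * si).
pose kap := expR (sl * D + C0) * n.+1%:R ^+ 2.
have kap0 : 0 <= kap by rewrite mulr_ge0 ?expR_ge0 ?exprn_ge0.
have hov w v e r : (w <= k + c)%N -> (v <= w)%N -> (2 * w + v <= 2 * e)%N -> (e <= n)%N -> (r <= n)%N ->
     r%:R <= w%:R / 2 + p * (n%:R - w%:R) + 1 ->
     #|X|%:R * ((rh * (1 - rh)) ^+ e * (1 - 3 * (rh * (1 - rh))) ^+ (n - e) *
       (p ^+ r * (1 - p) ^+ (n - r)) * (1 + gam) ^+ n) * n.+1%:R ^+ 2 <=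
     kap * (2 ^+ n * gam ^+ v * gam ^+ w * (rh ^+ r * (1 - rh) ^+ (n - r)) ^+ 3).
  move=> hw hv he en rn hr.
  have wD : w%:R <= dl * n%:R + D.
    have : w%:R <= (k + c)%:R :> R by rewrite ler_nat.
    by rewrite natrD /D; move: hk1 ndl c2 kni kn1; clear; lra.
  have OE := @overlap_exponent R x s n w v e r D A hv he en rn hr wD.
  set E := _ * (1 + gam) ^+ n in OE *; set F := (2 ^+ n * _ * _ * _) in OE *.
  have F0 : 0 <= F.
    have [rh0 rh1] := rh_gt0 A.
    have f1 : 0 <= (rh ^+ r * (1 - rh) ^+ (n - r)) ^+ 3.
      by rewrite exprn_ge0 // (mulr_ge0 (exprn_ge0 _ (ltW rh0)) (exprn_ge0 _ (ltW rh1))).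
    have f2 k' : 0 <= gam ^+ k' by rewrite exprn_ge0 // ltW.
    exact: mulr_ge0 (mulr_ge0 (mulr_ge0 (exprn_ge0 n (ler0n R 2)) (f2 v)) (f2 w)) f1.
  rewrite /kap [leRHS]mulrAC; apply: ler_wpM2r; first by rewrite exprn_ge0.
  have E0 : #|X|%:R * E <= #|X|%:R * (expR (slope x * D + (ln (1 + x) - ln (1 - x)) - n%:R * htau s) * F).
    by rewrite ler_wpM2l.
  apply: le_trans E0 _; rewrite mulrA ler_wpM2r //.
  apply: le_trans (ler_wpM2r (expR_ge0 _) hX2) _.
  by rewrite -expRD ler_expR /sl /C0; clear; lra.
have BF := @base_finite R x s n X b m k c s00 l Cm kap A n0 X0 Xev b0 m0 bmn s00_ge0 hs1 hs2 l0 hl hd hj kn_le hmode hk1 ka hC hN kap0 hov.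
set N := #|X|%:R in BF hX1 hX2 *; set Q := qerr p X id in BF *.
have Q0 : 0 <= Q by apply: qerr_ge0; have /andP[h1 h2] := p01 A; rewrite ltW.
have N0 : 0 < N by rewrite ltr0n.
have L1 : N * expR (n%:R * (H - kp * Lam / 2) - (5 * (kn * si) + 1) * lg) <= N ^+ 2 * gam ^+ c.
  have -> : N ^+ 2 * gam ^+ c = N * (N * gam ^+ c) by ring.
  rewrite (ler_wpM2l (ltW N0)) // expRD; apply: ler_pM; rewrite ?expR_ge0 //.
  rewrite (exprn_expR c gam0) ler_expR -/lg (_ : ln gam = - lg); last by rewrite /lg opprK.
  by rewrite [leRHS]mulrN lerN2; apply: ler_wpM2r c2; exact: ltW.
have kap1 : 1 <= kap.
  have C00 : 0 <= C0 by rewrite /C0 subr_ge0 ler_ln ?posrE; move: x0 x1; clear; lra.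
  rewrite -[leLHS]mulr1; apply: ler_pM => //.
    by rewrite -expR0 ler_expR addr_ge0 // mulr_ge0 // /D; move: kni kn1; clear; lra.
  by rewrite exprn_ege1 // ler1n.
have L2 : 32 * n%:R ^+ 3 * n.+1%:R ^+ 4 * m%:R * (kap + 1) <= expR (eps / 4 * n%:R + sl * D).
  rewrite expRD; apply: (@le_trans _ _ (64 * m%:R * expR C0 * n.+1%:R ^+ 9 * expR (sl * D))); last first.
    by rewrite ler_wpM2r ?expR_ge0.
  apply: (@le_trans _ _ (32 * n.+1%:R ^+ 3 * n.+1%:R ^+ 4 * m%:R * (kap + kap))).
    have k3 : 0 <= kap + 1 by move: kap1; clear; lra.
    have n30 : 0 <= 32 * n%:R ^+ 3 * n.+1%:R ^+ 4 * m%:R :> R.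
      by rewrite -!natrX -!natrM.
    apply: ler_pM n30 k3 _ _; last by rewrite lerD2l.
    by rewrite -!natrX -!natrM ler_nat leq_mul2r leq_mul2r leq_mul2l leq_exp2r ?leqnSn ?orbT.
  by rewrite le_eqVlt; apply/orP; left; apply/eqP; rewrite /kap expRD; ring.
have L3 : (1 + x ^+ 2) ^+ n = expR (n%:R * A0) by rewrite exprn_expR.
have L4 : N * expR (n%:R * (H - kp * Lam / 2) - (5 * (kn * si) + 1) * lg) <=
   expR (n%:R * A0 + (eps / 4 * n%:R + sl * D)) * Q.
  apply: le_trans L1 _; apply: le_trans BF _; rewrite ler_wpM2r // L3 [expR (_ + _ : R)]expRD.
  by rewrite ler_wpM2l ?expR_ge0.
have E2 : 0 < expR (n%:R * A0 + (eps / 4 * n%:R + sl * D)) by apply: expR_gt0.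
rewrite -(ler_pM2l E2); apply: le_trans L4.
rewrite mulrCA ler_wpM2l ?(ltW N0) // -expRD ler_expR.
have K3 : kn * (Lam + 6 * lg * si + 8 * sl * si) <= eps / 4 * n%:R.
  have := ler_wpM2r (ltW nR) kp3; rewrite /big /kn.
  have := mulr_gt0 kp0 nR; clear; lra.
have lgk : lg <= kn * si * lg.
  by rewrite -[leLHS]mul1r ler_wpM2r ?(ltW lg0) //; move: kni kn1; clear; lra.
have kL : kn * Lam = n%:R * (kp * Lam) by rewrite /kn; ring.
have e0n : 0 <= eps * n%:R by rewrite mulr_ge0 ?ltW.
have kl0 : 0 <= kn * Lam by rewrite mulr_ge0 ?(ltW Lam0) //; move: kn1; clear; lra.
rewrite /D -/H -/A0; move: K3 lgk kL e0n kl0; clear.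
move: (kn) => a; move: (kp * Lam) => b; move: H A0 si => h a0 i; lra.
Qed.

(** One of the two weight parities contains at least half of [X], and all distances inside it are
    even; the factor 2 is absorbed by halving [nu] and [eps]. *)
Lemma base_code (eps : R) : adm x s -> 0 < eps ->
  exists2 nu : R, 0 < nu <= eps & exists n0, forall n, (n0 <= n)%N -> forall X : {set n.-tuple bool},
    expR (n%:R * (htau s - nu)) <= #|X|%:R -> #|X|%:R <= expR (n%:R * htau s) ->
    #|X|%:R * expR (- (n%:R * (ln (1 + x ^+ 2) - htau s + eps))) <= qerr p X id.
Proof.
move=> A eps0; have e2 : 0 < eps / 2 by rewrite divr_gt0.
have [nu /andP[nu0 nu1] [n1 hn1]] := base_even A e2.
have [p0 p1] := andP (p01 A).
exists (nu / 2); first by rewrite divr_gt0 //=; lra.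
have nu2 : 0 < nu / 2 by rewrite divr_gt0.
have [n2 hn2] := @poly_le_expR R 2 (nu / 2) 0 nu2.
have [n3 hn3] := @poly_le_expR R 2 (eps / 2) 0 e2.
exists (maxn n1 (maxn n2 n3)) => n hn X hX1 hX2.
have [hna hnb hnc] : [/\ (n1 <= n)%N, (n2 <= n)%N & (n3 <= n)%N].
  by move: hn; clear; split; lia.
pose Xb b := [set y in X | odd (wt y) == b].
have Xbs b : Xb b \subset X by apply/fintype.subsetP => y; rewrite inE => /andP[].
have [b hb] : exists b, (#|X| <= 2 * #|Xb b|)%N.
  have e : (#|X| = #|Xb true| + #|Xb false|)%N.
    rewrite -cardsUI.
    have -> : Xb true :|: Xb false = X by apply/setP => y; rewrite !inE; case: (y \in X); case: odd.
    have -> : Xb true :&: Xb false = finset.set0 by apply/setP => y; rewrite !inE; case: (y \in X); case: odd.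
    by rewrite cards0 addn0.
  case: (leqP #|Xb false| #|Xb true|) => h; [exists true|exists false]; move: e h; clear.
    by move: #|X| #|Xb true| #|Xb false|; lia.
  by move: #|X| #|Xb true| #|Xb false|; lia.
have hbR : #|X|%:R <= 2 * #|Xb b|%:R :> R by rewrite -natrM ler_nat.
have ev : {in Xb b &, forall y z, ~~ odd (hdist y z)}.
  by move=> y z; rewrite !inE odd_hdist => /andP[_ /eqP ->] /andP[_ /eqP ->]; rewrite addbb.
have := hn1 n hna (Xb b) ev.
have h2 := hn2 n hnb; rewrite expr0 mulr1 in h2.
have h3 := hn3 n hnc; rewrite expr0 mulr1 in h3.
have c1 : expR (n%:R * (htau s - nu)) <= #|Xb b|%:R.
  have /(le_trans hX1) : #|X|%:R <= expR (nu / 2 * n%:R) * #|Xb b|%:R.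
    by apply: le_trans hbR _; rewrite ler_wpM2r.
  have -> : n%:R * (htau s - nu / 2) = nu / 2 * n%:R + n%:R * (htau s - nu) by field.
  by rewrite expRD ler_pM2l ?expR_gt0.
have c2 : #|Xb b|%:R <= expR (n%:R * htau s).
  by apply: le_trans hX2; rewrite ler_nat subset_leq_card.
move=> /(_ c1 c2) Q; apply: le_trans (qerr_sub (ltW p0) (ltW p1) id (Xbs b)).
apply: le_trans Q; set Y := #|Xb b|%:R in hbR *.
have -> : - (n%:R * (ln (1 + x ^+ 2) - htau s + eps)) =
   - (eps / 2 * n%:R) - (n%:R * (ln (1 + x ^+ 2) - htau s + eps / 2)) by field.
rewrite expRD mulrA ler_wpM2r ?expR_ge0 // expRN ler_pdivrMr ?expR_gt0 //.
by apply: le_trans hbR _; rewrite mulrC ler_wpM2l.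
Qed.

End BaseAsymptotic.

(** * The straight line argument *)

Section Families.
Variables (R : realType) (p : R).
Hypotheses (p0 : 0 <= p) (p1 : p <= 1).

Lemma qerr_image n (I : finType) (S : {set I}) (c : I -> n.-tuple bool) :
  qerr p (c @: S) id <= qerr p S c.
Proof.
apply: ler_sum => z _; apply: lerB.
  rewrite (partition_big_imset c) /=; apply: ler_sum => y /imsetP[i iS ->].
  rewrite (bigD1 i) ?iS ?eqxx //= lerDl sumr_ge0 // => j _; exact: W_ge0.
apply: bigmax_le => [|i iS]; first by apply: bigmax_ge_id.
by apply: (bigmax_sup (c i)) => //; apply: imset_f.
Qed.

(** The maximum over the family is at most the sum over its distinct words, so each repetition adds
    a full unit to the error. *)
Lemma qerr_repetition n (I : finType) (S : {set I}) (c : I -> n.-tuple bool) :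
  #|S|%:R - #|c @: S|%:R <= qerr p S c.
Proof.
rewrite /qerr sumrB exchange_big /=.
rewrite (eq_bigr (fun=> 1)) => [|i _]; last exact: sum_W.
rewrite sumr_const lerB //.
apply: (@le_trans _ _ (\sum_(z : n.-tuple bool) \sum_(y in c @: S) W p z y)).
  apply: ler_sum => z _; apply: bigmax_le => [|i iS]; first by apply: sumr_ge0 => y _; apply: W_ge0.
  rewrite (bigD1 (c i)) ?imset_f //= lerDl sumr_ge0 // => y _; exact: W_ge0.
rewrite exchange_big /= (eq_bigr (fun=> 1)) => [|i _]; last exact: sum_W.
by rewrite sumr_const.
Qed.

Lemma subset_of_card (I : finType) (S : {set I}) k : (k <= #|S|)%N ->
  exists2 B : {set I}, B \subset S & #|B| = k.
Proof.
move/card_geqP=> [t [tu tk tS]]; exists [set i in t].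
  by apply/fintype.subsetP => i; rewrite inE; apply: tS.
by rewrite cardsE -tk; apply/card_uniqP.
Qed.

Lemma qerr_blocks n (I : finType) (c : I -> n.-tuple bool) (L : nat) (q : R) :
  (forall B : {set I}, #|B| = L -> q <= qerr p B c) ->
  forall k (S : {set I}), (k * L <= #|S|)%N -> k%:R * q <= qerr p S c.
Proof.
move=> hB; elim=> [|k IH] S hS; first by rewrite mul0r qerr_ge0.
have [B BS cB] : exists2 B : {set I}, B \subset S & #|B| = L.
  by apply: subset_of_card; apply: leq_trans hS; rewrite mulSn leq_addr.
have dis : [disjoint B & S :\: B].
  by rewrite finset.disjoints_subset; apply/fintype.subsetP => i; rewrite !inE => ->.
have := qerrU p0 p1 c dis.
have -> : B :|: S :\: B = S by rewrite -{2}(finset.setID S B) (finset.setIidPr BS).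
apply: le_trans; rewrite -natr1 mulrDl mul1r addrC lerD ?hB // IH //.
by rewrite cardsD (finset.setIidPr BS) cB; move: hS; rewrite mulSn; clear; lia.
Qed.

(** The converse covers only sizes near exp(n htau s), so a larger family is cut into blocks of size
    [L]; by superadditivity only the last, incomplete block is lost. *)
Lemma qerr_family n (I : finType) (c : I -> n.-tuple bool) (L : nat) (q : R) (S : {set I}) :
  (0 < L)%N -> 0 <= q ->
  (forall B : {set I}, #|B| = L -> L%:R * q <= qerr p B c) ->
  (#|S|%:R - L%:R) * q <= qerr p S c.
Proof.
move=> L0 q0 hB; apply: le_trans (qerr_blocks hB (leq_divM #|S| L)).
rewrite mulrA ler_wpM2r // lerBlDr -natrM -natrD ler_nat.
by have := ltn_ceil #|S| L0; rewrite mulSn; clear; lia.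
Qed.

Lemma sum_sub_max_mono (I : finType) (S1 S2 : {set I}) (f : I -> R) : (forall i, 0 <= f i) ->
  S1 \subset S2 ->
  \sum_(i in S1) f i - \big[Num.max/0]_(i in S1) f i <=
  \sum_(i in S2) f i - \big[Num.max/0]_(i in S2) f i.
Proof.
move=> f0 s12; rewrite [\sum_(i in S2) _](bigID (mem S1)) /=.
have -> : \sum_(i in S2 | i \in S1) f i = \sum_(i in S1) f i.
  by apply: eq_bigl => i; rewrite andbC; case: (boolP (i \in S1)) => //= /(fintype.subsetP s12).
rewrite -addrA lerD2l lerNl opprB lerBlDr.
have T0 : 0 <= \sum_(i in S2 | i \notin S1) f i by apply: sumr_ge0.
have M0 : 0 <= \big[Num.max/0]_(i in S1) f i by apply: bigmax_ge_id.
apply: bigmax_le => [|i iS]; first by rewrite addr_ge0.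
case: (boolP (i \in S1)) => iS1.
  by apply: ler_wpDr => //; apply: (bigmax_sup i).
apply: ler_wpDl => //; rewrite (bigD1 i) ?iS ?iS1 //= lerDl.
by apply: sumr_ge0.
Qed.

End Families.

Section Concatenation.
Variables n1 n2 : nat.
Implicit Types y z : (n1 + n2).-tuple bool.

Definition pre y : n1.-tuple bool := [tuple tnth y (lshift n2 i) | i < n1].
Definition suf y : n2.-tuple bool := [tuple tnth y (rshift n1 i) | i < n2].

Lemma pre_cat (u : n1.-tuple bool) (v : n2.-tuple bool) : pre (cat_tuple u v) = u.
Proof. by apply: eq_from_tnth => i; rewrite tnth_mktuple tnth_lshift. Qed.

Lemma suf_cat (u : n1.-tuple bool) (v : n2.-tuple bool) : suf (cat_tuple u v) = v.
Proof. by apply: eq_from_tnth => i; rewrite tnth_mktuple tnth_rshift. Qed.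

Lemma cat_pre_suf y : cat_tuple (pre y) (suf y) = y.
Proof.
apply: eq_from_tnth => i; case: (split_ordP i) => j ->.
  by rewrite tnth_lshift tnth_mktuple.
by rewrite tnth_rshift tnth_mktuple.
Qed.

Lemma hdist_split y z : hdist y z = (hdist (pre y) (pre z) + hdist (suf y) (suf z))%N.
Proof.
by rewrite /hdist big_split_ord /=; congr (_ + _)%N; apply: eq_bigr => i _; rewrite !tnth_mktuple.
Qed.

Lemma sum_cat (S : nmodType) (F : (n1 + n2).-tuple bool -> S) :
  \sum_z F z = \sum_(u : n1.-tuple bool) \sum_(v : n2.-tuple bool) F (cat_tuple u v).
Proof.
rewrite pair_big /=.
rewrite (reindex (fun uv : n1.-tuple bool * n2.-tuple bool => cat_tuple uv.1 uv.2)) //=.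
exists (fun y => (pre y, suf y)) => [[u v] _|y _] /=; first by rewrite pre_cat suf_cat.
exact: cat_pre_suf.
Qed.

Variables (R : realType) (p : R).

Lemma W_split y z : W p z y = W p (pre z) (pre y) * W p (suf z) (suf y).
Proof.
rewrite /W hdist_split; have := hdist_le (pre y) (pre z); have := hdist_le (suf y) (suf z).
move: (hdist _ _) (hdist _ _) => a b hb ha.
have -> : (n1 + n2 - (a + b) = (n1 - a) + (n2 - b))%N by move: ha hb; clear; lia.
by rewrite !exprD; ring.
Qed.

Hypotheses (p0 : 0 <= p) (p1 : p <= 1).

(** For each received prefix [u] keep the codewords whose prefix is at distance [r] from it: they
    are equally likely on the first block, and what remains is the decoding of their suffixes. *)
Lemma qerr_prefix (C : {set (n1 + n2).-tuple bool}) (r : nat) :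
  \sum_(u : n1.-tuple bool) p ^+ r * (1 - p) ^+ (n1 - r) *
     qerr p [set y in C | hdist (pre y) u == r] suf <= qerr p C id.
Proof.
rewrite /qerr sum_cat; apply: ler_sum => u _; rewrite mulr_sumr; apply: ler_sum => v _.
set S := [set y in C | _]; set Pr := p ^+ r * _.
have Pr0 : 0 <= Pr by rewrite mulr_ge0 ?exprn_ge0 ?subr_ge0.
have SC : S \subset C by apply/fintype.subsetP => y; rewrite inE => /andP[].
have mono := @sum_sub_max_mono R _ S C (fun y => W p (cat_tuple u v) y) (fun y => W_ge0 p0 p1 _ y) SC.
apply: le_trans mono.
have e y : y \in S -> W p (cat_tuple u v) y = Pr * W p v (suf y).
  by rewrite inE => /andP[_ /eqP h]; rewrite W_split pre_cat suf_cat /W h.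
rewrite mulrBr mulr_sumr -(eq_bigr _ e) lerD2l lerN2.
rewrite (eq_bigr _ e); apply: bigmax_le => [|y yS]; first by rewrite mulr_ge0 // bigmax_ge_id.
by apply: ler_wpM2l => //; apply: (bigmax_sup y).
Qed.

End Concatenation.

Lemma card_sphere (R : realType) n (y : n.-tuple bool) r : #|[pred z : n.-tuple bool | hdist y z == r]| = 'C(n, r).
Proof.
pose f (z : n.-tuple bool) : n.-tuple bool := [tuple tnth y i (+) tnth z i | i < n].
have fK : involutive f.
  by move=> z; apply: eq_from_tnth => i; rewrite !tnth_mktuple; case: (tnth y i); case: (tnth z i).
rewrite -(card_wt n R r) -!sum1_card [RHS](reindex f); last by exists f => z _; apply: fK.
apply: eq_bigl => z; rewrite !inE; congr (_ == r).
by apply: eq_bigr => i _; rewrite tnth_mktuple; case: (tnth y i); case: (tnth z i).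
Qed.

Lemma sum_card_prefix (R : realType) n1 n2 (C : {set (n1 + n2).-tuple bool}) (r : nat) :
  (\sum_(u : n1.-tuple bool) #|[set y in C | hdist (pre y) u == r]| = #|C| * 'C(n1, r))%N.
Proof.
under eq_bigr do rewrite -sum1_card big_mkcond /=.
rewrite exchange_big /= -sum_nat_const [RHS]big_mkcond; apply: eq_bigr => y _ /=.
case: ifP => yC.
  rewrite -(card_sphere R (pre y) r) -sum1_card [RHS]big_mkcond; apply: eq_bigr => u _.
  by rewrite !inE yC.
by rewrite big1 // => u _; rewrite inE yC.
Qed.

(** A family has on average |C| C(n1, r) / 2^n1 >= 2 L members, so losing [L] of them per prefix
    costs at most half of the total. *)
Lemma straight_line_finite (R : realType) (p : R) n1 n2 (C : {set (n1 + n2).-tuple bool}) (r L : nat) (q : R) :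
  0 <= p -> p <= 1 -> (0 < L)%N -> 0 <= q ->
  (forall (I : finType) (B : {set I}) (c : I -> n2.-tuple bool), #|B| = L -> L%:R * q <= qerr p B c) ->
  2 * 2 ^+ n1 * L%:R <= #|C|%:R * 'C(n1, r)%:R :> R ->
  p ^+ r * (1 - p) ^+ (n1 - r) * ('C(n1, r)%:R * #|C|%:R * q) <= 2 * qerr p C id.
Proof.
move=> p0 p1 L0 q0 hB hC; set Pr := p ^+ r * _.
have Pr0 : 0 <= Pr by rewrite mulr_ge0 ?exprn_ge0 ?subr_ge0.
have h := qerr_prefix p0 p1 C r; rewrite -/Pr in h.
have : Pr * ((#|C|%:R * 'C(n1, r)%:R - 2 ^+ n1 * L%:R) * q) <= qerr p C id.
  apply: le_trans h; rewrite -mulr_sumr ler_wpM2l //.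
  have -> : (#|C|%:R * 'C(n1, r)%:R - 2 ^+ n1 * L%:R) * q =
      \sum_(u : n1.-tuple bool) (#|[set y in C | hdist (pre y) u == r]|%:R - L%:R) * q.
    rewrite -mulr_suml sumrB -natr_sum (sum_card_prefix R) natrM sumr_const card_tuple card_bool.
    by rewrite -[L%:R *+ _]mulr_natl natrX.
  apply: ler_sum => u _; apply: (qerr_family p0 p1 _ L0 q0) => B; exact: hB.
move=> h2; apply: le_trans (ler_wpM2l (ler0n R 2) h2).
rewrite [leRHS]mulrCA; apply: ler_wpM2l => //; rewrite [leRHS]mulrA; apply: ler_wpM2r => //.
by move: hC; clear; lra.
Qed.

Section StraightLine.
Variables (R : realType) (x s : R).

Local Notation p := (px x).
Local Notation rh := (rhx x).
Local Notation logx := (ln (1 + x) - ln (1 - x)).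

Lemma logx_ge0 : adm x s -> 0 <= logx.
Proof. by case=> _ _ x0 x1 _; rewrite subr_ge0 ler_ln ?posrE; lra. Qed.

Lemma htau_le_exponent : adm x s -> htau s <= ln (1 + x ^+ 2).
Proof.
move=> A; have [_ q0 x20 x21] := admP A; have [s0 sle _ _ xs] := A.
apply: le_trans (htau_le_half s0 sle) _.
have -> : s / (1 + s ^+ 2) = x ^+ 2 / 2 by rewrite xs; field; rewrite gt_eqF // ltr_wpDr ?sqr_ge0.
have i0 : 0 < (1 + x ^+ 2)^-1 by rewrite invr_gt0.
have := ln_le_subr1 i0; rewrite lnV ?posrE //.
have -> : (1 + x ^+ 2)^-1 = 1 - x ^+ 2 / (1 + x ^+ 2) by field; rewrite gt_eqF.
have : x ^+ 2 / 2 <= x ^+ 2 / (1 + x ^+ 2) by rewrite ler_wpM2l ?(ltW x20) // lef_pV2 ?posrE //; lra.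
lra.
Qed.

(** Either the distinct words number at least half of the family and form a code of the right size,
    or repetitions alone account for an error of half the family. *)
Lemma base_family (eps : R) : adm x s -> 0 < eps ->
  exists2 nu : R, 0 < nu <= eps & exists n0, forall n, (n0 <= n)%N ->
    forall (I : finType) (B : {set I}) (c : I -> n.-tuple bool),
    2 * expR (n%:R * (htau s - nu)) <= #|B|%:R -> #|B|%:R <= expR (n%:R * htau s) ->
    #|B|%:R * (expR (- (n%:R * (ln (1 + x ^+ 2) - htau s + eps))) / 2) <= qerr p B c.
Proof.
move=> A eps0; have [nu nu01 [n0 hn0]] := base_code A eps0; exists nu => //.
have [p0 p1] := andP (p01 A).
exists n0 => n hn I B c hB1 hB2; set f := expR (- _).
have f0 : 0 <= f by apply: expR_ge0.
have f1 : f <= 1.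
  rewrite -expR0 ler_expR oppr_le0 mulr_ge0 // addr_ge0 ?(ltW eps0) // subr_ge0.
  exact: htau_le_exponent.
have [h|h] := leP (#|B|%:R / 2) (#|c @: B|%:R : R).
  apply: le_trans (qerr_image (ltW p0) (ltW p1) B c); apply: le_trans (hn0 n hn _ _ _).
  - by rewrite -/f mulrCA mulrC ler_wpM2r.
  - by apply: le_trans h; rewrite ler_pdivlMr // mulrC.
  - by apply: le_trans hB2; rewrite ler_nat leq_imset_card.
apply: le_trans (qerr_repetition (ltW p0) (ltW p1) B c).
have : #|B|%:R * f <= #|B|%:R * 1 by rewrite ler_wpM2l.
by move: h; clear; lra.
Qed.

(** At the typical radius, C(n, r) is 2^n exp(- n gfun x) up to small factors. Moreover p^r (1 -
    p)^(n - r) is rh^r (1 - rh)^(n - r) times Z / (1 + x^2)^n, with Z about exp(n gfun x). So the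
    prefix block has the exponent ln (1 + x^2) - gfun x of the critical rate. *)
Lemma prefix_bounds n r : adm x s -> (r <= n)%N ->
  1 <= n.+1%:R * ('C(n, r)%:R * rh ^+ r * (1 - rh) ^+ (n - r)) ->
  r%:R <= n.+1%:R * rh -> n.+1%:R * rh <= r.+1%:R ->
  2 ^+ n * expR (- (n%:R * gfun x + logx)) <= n.+1%:R * 'C(n, r)%:R /\
  expR (n%:R * (gfun x - ln (1 + x ^+ 2)) - logx) <=
    n.+1%:R * ('C(n, r)%:R * (p ^+ r * (1 - p) ^+ (n - r))).
Proof.
move=> A rn hm h1 h2; have [_ _ x0 x1 _] := A; have [_ q0 _ _] := admP A.
have L0 := logx_ge0 A; have a0 : 0 < 1 - x by lra.
have b0 : 0 < 1 + x by lra.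
pose Z := expR (r%:R * ln (1 - x) + (n%:R - r%:R) * ln (1 + x)).
have ZE : (1 - x) ^+ r * (1 + x) ^+ (n - r) = Z.
  by rewrite !exprn_expR // -expRD natrB.
have rhE : rh ^+ r * (1 - rh) ^+ (n - r) = Z / 2 ^+ n.
  have -> : 1 - rh = (1 + x) / 2 by rewrite /rhx; field.
  by rewrite /rhx !expr_div_n mulf_div ZE -exprD subnKC.
have pE' : p ^+ r * (1 - p) ^+ (n - r) = rh ^+ r * (1 - rh) ^+ (n - r) * (Z / (1 + x ^+ 2) ^+ n).
  have -> : p = rh * ((1 - x) / (1 + x ^+ 2)) by rewrite /px /rhx; field; rewrite gt_eqF.
  have -> : 1 - rh * ((1 - x) / (1 + x ^+ 2)) = (1 - rh) * ((1 + x) / (1 + x ^+ 2)).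
    by rewrite /rhx; field; rewrite gt_eqF.
  have -> : Z / (1 + x ^+ 2) ^+ n = (1 - x) ^+ r / (1 + x ^+ 2) ^+ r * ((1 + x) ^+ (n - r) / (1 + x ^+ 2) ^+ (n - r)).
    by rewrite mulf_div ZE -exprD subnKC.
  by rewrite !exprMn !exprVn; ring.
have Zlo : expR (n%:R * gfun x - logx) <= Z.
  rewrite ler_expR.
  have : r%:R * logx <= (n%:R * rh + 1) * logx.
    apply: ler_wpM2r => //; apply: le_trans h1 _; rewrite -natr1 mulrDl mul1r lerD2l /rhx; lra.
  by rewrite /gfun /rhx; lra.
have Zhi : Z <= expR (n%:R * gfun x + logx).
  rewrite ler_expR.
  have : (n%:R * rh - 1) * logx <= r%:R * logx.
    apply: ler_wpM2r => //; move: h2; rewrite -natr1 mulrDl mul1r -[r.+1%:R]natr1 /rhx; lra.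
  by rewrite /gfun /rhx; lra.
have t0 : (0 : R) < 2 ^+ n by rewrite exprn_gt0.
have Z0 : 0 < Z by apply: expR_gt0.
have hm' : 1 <= n.+1%:R * ('C(n, r)%:R * (Z / 2 ^+ n)) by rewrite -rhE [X in _ * X]mulrA.
split.
  apply: (@le_trans _ _ (2 ^+ n / Z)).
    by rewrite ler_wpM2l ?(ltW t0) // expRN lef_pV2 ?posrE ?expR_gt0.
  rewrite ler_pdivrMr // -[leLHS]mul1r -ler_pdivlMr //.
  by apply: le_trans hm' _; rewrite !mulrA.
rewrite pE' rhE [X in _ <= _ * X]mulrA [leRHS]mulrA; apply: (@le_trans _ _ (Z / (1 + x ^+ 2) ^+ n)).
  rewrite ler_pdivlMr ?exprn_gt0 // (exprn_expR n q0) -expRD; apply: le_trans Zlo.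
  by rewrite ler_expR; lra.
by rewrite -[leLHS]mul1r ler_wpM2r // divr_ge0 ?(ltW Z0) // exprn_ge0 // ltW.
Qed.

Lemma straight_line (Rn eps : R) : adm x s -> 0 < eps -> htau s <= Rn -> Rn <= gfun x ->
  exists n0, forall n, (n0 <= n)%N -> forall C : {set n.-tuple bool},
    expR (n%:R * Rn) <= #|C|%:R ->
    #|C|%:R * expR (- (n%:R * (ln (1 + x ^+ 2) - Rn + eps))) <= qerr p C id.
Proof.
move=> A eps0 HR RG; set E := ln (1 + x ^+ 2); set H := htau s; set G := gfun x.
have [s0 sle x0 x1 xs] := A; have [p0 p1] := andP (p01 A).
have H0 : 0 < H by apply: htau_gt0 => //; move: sle; clear; lra.
(* The bound by [H] ensures nu <= H, so that exp(k (H - nu)) is at least 1. *)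
pose e1 := Num.min (eps / 4) H.
have e10 : 0 < e1 by rewrite lt_min H0 divr_gt0.
have e1a : e1 <= eps / 4 by rewrite ge_min lexx.
have e1b : e1 <= H by rewrite ge_min lexx orbT.
have [nu /andP[nu0 nu1] [n2 hn2]] := base_family A e10.
have D0 : 0 < G - H + nu by move: HR RG nu0; rewrite -/H -/G; clear; lra.
(* The fraction of coordinates put in the prefix. It solves lam G + (1 - lam)(H - nu) = Rn - nu,
   which leaves a margin exp(n nu) for the average size of a suffix family to exceed 2 L. *)
pose lam := (Rn - H) / (G - H + nu).
have lam0 : 0 <= lam by rewrite divr_ge0 ?(ltW D0) // subr_ge0.
have lamE : lam * (G - H + nu) = Rn - H by rewrite divfK // gt_eqF.
have lam1 : lam < 1 by rewrite ltr_pdivrMr // mul1r; move: RG nu0; rewrite -/G; clear; lra.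
have l1 : 0 < 1 - lam by rewrite subr_gt0.
have L0 := logx_ge0 A.
have [n3 hn3] := @archi_linear R n2%:R (1 - lam) l1.
have [n4 hn4] := @poly_le_expR R (8 * expR logx) nu 1 nu0.
have e4 : 0 < eps / 4 by rewrite divr_gt0.
have [n5 hn5] := @poly_le_expR R (4 * expR (G - H + logx)) (eps / 4) 1 e4.
have [n6 hn6] := @poly_le_expR R 4 ((1 - lam) * nu) 0 (mulr_gt0 l1 nu0).
exists (maxn (maxn n3 n4) (maxn n5 n6)) => n hn.
have [hna hnb hnc hnd] : [/\ (n3 <= n)%N, (n4 <= n)%N, (n5 <= n)%N & (n6 <= n)%N].
  by move: hn; clear; split; lia.
have {hn3}hn3 := hn3 n hna; have {hn4}hn4 := hn4 n hnb; have {hn5}hn5 := hn5 n hnc.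
have {hn6}hn6 := hn6 n hnd; rewrite expr0 mulr1 in hn6; rewrite expr1 in hn4 hn5.
clear hn hna hnb hnc hnd.
have [n1 [k [nE h1 h2]]] : exists n1 k, [/\ n = (n1 + k)%N, n1%:R <= lam * n%:R & lam * n%:R < n1%:R + 1].
  have ln0 : 0 <= lam * n%:R by rewrite mulr_ge0.
  have /andP[t1 t2] := truncn_itv ln0.
  exists (Num.trunc (lam * n%:R)), (n - Num.trunc (lam * n%:R))%N; split => //.
    rewrite subnKC // -(ler_nat R); apply: le_trans t1 _.
    by rewrite -[leRHS]mul1r ler_wpM2r // ltW.
  by rewrite natr1.
have nR : n%:R = n1%:R + k%:R :> R by rewrite nE natrD.
have kR : (1 - lam) * n%:R <= k%:R by move: h1; rewrite nR; clear; lra.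
have n2k : (n2 <= k)%N by rewrite -(ler_nat R); apply: le_trans kR.
clear hn3.
have k0 : 0 <= k%:R * (H - nu) by rewrite mulr_ge0 // subr_ge0 (le_trans nu1).
pose a := expR (k%:R * (H - nu)); have a1 : 1 <= a by rewrite -expR0 ler_expR.
have [L [La Lb]] : exists L : nat, 2 * a <= L%:R /\ L%:R <= 4 * a.
  have a0 : 0 <= 2 * a by move: a1; clear; lra.
  have /andP[t1 t2] := truncn_itv a0.
  exists (Num.trunc (2 * a)).+1; split; first exact: ltW.
  by rewrite -natr1; move: t1 a1; clear; lra.
have L0' : (0 < L)%N by rewrite -(ltr_nat R); apply: lt_le_trans La; move: a1; clear; lra.
have Lc : L%:R <= expR (k%:R * H).
  apply: le_trans Lb _; have -> : k%:R * H = nu * k%:R + k%:R * (H - nu) by ring.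
  rewrite expRD ler_wpM2r ?expR_ge0 //; apply: le_trans hn6 _; rewrite ler_expR -mulrA mulrCA.
  by rewrite ler_wpM2l // ltW.
pose q := expR (- (k%:R * (E - H + e1))) / 2.
have q0 : 0 <= q by rewrite divr_ge0 ?expR_ge0.
have hB (I : finType) (B : {set I}) (c : I -> k.-tuple bool) : #|B| = L -> L%:R * q <= qerr p B c.
  by move=> cB; have := hn2 k n2k I B c; rewrite cB => /(_ La Lc).
have [rh0 rh1] := rh_gt0 A.
have rh01 : 0 < rh < 1 by rewrite rh0 /= -subr_gt0.
have [r [rn hm hr1 hr2]] := @binomial_mode R n1 rh rh01.
have [B1 B2] := prefix_bounds A rn hm hr1 hr2.
clear hn2 hm hr1 hr2; subst n => C hC.
have N1 : (0 : R) < n1.+1%:R by rewrite ltr0n.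
have N1n : n1.+1%:R <= (n1 + k).+1%:R :> R by rewrite ler_nat ltnS leq_addr.
have hC2 : 2 * 2 ^+ n1 * L%:R <= #|C|%:R * 'C(n1, r)%:R :> R.
  rewrite -(ler_pM2l N1) [leRHS]mulrCA.
  have c0 : (0 : R) <= #|C|%:R by [].
  apply: le_trans (ler_wpM2l c0 B1).
  have t0 : (0 : R) <= 2 ^+ n1 by rewrite exprn_ge0.
  have -> : n1.+1%:R * (2 * 2 ^+ n1 * L%:R) = 2 ^+ n1 * (2 * n1.+1%:R * L%:R) :> R by ring.
  rewrite [leRHS]mulrCA; apply: ler_wpM2l => //.
  apply: le_trans (ler_wpM2r (expR_ge0 _) hC).
  rewrite -expRD; apply: (@le_trans _ _ (expR (nu * (n1 + k)%:R - logx) * a)).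
    rewrite expRD expRN; apply: (@le_trans _ _ (8 * (n1 + k).+1%:R * a)).
      have -> : 8 * (n1 + k).+1%:R * a = 2 * (n1 + k).+1%:R * (4 * a) by ring.
      by apply: ler_pM => //; apply: ler_wpM2l.
    apply: ler_wpM2r; first exact: expR_ge0.
    by rewrite ler_pdivlMr ?expR_gt0 // mulrAC.
  rewrite -expRD ler_expR.
  have : n1%:R * (G - H + nu) <= lam * (n1 + k)%:R * (G - H + nu) by apply: ler_wpM2r h1; exact: ltW.
  rewrite [lam * _ * _]mulrAC lamE nR /G; clear; lra.
have F := straight_line_finite (ltW p0) (ltW p1) L0' q0 hB hC2.
set Pr := p ^+ r * _ in F B2.
set T := expR (- _).
have K : n1.+1%:R * (2 * T) <= expR (n1%:R * (G - E) - logx) * q.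
  rewrite /q [leRHS]mulrA ler_pdivlMr // -expRD.
  apply: (@le_trans _ _ ((4 * (n1 + k).+1%:R) * T)).
    have T0 : 0 <= T by apply: expR_ge0.
    have := ler_wpM2r T0 N1n; clear; lra.
  apply: (@le_trans _ _ (expR (eps / 4 * (n1 + k)%:R - (G - H + logx)) * T)).
    apply: ler_wpM2r; first exact: expR_ge0.
    by rewrite expRD expRN ler_pdivlMr ?expR_gt0 // mulrAC.
  rewrite -expRD ler_expR.
  have GH : 0 <= G - H by move: HR RG; rewrite -/H -/G; clear; lra.
  have g1 : (lam * (n1 + k)%:R - 1) * (G - H) <= n1%:R * (G - H).
    by apply: ler_wpM2r => //; move: h2; clear; lra.
  have g2 : lam * (n1 + k)%:R * (G - H) = (Rn - H) * (n1 + k)%:R - lam * nu * (n1 + k)%:R.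
    by rewrite -lamE; ring.
  have g3 : lam * nu * (n1 + k)%:R <= nu * (n1 + k)%:R.
    by apply: ler_wpM2r => //; rewrite -[leRHS]mul1r; apply: ler_wpM2r; exact: ltW.
  have g4 : nu * (n1 + k)%:R <= eps / 4 * (n1 + k)%:R.
    by apply: ler_wpM2r => //; apply: le_trans e1a.
  have g5 : e1 * k%:R <= eps / 4 * (n1 + k)%:R.
    by apply: ler_pM => //; [exact: ltW|rewrite ler_nat leq_addl].
  have g6 : 0 <= eps * (n1 + k)%:R by rewrite mulr_ge0 // ltW.
  by move: g1 g2 g3 g4 g5 g6; rewrite nR; clear; lra.
have N2 : 0 < n1.+1%:R * 2 :> R by rewrite mulr_gt0.
rewrite -(ler_pM2l N2) -[leRHS]mulrA; apply: le_trans (ler_wpM2l (ltW N1) F).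
have -> : n1.+1%:R * 2 * (#|C|%:R * T) = #|C|%:R * (n1.+1%:R * (2 * T)) by ring.
have -> : n1.+1%:R * (Pr * ('C(n1, r)%:R * #|C|%:R * q)) = #|C|%:R * (n1.+1%:R * ('C(n1, r)%:R * Pr) * q) by ring.
by apply: ler_wpM2l => //; apply: le_trans K _; apply: ler_wpM2r.
Qed.

End StraightLine.

(** * Achievability *)

Section Achievability.
Variable R : realType.

Lemma sum_expr_hdist n (g : R) (y : n.-tuple bool) : \sum_(z : n.-tuple bool) g ^+ hdist y z = (1 + g) ^+ n.
Proof.
have e (z : n.-tuple bool) : g ^+ hdist y z = \prod_(i < n) (if tnth y i != tnth z i then g else 1).
  by rewrite -expr_hdist expr1n mulr1.
rewrite (eq_bigr _ (fun z _ => e z)) (sum_tuple_prod (fun i b => if tnth y i != b then g else 1)).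
rewrite (eq_bigr (fun=> 1 + g)) ?prodr_const ?card_ord // => i _.
by case: (tnth y i) => /=; rewrite // addrC.
Qed.

(** As long as the code fills at most half of the cube, averaging over its complement yields a word
    whose sum over [C] is at most twice the mean [k%:R * th]. *)
Lemma greedy_code n (g : R) k : 0 <= g -> (2 * k <= 2 ^ n)%N ->
  exists2 C : {set n.-tuple bool}, #|C| = k &
    \sum_(y in C) \sum_(z in C) g ^+ hdist y z <= k%:R + 2 * k%:R ^+ 2 * ((1 + g) ^+ n / 2 ^+ n).
Proof.
move=> g0; set th := (1 + g) ^+ n / 2 ^+ n.
have th0 : 0 <= th by rewrite divr_ge0 ?exprn_ge0 ?addr_ge0.
elim: k => [_|k IH hk].
  by exists finset.set0; rewrite ?cards0 // big_set0 expr0n /= mulr0 mul0r addr0.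
have [|C cC hC] := IH; first by move: hk; clear; lia.
have [v vC hv] : exists2 v, v \notin C & \sum_(y in C) g ^+ hdist v y <= 2 * k%:R * th.
  apply: contrapT => hno.
  have h v : v \in ~: C -> 2 * k%:R * th < \sum_(y in C) g ^+ hdist v y.
    by rewrite inE ltNge => vC; apply/negP => hv; apply: hno; exists v.
  have tot : \sum_(v in ~: C) \sum_(y in C) g ^+ hdist v y <= k%:R * (1 + g) ^+ n.
    rewrite exchange_big /= -cC mulr_natl -sumr_const; apply: ler_sum => y _.
    rewrite -(sum_expr_hdist g y) [leRHS](bigID (mem (~: C))) /= ler_wpDr //.
      by apply: sumr_ge0 => v _; rewrite exprn_ge0.
    by apply: ler_sum => v _; rewrite hdistC.
  have cCC : (2 ^ n <= 2 * #|~: C|)%N.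
    by have := cardsC C; rewrite card_tuple card_bool cC; move: hk; clear; lia.
  have [v0 v0C] : exists v0, v0 \in ~: C.
    by apply/set0Pn; rewrite -card_gt0; move: cCC; have := expn_gt0 2 n; clear; lia.
  have lower : #|~: C|%:R * (2 * k%:R * th) < \sum_(v in ~: C) \sum_(y in C) g ^+ hdist v y.
    rewrite mulr_natl -sumr_const; apply: ltr_sum; last by move=> v; apply: h.
    by apply/hasP; exists v0; rewrite ?mem_index_enum.
  have : k%:R * (1 + g) ^+ n <= #|~: C|%:R * (2 * k%:R * th).
    have t0 : (0 : R) < 2 ^+ n by rewrite exprn_gt0.
    have -> : k%:R * (1 + g) ^+ n = 2 ^+ n * (k%:R * th) by rewrite /th; field; rewrite gt_eqF.
    have -> : #|~: C|%:R * (2 * k%:R * th) = 2 * #|~: C|%:R * (k%:R * th) by ring.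
    have c2 : 2 ^+ n <= 2 * #|~: C|%:R :> R by rewrite -natrX -natrM ler_nat.
    by apply: ler_wpM2r c2; rewrite mulr_ge0.
  by move=> /(le_lt_trans)/(_ lower)/lt_le_trans/(_ tot); rewrite ltxx.
exists (v |: C); first by rewrite cardsU1 vC cC.
rewrite big_setU1 //= big_setU1 //= hdistxx expr0.
under [X in _ + X]eq_bigr do rewrite big_setU1 //= hdistC.
rewrite big_split /= -natr1.
have := mulr_ge0 (ler0n R k) th0; lra.
Qed.

(** At each output every word i other than a maximiser j has W_i <= sqrt(W_i W_j). Summed over all
    outputs, sqrt(W_i W_j) factorises over coordinates into (2 a b)^d. *)
Lemma qerr_bhattacharyya n (C : {set n.-tuple bool}) (p a b : R) :
  0 <= a -> 0 <= b -> p = a ^+ 2 -> 1 - p = b ^+ 2 ->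
  qerr p C id <= \sum_(y in C) \sum_(z in C | z != y) (2 * (a * b)) ^+ hdist y z.
Proof.
move=> a0 b0 pa pb; have p0 : 0 <= p by rewrite pa sqr_ge0.
have p1 : p <= 1 by rewrite -subr_ge0 pb sqr_ge0.
pose B z (y : n.-tuple bool) := a ^+ hdist y z * b ^+ (n - hdist y z).
have B0 z y : 0 <= B z y by rewrite mulr_ge0 ?exprn_ge0.
have WB z y : W p z y = B z y ^+ 2 by rewrite /W pb pa (exprAC a 2) (exprAC b 2) -exprMn.
have BB y z : (2 * (a * b)) ^+ hdist y z = \sum_(u : n.-tuple bool) B u y * B u z.
  transitivity (\sum_(u : n.-tuple bool) \prod_(i < n)
     ((if tnth y i != tnth u i then a else b) * (if tnth z i != tnth u i then a else b))).
    rewrite (sum_tuple_prod (fun i t => (if tnth y i != t then a else b) * (if tnth z i != t then a else b))).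
    have -> : (2 * (a * b)) ^+ hdist y z = \prod_(i < n) (if tnth y i != tnth z i then 2 * (a * b) else 1).
      by rewrite -expr_hdist expr1n mulr1.
    apply: eq_bigr => i _.
    have ab : 1 = a ^+ 2 + b ^+ 2 by rewrite -pa -pb; ring.
    by case: (tnth y i); case: (tnth z i) => /=; first [ring | rewrite ab; ring].
  by apply: eq_bigr => u _; rewrite big_split /= /B !expr_hdist.
under [leRHS]eq_bigr do under eq_bigr do rewrite BB.
under [leRHS]eq_bigr do rewrite exchange_big /=.
rewrite [leRHS]exchange_big /=; apply: ler_sum => u _ /=.
have [->|C0] := eqVneq C finset.set0; first by rewrite !big_set0 subr0.
have [i0 i0C] := set0Pn _ C0.
have [j jC [-> jmax]] := @bigmax_attained R _ C (fun i => W p u i) i0 i0C (W_ge0 p0 p1 u).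
rewrite (bigD1 j) //= addrAC subrr add0r [leRHS](bigD1 j) //= ler_wpDr //.
  by apply: sumr_ge0 => y _; apply: sumr_ge0 => z _; rewrite mulr_ge0.
apply: ler_sum => i /andP[iC _]; rewrite WB expr2 ler_wpM2r //.
by have := jmax i iC; rewrite !WB ler_pXn2r ?nnegrE.
Qed.

Lemma achievability n M (x s : R) : adm x s -> (2 * M <= 2 ^ n)%N ->
  exists2 C : {set n.-tuple bool}, #|C| = M &
    qerr (px x) C id <= 2 * M%:R ^+ 2 / (1 + x ^+ 2) ^+ n.
Proof.
move=> A hM; have [[x0 x1] q0 _ _] := admP A; have [g0 g1] := andP (gam01 A).
have [C cC hC] := greedy_code (ltW g0) hM; exists C => //.
have [p0 p1] := andP (p01 A).
have sp : Num.sqrt (px x) * Num.sqrt (1 - px x) = gamx x / 2.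
  rewrite -sqrtrM ?(ltW p0) //.
  have -> : px x * (1 - px x) = (gamx x / 2) ^+ 2.
    by rewrite expr_div_n -(p_gam A); field.
  by rewrite sqrtr_sqr ger0_norm // divr_ge0 // ltW.
have pa : px x = Num.sqrt (px x) ^+ 2 by rewrite sqr_sqrtr // ltW.
have pb : 1 - px x = Num.sqrt (1 - px x) ^+ 2 by rewrite sqr_sqrtr // subr_ge0 ltW.
apply: le_trans (qerr_bhattacharyya C (sqrtr_ge0 _) (sqrtr_ge0 _) pa pb) _.
rewrite sp (_ : 2 * (gamx x / 2) = gamx x); last by field.
have -> : \sum_(y in C) \sum_(z in C | z != y) gamx x ^+ hdist y z =
   \sum_(y in C) \sum_(z in C) gamx x ^+ hdist y z - M%:R.
  rewrite -cC -sumr_const -sumrB; apply: eq_bigr => y yC.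
  by rewrite [in RHS](bigD1 y) //= hdistxx expr0 addrAC subrr add0r.
rewrite lerBlDl; apply: le_trans hC _; rewrite lerD2l.
have -> : (1 + gamx x) ^+ n / 2 ^+ n = ((1 + x ^+ 2) ^+ n)^-1; last by [].
rewrite -expr_div_n -exprVn; congr (_ ^+ n).
apply: (mulIf (negbT (gt_eqF q0))); rewrite mulVf ?gt_eqF // mulrAC (gam_x A) divff //.
Qed.

End Achievability.

(** * The reliability function *)

Lemma limn_esup_eq (R : realType) (u : nat -> \bar R) (l : R) :
  (forall e : R, 0 < e -> exists n0, forall n, (n0 <= n)%N -> ((l - e)%:E <= u n /\ u n <= (l + e)%:E)%E) ->
  limn_esup u = l%:E.
Proof.
move=> hu; have cv : cvgn (esups u) by apply: is_cvg_esups.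
rewrite limn_esup_lim; apply/eqP; rewrite eq_le; apply/andP; split.
  apply/lee_addgt0Pr => e e0; have [n0 hn0] := hu e e0.
  apply: lime_le => //; exists n0 => // n /= hn.
  apply: ge_ereal_sup => _ [k /= nk <-].
  by have [_] := hn0 k (leq_trans hn nk); rewrite EFinD.
apply/lee_addgt0Pr => e e0; have [n0 hn0] := hu e e0.
rewrite -leeBlDr //; apply: lime_ge => //; exists n0 => // n /= hn.
have [h _] := hn0 n hn; rewrite -EFinB; apply: le_trans h _.
by apply: ereal_sup_ubound; exists n => /=.
Qed.

(** * Comparison of [R1] with the linear programming rate *)

Section RateComparison.
Variable R : realType.

(** The inverse of the map taking s to 2 s / (1 + s^2) on [0, 1], in the form without division by
    [u]. *)
Definition sigma (u : R) : R := u / (1 + Num.sqrt (1 - u ^+ 2)).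

Lemma sigmaP (u : R) : 0 <= u <= 1 ->
  u = 2 * sigma u / (1 + sigma u ^+ 2) /\
  (1 - Num.sqrt (1 - u ^+ 2)) / 2 = sigma u ^+ 2 / (1 + sigma u ^+ 2).
Proof.
move=> /andP[u0 u1]; have w0 := sqrtr_ge0 (1 - u ^+ 2).
have u2 : 0 <= 1 - u ^+ 2 by rewrite subr_ge0 expr_le1.
have := sqr_sqrtr u2; rewrite /sigma; move: (Num.sqrt _) w0 => w w0 wE.
have q : 0 < 1 + w by lra.
have qn : 1 + w != 0 by rewrite gt_eqF.
have uE : u ^+ 2 = 1 - w ^+ 2 by lra.
have e : 1 + (u / (1 + w)) ^+ 2 = 2 / (1 + w) by rewrite expr_div_n uE; field.
by rewrite e expr_div_n uE; split; field.
Qed.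

Lemma sigma_gt0 (u : R) : 0 < u -> 0 < sigma u.
Proof. by move=> u0; rewrite divr_gt0 // ltr_wpDr ?sqrtr_ge0. Qed.

Lemma sigma_le (u v : R) : 0 <= u -> u <= v -> v <= 1 -> sigma u <= sigma v.
Proof.
move=> u0 uv v1; have v0 := le_trans u0 uv.
have i0 : 0 <= (1 + Num.sqrt (1 - u ^+ 2))^-1 by rewrite invr_ge0 addr_ge0 ?sqrtr_ge0.
apply: ler_pM => //.
rewrite lef_pV2 ?posrE ?ltr_wpDr ?sqrtr_ge0 // lerD2l ler_wsqrtr // lerD2l lerN2.
by rewrite ler_pXn2r ?nnegrE.
Qed.

Lemma ln2_gt0 : 0 < ln 2 :> R.
Proof. by rewrite ln_gt0 // ltr1n. Qed.

Lemma h_gfun (y : R) : -1 < y -> y < 1 -> ln 2 * h ((1 - y) / 2) = ln 2 - gfun y.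
Proof.
move=> y1 y2; have l2 := ln2_gt0; rewrite /h /log2.
have -> : 1 - (1 - y) / 2 = (1 + y) / 2 by field.
have a0 : 0 < 1 - y by lra.
have b0 : 0 < 1 + y by lra.
rewrite !ln_div ?posrE // /gfun; by field; rewrite gt_eqF.
Qed.

Lemma h_htau (t : R) : 0 < t -> ln 2 * h (t ^+ 2 / (1 + t ^+ 2)) = htau t.
Proof.
move=> t0; have l2 := ln2_gt0; rewrite /h /log2 /htau.
have q0 : 0 < 1 + t ^+ 2 by rewrite ltr_wpDr ?sqr_ge0.
have -> : 1 - t ^+ 2 / (1 + t ^+ 2) = (1 + t ^+ 2)^-1 by field; rewrite gt_eqF.
rewrite ln_div ?posrE ?exprn_gt0 // lnV ?posrE // lnXn // mulr2n.
by field; rewrite !gt_eqF.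
Qed.

Lemma h0 : h 0 = 0 :> R.
Proof. by rewrite /h /log2 mul0r subr0 ln1 mul0r mulr0 subr0 oppr0. Qed.

Lemma gfun_lt_ln2 (x : R) : 0 < x < 1 -> gfun x < ln 2.
Proof.
move=> /andP[x0 x1]; have a0 : 0 < 1 - x by lra.
have b0 : 0 < 1 + x by lra.
have l1 : ln (1 - x) <= 0 by apply: ln_le0; lra.
have l2 : 0 <= ln (1 + x) by apply: ln_ge0; lra.
have l3 : ln (1 + x) < ln 2 by rewrite ltr_ln ?posrE //; lra.
have h1 : 0 <= (1 - x) * - ln (1 - x) by rewrite mulr_ge0 ?oppr_ge0 // ltW.
have h2 : 0 <= (1 - x) * ln (1 + x) by rewrite mulr_ge0 // ltW.
by rewrite /gfun; lra.
Qed.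

(** The number squared inside [tau] is u / 2 with y^2 = (x^2 - u)(1 + u). After gfun y >= y^2 / 2,
    the claim is [entropy_decrease] between [sigma u] and [s]. *)
Lemma htau_le_gap (x s y : R) : adm x s -> 59 / 200 <= dlx x -> 0 <= y -> y <= x ->
  htau s <= ln 2 * h (tau ((1 - y) / 2) (dlx x / 2)) + gfun y.
Proof.
move=> A hd y0 yx; have [s0 sle x0 x1 xs] := A; have [_ _ x20 x21] := admP A.
have [dl dlE xE] : exists2 dl, dlx x = dl & x ^+ 2 = 1 - 2 * dl by exists (dlx x) => //; rewrite /dlx; field.
rewrite dlE in hd *; have dl0 : 0 < dl by move: hd; clear; lra.
have dl1 : 0 <= 1 - dl by move: xE x20; clear; lra.
have y2 : y ^+ 2 <= 1 - 2 * dl by rewrite -xE ler_pXn2r ?nnegrE // ltW.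
have gy : y ^+ 2 / 2 <= gfun y.
  have := @gfun_ge R y; rewrite y0 (le_lt_trans yx x1) => /(_ isT); apply: le_trans.
  by rewrite -!addrA lerDl !addr_ge0 ?divr_ge0 ?exprn_ge0.
have arg : dl ^+ 2 <= (1 - dl) ^+ 2 - y ^+ 2 by move: y2; clear; lra.
have arg0 : 0 <= (1 - dl) ^+ 2 - y ^+ 2 by apply: le_trans arg; apply: sqr_ge0.
have [u u0 vE] : exists2 u, 0 <= u & Num.sqrt ((1 - dl) ^+ 2 - y ^+ 2) = u + dl.
  exists (Num.sqrt ((1 - dl) ^+ 2 - y ^+ 2) - dl); last by rewrite subrK.
  by rewrite subr_ge0 -(ler_pXn2r (n := 2)) ?nnegrE ?(ltW dl0) ?sqrtr_ge0 // sqr_sqrtr.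
have v2 : (u + dl) ^+ 2 = (1 - dl) ^+ 2 - y ^+ 2 by rewrite -vE sqr_sqrtr.
have ux : u <= x ^+ 2.
  have : u + dl <= 1 - dl.
    have udl : 0 <= u + dl by rewrite addr_ge0 // ltW.
    have := @ler_pXn2r R 2 isT _ _ udl dl1; rewrite /= v2 => <-.
    by have := sqr_ge0 y; clear; lra.
  by rewrite xE; clear; lra.
have yE : y ^+ 2 = (x ^+ 2 - u) * (1 + u) by rewrite xE; move: v2; clear; lra.
have -> : tau ((1 - y) / 2) (dl / 2) = (1 - Num.sqrt (1 - u ^+ 2)) / 2.
  rewrite /tau.
  have -> : (1 - y) / 2 * (1 - (1 - y) / 2) - dl / 2 * (1 - dl / 2) = ((1 - dl) ^+ 2 - y ^+ 2) / 2 ^+ 2.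
    by field.
  rewrite sqrtrM // vE.
  have -> : Num.sqrt (2 ^+ 2)^-1 = 2^-1 :> R by rewrite -exprVn sqrtr_sqr ger0_norm.
  have -> : 4 * ((u + dl) / 2 - dl / 2) ^+ 2 = u ^+ 2 by field.
  by [].
have s12 : 0 < 1 + s ^+ 2 by rewrite ltr_wpDr ?sqr_ge0.
have s1 : s <= 1 by move: sle; clear; lra.
have sE : sigma (x ^+ 2) = s.
  rewrite /sigma.
  have -> : 1 - (x ^+ 2) ^+ 2 = ((1 - s ^+ 2) / (1 + s ^+ 2)) ^+ 2.
    by rewrite xs; field; rewrite gt_eqF.
  rewrite sqrtr_sqr ger0_norm; last by rewrite divr_ge0 ?(ltW s12) // subr_ge0 expr_le1 ?(ltW s0).
  have -> : 1 + (1 - s ^+ 2) / (1 + s ^+ 2) = 2 / (1 + s ^+ 2) by field; rewrite gt_eqF.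
  by rewrite xs; field; rewrite gt_eqF.
(* u = 0 is the case y = x, where [sigma u] = 0 is outside the range of [entropy_decrease]; the
   bound htau s <= x^2 / 2 replaces it. *)
move: u0; rewrite le_eqVlt => /orP[/eqP u0|u0].
  rewrite -u0 expr0n /= subr0 sqrtr1 subrr mul0r h0 mulr0 add0r.
  have := htau_le_half s0 sle; rewrite (_ : s / (1 + s ^+ 2) = x ^+ 2 / 2); last first.
    by rewrite xs; field; rewrite gt_eqF.
  have : y ^+ 2 = x ^+ 2 by rewrite yE -u0; ring.
  by move: gy; clear; lra.
have u01 : 0 <= u <= 1 by rewrite ltW //= (le_trans ux) // ltW.
have [us tE] := sigmaP u01; rewrite tE h_htau; last exact: sigma_gt0.
have st : sigma u <= s by rewrite -sE sigma_le // ltW.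
have := @entropy_decrease R (sigma u) s dl (sigma_gt0 u0) st sle hd.
rewrite -us -xs; move: gy; rewrite yE xE; clear; lra.
Qed.

Lemma Rbar_ge (x s : R) : adm x s -> 59 / 200 <= dlx x -> htau s <= ln 2 * Rbar (dlx x).
Proof.
move=> A hd; have l2 := ln2_gt0; have [_ _ x0 x1 _] := A.
have dE : 1 - 2 * dlx x = x ^+ 2 by rewrite /dlx; field.
rewrite /Rbar dE sqrtr_sqr gtr0_norm // [leRHS]mulrC -ler_pdivrMr // -lerBlDl.
apply: lb_le_inf.
  by exists (h (tau (1 / 2) (dlx x / 2)) - h (1 / 2)); exists (1 / 2) => //=; move: x0; clear; lra.
move=> _ [al /= /andP[al1 al2] <-].
rewrite lerBlDl ler_pdivrMr // [leRHS]mulrC mulrDr mulr1 mulrBr.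
have [y alE] : exists y, al = (1 - y) / 2 by exists (1 - 2 * al); field.
have y0 : 0 <= y by move: al2; rewrite alE; clear; lra.
have yx : y <= x by move: al1; rewrite alE; clear; lra.
have := htau_le_gap A hd y0 yx.
have -> : ln 2 * h al = ln 2 - gfun y by rewrite alE h_gfun //; move: y0 yx x1; clear; lra.
by rewrite -alE; clear; lra.
Qed.

Lemma parameters (p : R) : 46%:R / 1000%:R <= p -> p < 1 / 2 ->
  exists x s : R, [/\ adm x s, 59 / 200 <= dlx x, px x = p, rho p = (1 - x) / 2 & delta1 p = dlx x].
Proof.
move=> hp' p2; have hp : 23 / 500 <= p by move: hp'; clear; lra.
clear hp'; have p0 : 0 < p by move: hp; clear; lra.
pose a := Num.sqrt p; pose b := Num.sqrt (1 - p).
have a0 : 0 < a by rewrite sqrtr_gt0.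
have b0 : 0 < b by rewrite sqrtr_gt0; lra.
have aE : a ^+ 2 = p by rewrite sqr_sqrtr // ltW.
have bE : b ^+ 2 = 1 - p by rewrite sqr_sqrtr //; lra.
have ab : a < b by rewrite ltr_sqrt //; lra.
have d0 : 0 < a + b by rewrite addr_gt0.
have dn : a + b != 0 by rewrite gt_eqF.
pose x := (b - a) / (a + b); pose eta := x ^+ 2.
have x0 : 0 < x by rewrite divr_gt0 // subr_gt0.
have x1 : x < 1 by rewrite ltr_pdivrMr // mul1r; lra.
have q1 : 1 + x ^+ 2 = 2 / (a + b) ^+ 2.
  have -> : (2 : R) = 2 * (a ^+ 2 + b ^+ 2) by rewrite aE bE; ring.
  by rewrite /x; field.
have pxE : px x = p by rewrite /px q1 -aE /x; field.
have rhoE : rho p = (1 - x) / 2 by rewrite /rho -/a -/b /x; field.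
have d1E : delta1 p = dlx x by rewrite /delta1 rhoE /dlx; field.
(* 121/289 is ((1 - s) / (1 + s))^2 at s = 3/14. The square of 2 a b is 4 p (1 - p), bounded below
   by its chord on [23/500, 1/2]. *)
have ab2 : 121 / 289 <= 2 * (a * b).
  have c0 : 0 <= 121 / 289 :> R by clear; lra.
  have := @ler_pXn2r R 2 isT _ _ c0 (mulr_ge0 (ler0n R 2) (mulr_ge0 (ltW a0) (ltW b0))) => /= <-.
  rewrite !exprMn aE bE.
  have := mulr_ge0 (_ : 0 <= p - 23 / 500) (_ : 0 <= 1 / 2 - p); rewrite !subr_ge0 => /(_ hp (ltW p2)).
  by move: hp; clear; lra.
(* 84/205 is 2 s / (1 + s^2) at s = 3/14, and [eta] is (1 - gamma) / (1 + gamma) with gamma = 2 a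
   b. *)
have eta1 : eta <= 84 / 205.
  have g0 : 0 < 1 + 2 * (a * b) by rewrite ltr_wpDr ?mulr_ge0 ?(ltW a0) ?(ltW b0).
  have -> : eta = (1 - 2 * (a * b)) / (1 + 2 * (a * b)).
    have -> : 1 - 2 * (a * b) = (b - a) ^+ 2 by move: aE bE; clear; lra.
    have -> : 1 + 2 * (a * b) = (b + a) ^+ 2 by move: aE bE; clear; lra.
    by rewrite /eta /x expr_div_n [b + a]addrC.
  by rewrite ler_pdivrMr //; move: ab2; clear; lra.
have eta0 : 0 < eta by rewrite exprn_gt0.
have eta01 : 0 <= eta <= 1 by rewrite ltW //=; move: eta1; clear; lra.
have [e1 e2] := sigmaP eta01.
exists x, (sigma eta); split => //; last by rewrite /dlx -/eta; move: eta1; clear; lra.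
split => //; first exact: sigma_gt0.
have e84 : (84 / 205 : R) <= 1 by clear; lra.
apply: le_trans (sigma_le (ltW eta0) eta1 e84) _; rewrite /sigma.
have -> : 1 - (84 / 205) ^+ 2 = (187 / 205) ^+ 2 :> R by field.
have e0 : 0 <= 187 / 205 :> R by clear; lra.
rewrite sqrtr_sqr (ger0_norm e0).
by have -> : 84 / 205 / (1 + 187 / 205) = 3 / 14 :> R by field.
Qed.

End RateComparison.

(** * Upper and lower bounds for the best exponent *)

Section Exponents.
Variables (R : realType) (p x s : R).
Hypotheses (A : adm x s) (pE' : px x = p) (rhoE : rho p = (1 - x) / 2).

Lemma Rcrit_gfun : ln 2 * Rcrit p = gfun x.
Proof.
have [_ _ x0 x1 _] := A; rewrite /Rcrit rhoE mulrBr mulr1 h_gfun //; last by lra.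
by rewrite subKr.
Qed.

Lemma E0_ln Rt : ln 2 * E0 Rt p = ln (1 + x ^+ 2) - ln 2 * Rt.
Proof.
rewrite /E0 mulrBr mulrDr Rcrit_gfun; congr (_ - _).
have [_ _ x0 x1 _] := A; have [_ q0 _ _] := admP A; have l2 := ln2_gt0 R.
have a0 : 0 < 1 - x by rewrite subr_gt0.
have b0 : 0 < 1 + x by rewrite addr_gt0.
rewrite /Dkl /log2 rhoE.
have -> : (1 - x) / 2 / p = (1 + x ^+ 2) / (1 - x) by rewrite -pE' /px; field; rewrite !gt_eqF.
have -> : (1 - (1 - x) / 2) / (1 - p) = (1 + x ^+ 2) / (1 + x).
  by rewrite -pE' (pE A); field; rewrite !gt_eqF.
rewrite !ln_div ?posrE // /gfun; by field; rewrite gt_eqF.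
Qed.

Lemma best_exponent_le (Rt eps : R) : 0 < eps -> htau s <= ln 2 * Rt -> Rt <= Rcrit p ->
  exists n0, forall n, (n0 <= n)%N -> (best_exponent Rt p n <= (E0 Rt p + eps)%:E)%E.
Proof.
move=> eps0 h1 h2; have l2 := ln2_gt0 R.
have [s0 sle _ _ _] := A; have H0 : 0 < htau s by apply: htau_gt0 => //; lra.
have Rt0 : 0 < Rt by rewrite -(pmulr_rgt0 _ l2); lra.
have h2' : ln 2 * Rt <= gfun x by rewrite -Rcrit_gfun ler_wpM2l // ltW.
have e2 : 0 < eps * ln 2 by rewrite mulr_gt0.
have [n0 hn0] := straight_line A e2 h1 h2'.
exists n0.+1 => n hn; have n1 : (0 < n)%N by apply: leq_trans hn.
have nR : (0 : R) < n%:R by rewrite ltr0n.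
apply/bigmax_leP; split => [|C hC]; first exact: leNye.
(* By the convention ln 0 = 0 the empty code has rate 0, which is below [Rt]. *)
have C0 : (0 < #|C|)%N.
  rewrite lt0n; apply/negP => /eqP c0; move: hC; rewrite /rate c0 /log2 ln0 // !mul0r; lra.
have CR : (0 : R) < #|C|%:R by rewrite ltr0n.
have lnC : n%:R * (ln 2 * Rt) <= ln #|C|%:R.
  by move: hC; rewrite /rate /log2 ler_pdivlMr // ler_pdivlMr // mulrC [Rt * _]mulrC mulrA; lra.
have eC : expR (n%:R * (ln 2 * Rt)) <= #|C|%:R by rewrite -[leRHS]lnK ?posrE // ler_expR.
have [p0 p1] := andP (p01 A).
have CN : C != finset.set0 by rewrite -card_gt0.
have := hn0 n (ltnW hn) C eC; rewrite -(Pe_qerr (px x) CN) pE' ler_pM2l // => hPe.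
have Pe0 : 0 < Pe C p by apply: lt_le_trans hPe; apply: expR_gt0.
rewrite /exponent Pe0 lee_fin /log2 ler_pdivrMr // -mulNr ler_pdivrMr //.
have : - (n%:R * (ln (1 + x ^+ 2) - ln 2 * Rt + eps * ln 2)) <= ln (Pe C p).
  by rewrite -[leLHS]expRK ler_ln ?posrE ?expR_gt0.
rewrite -E0_ln; lra.
Qed.

Lemma best_exponent_ge (Rt eps : R) : 0 < eps -> 0 < Rt -> Rt <= Rcrit p ->
  exists n0, forall n, (n0 <= n)%N -> ((E0 Rt p - eps)%:E <= best_exponent Rt p n)%E.
Proof.
move=> eps0 Rt0 h2; have l2 := ln2_gt0 R.
have [s0 sle x0 x1 _] := A; have [_ q0 _ _] := admP A.
have x01 : 0 < x < 1 by rewrite x0.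
have h2' : ln 2 * Rt <= gfun x by rewrite -Rcrit_gfun ler_wpM2l // ltW.
have g2 := gfun_lt_ln2 x01.
have d0 : 0 < ln 2 - ln 2 * Rt by lra.
have e2 : 0 < eps * ln 2 by rewrite mulr_gt0.
have [n3 hn3] := @poly_le_expR R 4 _ 0 d0.
have [n4 hn4] := @poly_le_expR R 4 _ 0 e2.
exists (maxn n3 n4).+1 => n hn; have n1 : (0 < n)%N by apply: leq_trans hn.
have nR : (0 : R) < n%:R by rewrite ltr0n.
have {hn3}hn3 := hn3 n (leq_trans (leq_maxl n3 n4) (ltnW hn)).
have {hn4}hn4 := hn4 n (leq_trans (leq_maxr n3 n4) (ltnW hn)).
rewrite expr0 mulr1 in hn3; rewrite expr0 mulr1 in hn4.
pose a := expR (n%:R * (ln 2 * Rt)).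
have a1 : 1 <= a by rewrite -expR0 ler_expR !mulr_ge0 // ltW.
have [M [Ma Mb]] : exists M : nat, a <= M%:R /\ M%:R <= 2 * a.
  have a0 : 0 <= a by lra.
  have /andP[t1 t2] := truncn_itv a0.
  exists (Num.trunc a).+1; split; first exact: ltW.
  by rewrite -natr1; lra.
have MR : (0 : R) < M%:R by lra.
(* The greedy code may fill only half of the cube; there is room because gfun x < ln 2. *)
have hM : (2 * M <= 2 ^ n)%N.
  rewrite -(ler_nat R) natrM natrX; have t2 : (0 : R) < 2 by [].
  rewrite (exprn_expR n t2).
  have -> : n%:R * ln 2 = (ln 2 - ln 2 * Rt) * n%:R + n%:R * (ln 2 * Rt) by ring.
  rewrite expRD -/a; apply: (@le_trans _ _ (4 * a)); first by clear -Mb; lra.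
  by rewrite ler_wpM2r // expR_ge0.
have [C cC hC] := achievability A hM.
have [p0 p1] := andP (p01 A).
have CN : C != finset.set0 by rewrite -card_gt0 cC -(ltr_nat R).
apply: (bigmax_sup C) => //.
  rewrite /rate cC /log2 ler_pdivlMr // ler_pdivlMr //.
  have : n%:R * (ln 2 * Rt) <= ln M%:R by rewrite -[leLHS]expRK ler_ln ?posrE ?expR_gt0.
  by lra.
rewrite /exponent; case: ifP => [Pe0|_]; last by rewrite leey.
rewrite lee_fin /log2 ler_pdivlMr // -mulNr ler_pdivlMr //.
have hPe : Pe C p <= expR (eps * ln 2 * n%:R + n%:R * (ln 2 * Rt) - n%:R * ln (1 + x ^+ 2)).
  move: hC; rewrite -(Pe_qerr (px x) CN) pE' cC.
  have -> : 2 * M%:R ^+ 2 / (1 + x ^+ 2) ^+ n = M%:R * (2 * M%:R / (1 + x ^+ 2) ^+ n) by ring.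
  rewrite ler_pM2l // => /le_trans; apply.
  rewrite ler_pdivrMr ?exprn_gt0 // (exprn_expR n q0) -expRD subrK expRD -/a.
  apply: (@le_trans _ _ (4 * a)); first by clear -Mb; lra.
  by rewrite ler_wpM2r // expR_ge0.
have : ln (Pe C p) <= eps * ln 2 * n%:R + n%:R * (ln 2 * Rt) - n%:R * ln (1 + x ^+ 2).
  by rewrite -[leRHS]expRK ler_ln ?posrE ?expR_gt0.
have := E0_ln Rt; move: (E0 Rt p) => e eE.
have -> : ln (1 + x ^+ 2) = ln 2 * e + ln 2 * Rt by rewrite eE subrK.
by clear -eE; lra.
Qed.

End Exponents.

Theorem theorem17 (R : realType) (p : R) :
  46%:R / 1000%:R <= p -> p < 1 / 2 ->
  forall Rt : R, R1 p <= Rt -> Rt <= Rcrit p ->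
  reliability Rt p = (E0 Rt p)%:E.
Proof.
move=> hp p2 Rt h1 h2; have [x [s [A hd pE' rhoE d1E]]] := parameters hp p2.
have l2 := ln2_gt0 R.
have hR : htau s <= ln 2 * Rt.
  apply: le_trans (Rbar_ge A hd) _; rewrite ler_wpM2l ?(ltW l2) //.
  by rewrite -d1E.
have Rt0 : 0 < Rt.
  rewrite -(pmulr_rgt0 _ l2); apply: lt_le_trans hR; have [s0 sle _ _ _] := A.
  by apply: htau_gt0 => //; lra.
apply: limn_esup_eq => e e0.
have [n1 hn1] := best_exponent_le A pE' rhoE e0 hR h2.
have [n2 hn2] := best_exponent_ge A pE' rhoE e0 Rt0 h2.
exists (maxn n1 n2) => n; rewrite geq_max => /andP[a b]; split; [exact: hn2|exact: hn1].
Qed.
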